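(* Let $c>0$. Then for any $f\in \mathcal{B}_c$ and any integer $N\geq \frac{ec}{2}$, $$\|f-\mathcal{L}_Nf\|_{L^\infty(-1,1)}\leq \sqrt{\frac{c}{2N+5}}\left(\frac{ec}{2N+5}\right)^{N}\| f\|_{L^2(\mathbb{R})}$$ and $$\|f-\mathcal{L}_Nf\|_{L^2(-1,1)}\leq \sqrt{c}\left(\frac{ec}{2N+5}\right)^{N+1}\| f\|_{L^2(\mathbb{R})}.$$
   Context: $\mathcal{B}_c=\{f\in L^2(\mathbb{R}):\ \operatorname{Supp}\widehat f\subseteq[-c,c]\}$ is the Paley-Wiener space of $c$-bandlimited functions, with the Fourier transform normalized by $\widehat{f}(\omega)=\frac{1}{\sqrt{2\pi}}\int_{\mathbb{R}}f(t)e^{-it\omega}\,\mathrm{d}t$. $P_k$ is the classical Legendre polynomial of degree $k$ with $P_k(1)=1$, and $\tilde P_k=\sqrt{k+1/2}\,P_k$, so that $(\tilde P_k)_{k\geq 0}$ is an orthonormal basis of $L^2([-1,1])$. For $f\in L^2(\mathbb{R})$, $\mathcal{L}_Nf=\sum_{k=0}^{N}\langle \mathbf{1}_{(-1,1)}f,\tilde P_k\rangle\,\tilde P_k\mathbf{1}_{(-1,1)}$, the inner product being that of $L^2([-1,1])$. *)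

(* Defs.v *)
From HB Require Import structures.
From mathcomp Require Export all_boot all_order all_algebra.
From mathcomp Require Export all_classical all_reals all_analysis.
From mathcomp Require Export complex.

Set Implicit Arguments.
Unset Strict Implicit.
Unset Printing Implicit Defensive.

Export Order.TTheory GRing.Theory Num.Theory.
Export numFieldNormedType.Exports.

Local Open Scope classical_set_scope.
Local Open Scope ring_scope.
Local Open Scope complex_scope.

Section PaleyWiener.
Context {R : realType}.
Let mu := @lebesgue_measure R.
Implicit Types (f g : R -> R[i]) (D : set R).

Definition Cintegral D f : R[i] :=
  (\int[mu]_(t in D) complex.Re (f t)) +i* (\int[mu]_(t in D) complex.Im (f t)).

Definition cis (theta : R) : R[i] := cos theta +i* sin theta.

(* Extending by zero outside D does not change the norm of L^p(D), for p = +oo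
   included, since |f| is nonnegative. *)
Definition LpnormC (p : \bar R) D f : \bar R :=
  'N[mu]_p[(fun t => (Normc.normc (f t))%:E) \_ D]%E.

(* Elements of L^2 are represented by functions; no choice of a representative
   is made, every notion below being invariant under a.e. equality. *)
Definition L2C f : Prop :=
  [/\ measurable_fun [set: R] (fun t => complex.Re (f t)),
      measurable_fun [set: R] (fun t => complex.Im (f t)) &
      (LpnormC 2%:E [set: R] f < +oo)%E].

Definition fourier_integral D f (w : R) : R[i] :=
  (Num.sqrt (2 * pi))^-1%:C * Cintegral D (fun t => f t * cis (- (t * w))).

(* g is the Fourier-Plancherel transform of f in L^2: the integral over R need
   not converge, and g is the L^2 limit of the transforms of the truncations
   f 1_[-n, n], which are in L^1 and L^2. *)
Definition is_fourier_transform f g : Prop :=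
  L2C g /\
  (fun n : nat => LpnormC 2%:E [set: R]
     (fun w => g w - fourier_integral `[- n%:R, n%:R] f w)) @ \oo --> 0%E.

(* The support of a class of functions modulo a.e. equality: the complement of
   the union of the open sets on which g vanishes almost everywhere. *)
Definition ess_support g : set R :=
  ~` \bigcup_(U in [set U : set R |
                 open U /\ {ae mu, forall w, U w -> g w = 0}]) U.

Definition bandlimited (c : R) f : Prop :=
  L2C f /\
  exists2 g, is_fourier_transform f g & ess_support g `<=` `[- c, c].

(* Rodrigues' formula *)
Definition legendre (k : nat) : {poly R} :=
  (2 ^+ k * k`!%:R)^-1 *: (('X ^+ 2 - 1) ^+ k)^`(k).

Definition nlegendre (k : nat) (x : R) : R :=
  Num.sqrt (k%:R + 1 / 2) * (legendre k).[x].

Definition innerC D f g : R[i] := Cintegral D (fun t => f t * conjc (g t)).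

Definition legendre_proj (N : nat) f (x : R) : R[i] :=
  \sum_(0 <= k < N.+1)
     innerC `[- 1, 1] (fun t => (\1_(`]- 1, 1[%classic) t)%:C * f t)
                      (fun t => (nlegendre k t)%:C)
     * (nlegendre k x * \1_(`]- 1, 1[%classic) x)%:C.

End PaleyWiener.

(* Main.v *)
(* A c-bandlimited f is a.e. equal to (2 pi)^(-1/2) int_{-c}^{c} g(w) e^{ixw} dw
   with ||g|| <= ||f||, so f - L_N f is the same superposition of the errors
   E_w := (1 - L_N) e^{iw.}, and by Cauchy-Schwarz
     |f - L_N f|^2 (x) <= (2 pi)^(-1) ||f||^2 int_{-c}^{c} |E_w(x)|^2 dw.
   By Rodrigues' formula the k-th term of the Legendre expansion of e^{iw.} is
   i^k w^k phi_k(w) / (2k-1)!! times a factor of modulus at most 1, where phi_k is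
   the mean of cos(w.) for the weight (1 - x^2)^k on [-1,1].  Clearly |phi_k| <= 1;
   a three-term recurrence moreover gives phi_k <= exp(- w^2 / (2 (2k+3))) for
   small w, hence |w phi_k| <= sqrt((2k+3) / e).  So the expansion of E_w is
   dominated by a geometric series, whose even and odd terms feed the real and the
   imaginary part respectively.  Integrating in w, both bounds come down to the
   size of ((2M+3)/e)^(2M) / ((2M-1)!!)^2 for M = N + 1: it is computed for M <= 6,
   and its quotient by 2M - 1 decreases. *)
Require Import Defs.
From mathcomp Require Import measurable_realfun ess_sup_inf ring lra zify.

Set Implicit Arguments.
Unset Strict Implicit.
Unset Printing Implicit Defensive.

Local Open Scope classical_set_scope.
Local Open Scope ring_scope.

(** * Integrals of real functions on the line, and Fubini for bounded kernels *)

Section RealIntegrals.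
Context {R : realType}.
Notation mu := (@lebesgue_measure R).
Implicit Types (u v k : R -> R).

(** The transform is given only as an L^2 limit of truncated integrals, so its inversion and the
    bound on ||g|| are proved on real and imaginary parts: transforms with phases 0 and -pi/2
    (cosine and sine) replace complex exponentials. The damping exp(-|w|/(n+1)) makes Fubini
    legitimate and turns products of transforms into Poisson kernels. For the norm an inequality of
    Plancherel type is enough; equality is needed only against indicators of intervals, which
    determine a function a.e. by Lebesgue differentiation.

    The bound |phi_k| <= 1 alone yields the L^2 estimate for every N. For the uniform estimate,
    whose exponent is N and not N+1, it would require amp * growth * (2N)^2 / ((2N+3)(2N+5)) <= pi;
    as growth tends to e^3/2, this fails for large N, and it is used for N <= 3 only. From N = 4 on,
    |w phi_k| <= sqrt((2k+3)/e) replaces one power of w, which gains a factor of order N. The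
    remaining slack is small, and this is why e, pi and the ratio q of the geometric majorant are
    estimated by explicit rationals. *)

Definition rint u := mu.-integrable [set: R] (EFin \o u).

Lemma rint_meas u : rint u -> measurable_fun [set: R] u.
Proof. by move=> /measurable_int /measurable_EFinP. Qed.

Lemma rint_le u v : measurable_fun [set: R] u -> rint v ->
  (forall x, `|u x| <= v x) -> rint u.
Proof.
move=> mu' iv h; apply: (le_integrable measurableT _ _ iv) => //.
  exact/measurable_EFinP.
by move=> x _ /=; rewrite lee_fin (le_trans (h x))// ler_norm.
Qed.

Lemma rintZ (a : R) u : rint u -> rint (fun x => a * u x).
Proof. by move=> /(integrableZl measurableT a). Qed.

Lemma rintD u v : rint u -> rint v -> rint (fun x => u x + v x).
Proof. by move=> iu /(integrableD measurableT iu). Qed.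

Lemma rintB u v : rint u -> rint v -> rint (fun x => u x - v x).
Proof. by move=> iu /(integrableB measurableT iu). Qed.

Lemma rint_abs u : rint u -> rint (fun x => `|u x|).
Proof. by move=> /integrable_abse. Qed.

Lemma rintMb (M : R) u k : rint u -> measurable_fun [set: R] k ->
  (forall x, `|k x| <= M) -> rint (fun x => u x * k x).
Proof.
move=> iu mk kM; apply: (@rint_le _ (fun x => M * `|u x|)).
- by apply: measurable_funM => //; exact: rint_meas.
- exact/rintZ/rint_abs.
- by move=> x; rewrite normrM mulrC ler_wpM2r.
Qed.

Lemma Rint_bound (M : R) u k : rint u -> measurable_fun [set: R] k ->
  (forall x, `|k x| <= M) ->
  `|\int[mu]_x (u x * k x)| <= M * \int[mu]_x `|u x|.
Proof.
move=> iu mk kM.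
have iuk := rintMb iu mk kM.
rewrite (le_trans (le_normr_Rintegral measurableT iuk))//.
rewrite -RintegralZl//; last exact: rint_abs.
apply: le_Rintegral => //; [exact: (rint_abs iuk)|exact/rintZ/rint_abs|].
by move=> x _; rewrite normrM mulrC ler_wpM2r.
Qed.

Lemma ksec1 (K : R * R -> R) t : measurable_fun [set: R * R] K ->
  measurable_fun [set: R] (fun w => K (t, w)).
Proof. by move=> mK; exact: (measurableT_comp mK (measurable_pair1 t)). Qed.

Lemma ksec2 (K : R * R -> R) w : measurable_fun [set: R * R] K ->
  measurable_fun [set: R] (fun t => K (t, w)).
Proof. by move=> mK; exact: (measurableT_comp mK (measurable_pair2 w)). Qed.

Section Swap.
Variables (K : R * R -> R) (M : R) (u v : R -> R).
Hypotheses (mK : measurable_fun [set: R * R] K) (KM : forall z, `|K z| <= M)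
  (iu : rint u) (iv : rint v).

Let F (z : R * R) := (u z.1 * v z.2 * K z)%:E.

Let mF : measurable_fun [set: R * R] F.
Proof.
apply/measurable_EFinP; apply: measurable_funM => //.
apply: measurable_funM.
  by apply: measurableT_comp => //; exact: rint_meas.
by apply: measurableT_comp => //; exact: rint_meas.
Qed.

(** By Tonelli it suffices that the iterated integral of |u(x) v(y) K(x,y)| is finite; it is at most
    M ||u||_1 ||v||_1. *)
Let iF : (mu \x mu)%E.-integrable [set: R * R] F.
Proof.
apply: (integrable12ltyP mu mu mF).2.
have M0 : 0 <= M by rewrite (le_trans _ (KM (0, 0))).
apply: (@le_lt_trans _ _ (\int[mu]_x ((`|u x|)%:E * (\int[mu]_y (M * `|v y|)%:E)))%E).
  apply: ge0_le_integral => //.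
  - by move=> x _; exact: integral_ge0.
  - apply: (@measurable_fun_fubini_tonelli_F _ _ _ _ _ mu (abse \o F)) => //=.
    exact: measurableT_comp mF.
  - by apply: emeasurable_funM => //; apply/measurable_EFinP; apply: measurableT_comp => //; exact: rint_meas.
  - move=> x _; rewrite -ge0_integralZl//; last first.
    + by move=> y _; rewrite lee_fin mulr_ge0.
    + apply/measurable_EFinP/measurable_funM => //.
      by apply: measurableT_comp => //; exact: rint_meas.
    apply: ge0_le_integral => //.
    + apply: measurableT_comp => //.
      exact: (measurableT_comp mF (measurable_pair1 x)).
    + apply/measurable_EFinP/measurable_funM => //; apply/measurable_funM => //.
      by apply: measurableT_comp => //; exact: rint_meas.
    + move=> y _; rewrite /F /= -?EFinM lee_fin !normrM -mulrA ler_wpM2l// mulrC.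
      by rewrite ler_wpM2r.
have [r ->] : exists r : R, (\int[mu]_y (M * `|v y|)%:E)%E = r%:E.
  exists (fine (\int[mu]_y (M * `|v y|)%:E)%E); rewrite fineK//.
  by apply: integrable_fin_num => //; exact: (rintZ M (rint_abs iv)).
under eq_integral do rewrite -EFinM mulrC.
have : rint (fun x => r * `|u x|) by exact/rintZ/rint_abs.
by move=> /(integrable_fin_num measurableT); rewrite fin_numElt => /andP[].
Qed.

Lemma inner1 x : fubini_F mu F x = (u x * \int[mu]_y (v y * K (x, y)))%:E.
Proof.
have ivK : rint (fun y => v y * K (x, y)).
  by apply: (rintMb iv (ksec1 x mK)) => y; exact: KM.
rewrite /fubini_F /F /=; under eq_integral do rewrite -mulrA EFinM.
rewrite integralZl// EFinM /Rintegral fineK//.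
exact: integrable_fin_num.
Qed.

Lemma inner2 y : fubini_G mu F y = (v y * \int[mu]_x (u x * K (x, y)))%:E.
Proof.
have iuK : rint (fun x => u x * K (x, y)).
  by apply: (rintMb iu (ksec2 y mK)) => x; exact: KM.
rewrite /fubini_G /F /=; under eq_integral do rewrite mulrAC mulrC EFinM.
rewrite integralZl// EFinM /Rintegral fineK//.
exact: integrable_fin_num.
Qed.

Lemma swap_int1 : rint (fun x => u x * \int[mu]_y (v y * K (x, y))).
Proof.
by have := integrable_fubini_F iF; congr (_.-integrable _ _); apply/funext => x; exact: inner1.
Qed.

Lemma swap_eq : \int[mu]_x (u x * \int[mu]_y (v y * K (x, y))) =
  \int[mu]_y (v y * \int[mu]_x (u x * K (x, y))).
Proof.
rewrite /Rintegral; congr fine.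
under eq_integral do rewrite -inner1.
under [RHS]eq_integral do rewrite -inner2.
exact: (Fubini iF).
Qed.

End Swap.

Lemma swap_int2 (K : R * R -> R) (M : R) u v :
  measurable_fun [set: R * R] K -> (forall z, `|K z| <= M) ->
  rint u -> rint v -> rint (fun y => v y * \int[mu]_x (u x * K (x, y))).
Proof.
move=> mK KM iu iv.
apply: (@swap_int1 (fun z => K (z.2, z.1)) M v u) => //.
exact: (measurableT_comp mK (@measurable_swap _ _ _ _)).
Qed.

End RealIntegrals.

(** * The Fourier transform of exp(-e|x|) *)

Section ExpKernel.
Context {R : realType}.
Notation mu := (@lebesgue_measure R).
Implicit Types (u v k : R -> R).

Lemma is_derive_expRZ (k x : R) :
  is_derive x (1 : R) (fun y : R => expR (k * y)) (k * expR (k * x)).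
Proof.
apply: (is_derive_eq (is_derive1_comp (f := @expR R) (g := fun y : R => k * y) _ _)).
by rewrite mulrC /GRing.scale /= mulr1.
Qed.

Lemma is_derive_cosDZ (u a x : R) :
  is_derive x (1 : R) (fun y : R => cos (u * y + a)) (- u * sin (u * x + a)).
Proof.
apply: (is_derive_eq (is_derive1_comp (f := @cos R) (g := fun y : R => u * y + a) _ _)).
rewrite /GRing.scale /= mulr1 addr0; ring.
Qed.

Lemma is_derive_sinDZ (u a x : R) :
  is_derive x (1 : R) (fun y : R => sin (u * y + a)) (u * cos (u * x + a)).
Proof.
apply: (is_derive_eq (is_derive1_comp (f := @sin R) (g := fun y : R => u * y + a) _ _)).
rewrite /GRing.scale /= mulr1 addr0; ring.
Qed.

Lemma continuous_cosDZ (u a : R) : continuous (fun y : R => cos (u * y + a)).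
Proof.
move=> x; have := is_derive_cosDZ u a x => -[h _].
exact/differentiable_continuous/derivable1_diffP.
Qed.

Lemma continuous_expRZ (u : R) : continuous (fun y : R => expR (u * y)).
Proof.
move=> x; have := is_derive_expRZ u x => -[h _].
exact/differentiable_continuous/derivable1_diffP.
Qed.

Section HalfLine.
Variables (e u a : R).
Hypothesis e0 : 0 < e.

(** Adding 1 to the cosine makes the integrand nonnegative, so that the fundamental theorem on a
    half-line and the additivity of extended integrals apply before integrability is known. [F] is
    the antiderivative that tends to 0 at +oo. [Rint_expabs_cos] removes the 1 again. *)
Let f x := expR (- e * x) * (1 + cos (u * x + a)).
Let F x := expR (- e * x) *
  (- e^-1 + (u * sin (u * x + a) - e * cos (u * x + a)) / (e ^+ 2 + u ^+ 2)).

Let den : 0 < e ^+ 2 + u ^+ 2.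
Proof. by rewrite ltr_wpDr ?sqr_ge0// exprn_gt0. Qed.

Let dF (x : R) : is_derive x (1 : R) F (f x).
Proof.
have h1 := is_derive_expRZ (- e) x.
have h2 := is_derive_cosDZ u a x.
have h3 := is_derive_sinDZ u a x.
apply: is_derive_eq.
rewrite /f /GRing.scale /=.
field.
by rewrite !gt_eqF.
Qed.

Let bF x : `|F x| <= expR (- e * x) * (e^-1 + (`|u| + e) / (e ^+ 2 + u ^+ 2)).
Proof.
rewrite /F normrM ger0_norm ?expR_ge0// ler_wpM2l ?expR_ge0//.
rewrite (le_trans (ler_normD _ _))// normrN (@ger0_norm _ e^-1) ?invr_ge0 ?(ltW e0)//.
rewrite lerD2l normrM (@ger0_norm _ _^-1) ?invr_ge0 ?(ltW den)//.
rewrite ler_wpM2r ?invr_ge0 ?(ltW den)//.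
rewrite (le_trans (ler_normB _ _))// !normrM (gtr0_norm e0) lerD//.
  by rewrite ler_piMr// sin_max.
by rewrite ler_piMr ?cos_max// ltW.
Qed.

Lemma int_halfline : (\int[mu]_(x in `[0%R, +oo[) (f x)%:E =
  (e^-1 + (e * cos a - u * sin a) / (e ^+ 2 + u ^+ 2))%:E)%E.
Proof.
have cf : continuous f.
  move=> x; apply: cvgM; first exact: continuous_expRZ.
  by apply: cvgD; [exact: cvg_cst|exact: continuous_cosDZ].
rewrite (@ge0_continuous_FTC2y _ f F 0 0).
- rewrite -EFinB; congr EFin; rewrite /F !mulr0 expR0 !add0r; ring.
- by move=> x _; rewrite mulr_ge0 ?expR_ge0// -lerBlDl sub0r cos_geN1.
- exact: continuous_subspaceT.
- set C := (e^-1 + (`|u| + e) / (e ^+ 2 + u ^+ 2)).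
  have h : expR (- e * x) * C @[x --> +oo] --> (0 : R).
    rewrite -[X in _ --> X](mul0r C); apply: cvgMl.
    under eq_fun do rewrite mulNr.
    apply: (@cvg_comp _ _ _ (fun x => e * x) (fun y => expR (- y)) _ (+oo%R : set_system R)); last exact: cvgr_expR.
    by apply: gt0_cvgMry.
  apply/norm_cvg0P; apply: (squeeze_cvgr _ (cvg_cst 0) h).
  by apply: nearW => x; rewrite normr_ge0 bF.
- by move=> x _; have [] := dF x.
- apply: cvg_at_right_filter; have [h _] := dF 0.
  exact/differentiable_continuous/derivable1_diffP.
- by move=> x _; rewrite derive1E; have [_] := dF x.
Qed.

End HalfLine.

Lemma meas_expabs (e : R) : measurable_fun [set: R] (fun w : R => expR (- e * `|w|)).
Proof.
apply: measurableT_comp; first exact: measurable_expR.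
by apply: measurable_funM => //; exact: normr_measurable.
Qed.

Lemma meas_cosDZ (u a : R) : measurable_fun [set: R] (fun y : R => cos (u * y + a)).
Proof. by apply: continuous_measurable_fun; exact: continuous_cosDZ. Qed.

(** The reflection x -> -x turns the negative half-line into the positive one with [u] replaced by
    [- u]; the sine terms of the two halves cancel. *)
Lemma int_fullline (e u a : R) : 0 < e ->
  (\int[mu]_x (expR (- e * `|x|) * (1 + cos (u * x + a)))%:E =
  (2 * e^-1 + 2 * e * cos a / (e ^+ 2 + u ^+ 2))%:E)%E.
Proof.
move=> e0; set h := fun x => _.
have mh : measurable_fun [set: R] h.
  apply/measurable_EFinP; apply: measurable_funM; first exact: meas_expabs.
  by apply: measurable_funD => //; exact: meas_cosDZ.
have h0 x : (0 <= h x)%E.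
  by rewrite lee_fin mulr_ge0 ?expR_ge0// -lerBlDl sub0r cos_geN1.
have -> : [set: R] = `]-oo, 0] `|` `]0, +oo[ :> set R.
  by rewrite itv_setU_setT.
rewrite ge0_integral_setU//=; last 2 first.
- exact: measurable_funS mh.
- by apply/disj_setPS => x /= []; rewrite !in_itv/= andbT => x1 x2; have := le_lt_trans x1 x2; rewrite ltxx.
rewrite integral_itv_obnd_cbnd; last exact: measurable_funS mh.
have -> : (\int[mu]_(x in `]-oo, 0%R]) h x = \int[mu]_(x in `[0%R, +oo[) h (- x)%R)%E.
  rewrite (@ge0_integration_by_substitution0 _ (h \o -%R))//=.
    by apply: eq_integral => x _; rewrite opprK.
  by apply: measurableT_comp => //.
have -> : (\int[mu]_(x in `[0%R, +oo[) h x)%E = (e^-1 + (e * cos a - u * sin a) / (e ^+ 2 + u ^+ 2))%:E.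
  rewrite -int_halfline//; apply: eq_integral => x; rewrite inE/= in_itv/= andbT => x0.
  by rewrite /h ger0_norm.
have -> : (\int[mu]_(x in `[0%R, +oo[) h (- x)%R)%E = (e^-1 + (e * cos a - (- u) * sin a) / (e ^+ 2 + (- u) ^+ 2))%:E.
  rewrite -int_halfline//; apply: eq_integral => x; rewrite inE/= in_itv/= andbT => x0.
  by rewrite /h normrN ger0_norm// mulrN -(mulNr u).
rewrite -EFinD sqrrN; congr EFin; ring.
Qed.

Lemma rint_expabs (e : R) : 0 < e -> rint (fun x : R => expR (- e * `|x|)).
Proof.
move=> e0; apply/integrableP; split.
  by apply/measurable_EFinP; exact: meas_expabs.
(* Frequency 0 and phase pi/2 make the cosine vanish, which leaves the exponential alone. *)
rewrite (_ : (\int[mu]_x _)%E = (\int[mu]_x (expR (- e * `|x|) * (1 + cos (0 * x + pi / 2)))%:E)%E).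
  by rewrite int_fullline// ltry.
apply: eq_integral => x _; rewrite /= mul0r add0r cos_pihalf addr0 mulr1.
by rewrite ger0_norm// expR_ge0.
Qed.

Lemma Rint_expabs_cos (e u a : R) : 0 < e ->
  \int[mu]_x (expR (- e * `|x|) * cos (u * x + a)) =
  2 * e * cos a / (e ^+ 2 + u ^+ 2).
Proof.
move=> e0.
have iE := rint_expabs e0.
have iEc : rint (fun x => expR (- e * `|x|) * cos (u * x + a)).
  by apply: (rintMb (M := 1)) => //; [exact: meas_cosDZ|move=> x; exact: cos_max].
have h1 : \int[mu]_x (expR (- e * `|x|)) = 2 * e^-1.
  have := int_fullline 0 (pi / 2) e0.
  rewrite cos_pihalf mulr0 mul0r addr0 => h.
  rewrite /Rintegral (_ : (\int[mu]_x _)%E = (2 * e^-1)%:E)// -h.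
  by apply: eq_integral => x _; rewrite /= mul0r add0r cos_pihalf addr0 mulr1.
have h2 : \int[mu]_x (expR (- e * `|x|) + expR (- e * `|x|) * cos (u * x + a)) =
    2 * e^-1 + 2 * e * cos a / (e ^+ 2 + u ^+ 2).
  rewrite /Rintegral -[RHS]/(fine (_ %:E)) -int_fullline//; congr fine.
  by apply: eq_integral => x _; rewrite mulrDr mulr1.
by move: h2; rewrite RintegralD// h1 => /addrI.
Qed.

End ExpKernel.

(** * Cosine and sine transforms *)

Section CosTransform.
Context {R : realType}.
Notation mu := (@lebesgue_measure R).
Implicit Types (u v k : R -> R).

(* [ctr u 0] and [ctr u (- (pi / 2))] are the cosine and sine transforms of u. *)
Definition ctr u (a w : R) := \int[mu]_t (u t * cos (t * w + a)).

Lemma meas_cosM (a : R) : measurable_fun [set: R * R] (fun z : R * R => cos (z.1 * z.2 + a)).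
Proof.
apply: (@measurableT_comp _ _ _ _ _ _ (@cos R)).
  by apply: continuous_measurable_fun; exact: continuous_cos.
by apply: measurable_funD => //; apply: measurable_funM.
Qed.

Lemma meas_cosM' (a : R) : measurable_fun [set: R * R] (fun z : R * R => cos (z.2 * z.1 + a)).
Proof. by have := meas_cosM a; congr measurable_fun; apply/funext => z; rewrite mulrC. Qed.

Lemma meas_cos1 (w a : R) : measurable_fun [set: R] (fun t : R => cos (t * w + a)).
Proof. by have := meas_cosDZ w a; congr measurable_fun; apply/funext => z; rewrite mulrC. Qed.

(** Fubini ([swap_int2]) shows that exp(-|w|) times the transform is integrable, hence measurable;
    it remains to divide by the exponential. *)
Lemma meas_ctr u a : rint u -> measurable_fun [set: R] (ctr u a).
Proof.
move=> iu; have := rint_meas (swap_int2 (M := 1) (meas_cosM a) (fun z => cos_max _) iu (rint_expabs ltr01)).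
move=> h; have -> : ctr u a = (fun w => (expR (- 1 * `|w|) * ctr u a w) * (expR (- 1 * `|w|))^-1).
  by apply/funext => w; rewrite mulrC mulrA mulVf ?mul1r// gt_eqF// expR_gt0.
apply: measurable_funM => //.
under eq_fun do rewrite -expRN -mulNr opprK mul1r.
apply: measurableT_comp; first exact: measurable_expR.
exact: normr_measurable.
Qed.

Lemma ctr_bound u a w : rint u -> `|ctr u a w| <= \int[mu]_t `|u t|.
Proof.
move=> iu; have := @Rint_bound _ 1 u (fun t => cos (t * w + a)) iu (meas_cos1 w a).
by rewrite mul1r; apply => x; exact: cos_max.
Qed.

(** 2 pi times the Poisson kernel, that is, the Fourier transform of exp(-e|w|); its total mass is 2
    pi. *)
Definition pker (e x : R) := 2 * e / (e ^+ 2 + x ^+ 2).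

Lemma pker_ge0 e x : 0 < e -> 0 <= pker e x.
Proof. by move=> e0; rewrite /pker divr_ge0 ?mulr_ge0 ?addr_ge0 ?sqr_ge0 ?exprn_ge0 ?ltW. Qed.

Lemma pker_le e x : 0 < e -> pker e x <= 2 / e.
Proof.
move=> e0; rewrite ler_pdivrMr ?ltr_wpDr ?sqr_ge0 ?exprn_gt0//.
rewrite mulrAC ler_pdivlMr// expr2 -mulrA ler_wpM2l//.
by rewrite lerDl sqr_ge0.
Qed.

Lemma pkerN e x : pker e (- x) = pker e x.
Proof. by rewrite /pker sqrrN. Qed.

Lemma continuous_pker e : 0 < e -> continuous (pker e).
Proof.
move=> e0 x; apply: cvgM; first exact: cvg_cst.
apply: cvgV; first by rewrite gt_eqF// ltr_wpDr ?sqr_ge0 ?exprn_gt0.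
by apply: cvgD; [exact: cvg_cst|exact: exprn_continuous].
Qed.

Lemma meas_pker e (g : R * R -> R) : 0 < e -> measurable_fun [set: R * R] g ->
  measurable_fun [set: R * R] (fun z => pker e (g z)).
Proof.
move=> e0 mg; apply: (@measurableT_comp _ _ _ _ _ _ (pker e)) => //.
by apply: continuous_measurable_fun; exact: continuous_pker.
Qed.

(** The product of the cosines is half the sum of two cosines with frequencies s + t and s - t, each
    integrated by [Rint_expabs_cos]. *)
Lemma ctr_kernel (e s t a b : R) : 0 < e ->
  \int[mu]_w (expR (- e * `|w|) * cos (t * w + b) * cos (s * w + a)) =
  2^-1 * (cos (a + b) * pker e (s + t) + cos (a - b) * pker e (s - t)).
Proof.
move=> e0.
have i1 (c d : R) : rint (fun w => expR (- e * `|w|) * cos (c * w + d)).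
  apply: (rintMb (M := 1) (rint_expabs e0)); first exact: meas_cosDZ.
  by move=> x; exact: cos_max.
transitivity (\int[mu]_w (2^-1 * (expR (- e * `|w|) * cos ((s + t) * w + (a + b)))
   + 2^-1 * (expR (- e * `|w|) * cos ((s - t) * w + (a - b))))).
  apply: eq_Rintegral => w _.
  have -> : (s + t) * w + (a + b) = (s * w + a) + (t * w + b) by ring.
  have -> : (s - t) * w + (a - b) = (s * w + a) - (t * w + b) by ring.
  by rewrite (cosD (s * w + a)) (cosB (s * w + a)); field.
rewrite RintegralD//; [|exact/rintZ/i1|exact/rintZ/i1].
rewrite !RintegralZl//; [|exact/i1|exact/i1].
rewrite !Rint_expabs_cos// /pker; field.
by rewrite !gt_eqF// ltr_wpDr ?sqr_ge0 ?exprn_gt0.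
Qed.

(** Two applications of Fubini, one for each transform, bring the integral over w inside, where
    [ctr_kernel] evaluates it. The damping supplies the integrable factor in w. *)
Lemma ctr_prod (e a b : R) u v : 0 < e -> rint u -> rint v ->
  \int[mu]_w (expR (- e * `|w|) * (ctr u a w * ctr v b w)) =
  \int[mu]_t (v t * \int[mu]_s (u s *
     (2^-1 * (cos (a + b) * pker e (s + t) + cos (a - b) * pker e (s - t))))).
Proof.
move=> e0 iu iv.
have iE := rint_expabs e0.
have iEu : rint (fun w => expR (- e * `|w|) * ctr u a w).
  apply: (rintMb iE (meas_ctr a iu)) => w; exact: ctr_bound.
under eq_Rintegral do rewrite mulrA.
rewrite (swap_eq (M := 1) (K := fun z => cos (z.2 * z.1 + b)) _ _ iEu iv)//=; last 2 first.
- exact: meas_cosM'.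
- by move=> z; exact: cos_max.
apply: eq_Rintegral => t _; congr (_ * _).
have iEt : rint (fun w => expR (- e * `|w|) * cos (t * w + b)).
  apply: (rintMb (M := 1) iE); first exact: meas_cosDZ.
  by move=> x; exact: cos_max.
transitivity (\int[mu]_w ((expR (- e * `|w|) * cos (t * w + b)) * ctr u a w)).
  by apply: eq_Rintegral => w _; rewrite mulrAC.
rewrite /ctr (swap_eq (M := 1) (K := fun z => cos (z.2 * z.1 + a)) _ _ iEt iu)//=; last 2 first.
- exact: meas_cosM'.
- by move=> z; exact: cos_max.
by apply: eq_Rintegral => s _; rewrite -ctr_kernel.
Qed.

Lemma rint_indic (a b : R) : rint (\1_`[a, b] : R -> R).
Proof.
exact: integrable_indic_itv.
Qed.

Lemma pker_itv (e a b s : R) : 0 < e -> a < b ->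
  \int[mu]_t (\1_`[a, b] t * pker e (s - t)) =
  2 * (atan (e^-1 * (b - s)) - atan (e^-1 * (a - s))).
Proof.
move=> e0 ab.
transitivity (\int[mu]_(t in `[a, b]) pker e (s - t)).
  rewrite [RHS]Rintegral_mkcond; apply: eq_Rintegral => t _.
  by rewrite patchE indicE; case: ifPn => _; rewrite ?mul1r ?mul0r.
pose F t := 2 * atan (e^-1 * (t - s)).
have dF (x : R) : is_derive x (1 : R) F (pker e (s - x)).
  have h1 : is_derive x (1 : R) (fun y : R => e^-1 * (y - s)) (e^-1).
    by apply: is_derive_eq; rewrite /GRing.scale /= subr0 mulr1.
  have h2 := is_derive1_comp (f := @atan R) (g := fun y : R => e^-1 * (y - s)) (is_derive1_atan _) h1.
  apply: is_derive_eq; rewrite /GRing.scale /= /pker.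
  field.
  rewrite !gt_eqF ?ltr_wpDr ?sqr_ge0 ?exprn_gt0//.
have cF : continuous F.
  by move=> x; have [h _] := dF x; exact/differentiable_continuous/derivable1_diffP.
rewrite /Rintegral (@continuous_FTC2 _ _ F)//.
- by rewrite /= /F; ring.
- apply: continuous_subspaceT => x; apply: (@continuous_comp _ _ _ (fun y : R => s - y) (pker e)); last exact: continuous_pker.
  by apply: cvgB; [exact: cvg_cst|exact: cvg_id].
- split; first by move=> x _; have [] := dF x.
  + exact/cvg_at_right_filter/cF.
  + exact/cvg_at_left_filter/cF.
- by move=> x _; rewrite derive1E; have [_] := dF x.
Qed.

Lemma pker_itv_le (e a b s : R) : 0 < e -> a < b ->
  0 <= \int[mu]_t (\1_`[a, b] t * pker e (s - t)) <= 2 * pi.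
Proof.
move=> e0 ab; rewrite pker_itv//; apply/andP; split.
  rewrite mulr_ge0// subr_ge0 le_atan// ler_wpM2l ?invr_ge0 ?ltW//.
  by rewrite ltrD2r.
rewrite ler_wpM2l//.
have := atan_ltpi2 (e^-1 * (b - s)); have := atan_gtNpi2 (e^-1 * (a - s)); lra.
Qed.

(** The arguments of the two arctangents tend to infinity with the signs of b - s and a - s. At an
    endpoint the limit would be pi, half of the jump, hence the two exclusions. *)
Lemma cvg_pker_itv (a b s : R) : a < b -> s != a -> s != b ->
  (\int[mu]_t (\1_`[a, b] t * pker n.+1%:R^-1 (s - t))) @[n --> \oo] -->
  2 * pi * \1_`[a, b] s.
Proof.
move=> ab sa sb.
have cp (x : R) : 0 < x -> atan (n.+1%:R * x) @[n --> \oo] --> pi / 2.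
  move=> x0; apply: (@cvg_comp _ _ _ (fun n : nat => n.+1%:R * x) (@atan R) _ (+oo%R : set_system R)); last exact: cvgy_atan.
  have h : n.+1%:R @[n --> \oo] --> (+oo%R : set_system R).
    by have := @cvgr_idn R; rewrite -(cvg_shiftS (fun n => n%:R : R)).
  apply/cvgryPge => A.
  have /cvgryPge /(_ (A / x)) := h.
  by apply: filterS => n; rewrite ler_pdivrMr.
have cn (x : R) : x < 0 -> atan (n.+1%:R * x) @[n --> \oo] --> - (pi / 2).
  move=> x0; rewrite -oppr_gt0 in x0.
  have -> : (fun n => atan (n.+1%:R * x)) = (fun n => - atan (n.+1%:R * - x)).
    by apply/funext => n; rewrite mulrN atanN opprK.
  by apply: cvgN; exact: cp.
under eq_fun do rewrite pker_itv// invrK.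
have -> : 2 * pi * \1_`[a, b] s = 2 * ((if s < b then pi / 2 else - (pi / 2)) - (if s < a then pi / 2 else - (pi / 2))) :> R.
  rewrite indicE; have [sa'|sa'|sa'] := ltgtP s a; last by rewrite sa' eqxx in sa.
    rewrite (lt_trans sa' ab) memNset; last by rewrite /= in_itv/= => /andP[]; rewrite leNgt sa'.
    by rewrite subrr !mulr0.
  have [sb'|sb'|sb'] := ltgtP s b; last by rewrite sb' eqxx in sb.
    have -> : s \in `[a, b]%classic by apply/mem_set; rewrite /= in_itv/= !ltW.
    by rewrite /=; field.
  rewrite memNset; last by rewrite /= in_itv/= => /andP[_]; rewrite leNgt sb'.
  by rewrite subrr !mulr0.
apply: cvgM; first exact: cvg_cst.
apply: cvgB.
  case: ifPn => h; first by apply: cp; rewrite subr_gt0.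
  by apply: cn; rewrite subr_lt0 lt_neqAle eq_sym sb leNgt.
case: ifPn => h; first by apply: cp; rewrite subr_gt0.
by apply: cn; rewrite subr_lt0 lt_neqAle eq_sym sa leNgt.
Qed.

End CosTransform.

(** * Plancherel's inequality, and Parseval's identity against intervals *)

Section Plancherel.
Context {R : realType}.
Notation mu := (@lebesgue_measure R).
Implicit Types (u v k h : R -> R).

(* The damping makes Fubini applicable; it is removed in the limit n -> oo. *)
Definition damp (n : nat) (w : R) : R := expR (- n.+1%:R^-1 * `|w|).

Lemma damp_ge0 n w : 0 <= damp n w. Proof. exact: expR_ge0. Qed.

Lemma damp_le1 n w : damp n w <= 1.
Proof. by rewrite /damp expR_le1 mulNr oppr_le0 mulr_ge0// invr_ge0. Qed.

Lemma meas_damp n : measurable_fun [set: R] (damp n).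
Proof. exact: meas_expabs. Qed.

Lemma nd_damp w : {homo damp^~ w : m n / (m <= n)%N >-> m <= n}.
Proof.
move=> m n mn; rewrite /damp ler_expR ler_wpM2r// lerN2 lef_pV2 ?posrE ?ltr0n//.
by rewrite ler_nat.
Qed.

Lemma cvg_damp w : damp n w @[n --> \oo] --> (1 : R).
Proof.
rewrite -[X in _ --> X](@expR0 R).
apply: (@cvg_comp _ _ _ (fun n : nat => - n.+1%:R^-1 * `|w|) (@expR R) _ (nbhs (0 : R))); last exact: continuous_expR.
have : - n.+1%:R^-1 * `|w| @[n --> \oo] --> - (0 : R) * `|w|.
  by apply: cvgM; [apply: cvgN; exact: cvg_harmonic|exact: cvg_cst].
by rewrite oppr0 mul0r.
Qed.

Lemma Rint0 h : (forall x, h x = 0) -> \int[mu]_x h x = 0.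
Proof. by move=> h0; rewrite /Rintegral integral0_eq// => x _; rewrite h0. Qed.

Lemma Rint_dct (f_ : nat -> R -> R) (f g : R -> R) :
  (forall n, measurable_fun [set: R] (f_ n)) -> measurable_fun [set: R] f ->
  {ae mu, forall x, f_ n x @[n --> \oo] --> f x} -> rint g ->
  (forall n x, `|f_ n x| <= g x) ->
  \int[mu]_x f_ n x @[n --> \oo] --> \int[mu]_x f x.
Proof.
move=> mf_ mf ff ig fg.
have [i1 _ i2] : [/\ rint f,
    (\int[mu]_x (`|(f_ n x)%:E - (f x)%:E|))%E @[n --> \oo] --> 0%E &
    (\int[mu]_x (f_ n x)%:E)%E @[n --> \oo] --> (\int[mu]_x (f x)%:E)%E].
  apply: (@dominated_convergence _ _ _ mu _ measurableT
    (fun n x => (f_ n x)%:E) (fun x => (f x)%:E) (fun x => (g x)%:E)) => //.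
  - by move=> n; apply/measurable_EFinP; exact: mf_.
  - by apply/measurable_EFinP; exact: mf.
  - by apply: (@filterS _ _ (ae_filter_ringOfSetsType mu)) ff => x fx _; apply: cvg_EFin => //; exact: nearW.
  - by apply: nearW => x n _; rewrite lee_fin.
apply: fine_cvg; rewrite /Rintegral fineK//.
exact: integrable_fin_num.
Qed.

Lemma Rint_damp h : rint h -> \int[mu]_x (damp n x * h x) @[n --> \oo] --> \int[mu]_x h x.
Proof.
move=> ih; apply: (@Rint_dct _ h (fun x => `|h x|)).
- by move=> n; apply: measurable_funM; [exact: meas_damp|exact: rint_meas].
- exact: rint_meas.
- apply: nearW => x; rewrite -[X in _ --> X]mul1r.
  by apply: cvgM; [exact: cvg_damp|exact: cvg_cst].
- exact: rint_abs.
- by move=> n x; rewrite normrM ler_piMl// ger0_norm ?damp_ge0// damp_le1.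
Qed.

(** The damping increases to 1, so monotone convergence carries the uniform bound over to [h], and
    its integrability comes along. *)
Lemma rint_damp_bound h (B : R) : measurable_fun [set: R] h -> (forall x, 0 <= h x) ->
  (forall n, rint (fun x => damp n x * h x)) ->
  (forall n, \int[mu]_x (damp n x * h x) <= B) ->
  rint h /\ \int[mu]_x h x <= B.
Proof.
move=> mh h0 ih hB.
have mdh n : measurable_fun [set: R] (fun x => damp n x * h x).
  by apply: measurable_funM => //; exact: meas_damp.
have Bn n : (\int[mu]_x (damp n x * h x)%:E <= B%:E)%E.
  by move: (hB n); rewrite -lee_fin /Rintegral fineK//; exact: (integrable_fin_num measurableT (ih n)).
have lim : (\int[mu]_x (damp n x * h x)%:E)%E @[n --> \oo] --> (\int[mu]_x (h x)%:E)%E.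
  rewrite (_ : (\int[mu]_x (h x)%:E)%E =
     (\int[mu]_x limn (fun n => (damp n x * h x)%:E))%E); last first.
    apply: eq_integral => x _; apply/esym/cvg_lim => //.
    apply: cvg_EFin; first exact: nearW.
    rewrite -[X in _ --> X]mul1r.
    by apply: cvgM; [exact: cvg_damp|exact: cvg_cst].
  apply: cvg_monotone_convergence => //.
  - by move=> n; apply/measurable_EFinP; exact: mdh.
  - by move=> n x _; rewrite lee_fin mulr_ge0 ?damp_ge0.
  - by move=> x _ m n mn; rewrite lee_fin ler_wpM2r// nd_damp.
have hle : (\int[mu]_x (h x)%:E <= B%:E)%E.
  move/cvg_lim : (lim) => <- //; apply: lime_le; first by apply/cvg_ex; eexists; exact: lim.
  exact: nearW.
have irh : rint h.
  apply/integrableP; split; first exact/measurable_EFinP.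
  under eq_integral do rewrite gee0_abs ?lee_fin//.
  by rewrite (le_lt_trans hle)// ltry.
split => //; rewrite -lee_fin /Rintegral fineK//.
exact: integrable_fin_num.
Qed.

(** The class contains truncations of L^2 functions and indicators of intervals. The bounded support
    provides the integrable weight [chi] of [plancherel_damp]. *)
Definition cs2 u := [/\ rint u, rint (fun x => u x ^+ 2) &
  exists2 M : R, 0 < M & forall x, M < `|x| -> u x = 0].

Notation ct u := (ctr u 0).
Notation st u := (ctr u (- (pi / 2))).

Lemma meas_pkerB e : 0 < e -> measurable_fun [set: R * R] (fun z : R * R => pker e (z.1 - z.2)).
Proof. by move=> e0; apply: meas_pker => //; apply: measurable_funB. Qed.

Lemma meas_pkerD e : 0 < e -> measurable_fun [set: R * R] (fun z : R * R => pker e (z.1 + z.2)).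
Proof. by move=> e0; apply: meas_pker => //; apply: measurable_funD. Qed.

Lemma pker_norm (e x : R) : 0 < e -> `|pker e x| <= 2 / e.
Proof. by move=> e0; rewrite ger0_norm ?pker_ge0// pker_le. Qed.

Lemma ctr_prod_int n u v a b : rint u -> rint v ->
  rint (fun w => damp n w * (ctr u a w * ctr v b w)).
Proof.
move=> iu iv; have iE : rint (damp n) by apply: rint_expabs; rewrite invr_gt0.
apply: (rintMb (M := (\int[mu]_t `|u t|) * (\int[mu]_t `|v t|)) iE).
  by apply: measurable_funM; exact: meas_ctr.
by move=> w; rewrite normrM ler_pM// ctr_bound.
Qed.

(** For the phases 0 and -pi/2 the coefficients cos(a+b) of the kernel at s + t are 1 and -1 and
    cancel, while cos(a-b) = 1 both times: only the convolution with the Poisson kernel remains. *)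
Lemma ctr_prod_sum n u v : rint u -> rint v ->
  \int[mu]_w (damp n w * (ct u w * ct v w + st u w * st v w)) =
  \int[mu]_t (v t * \int[mu]_s (u s * pker n.+1%:R^-1 (s - t))).
Proof.
move=> iu iv; set e := n.+1%:R^-1.
have e0 : 0 < e by rewrite invr_gt0.
under eq_Rintegral do rewrite mulrDr.
rewrite RintegralD//; [|exact: ctr_prod_int|exact: ctr_prod_int].
rewrite /damp !ctr_prod//.
have mK c d : measurable_fun [set: R * R] (fun z : R * R => 2^-1 * (c * pker e (z.1 + z.2) + d * pker e (z.1 - z.2))).
  apply: measurable_funM => //; apply: measurable_funD; apply: measurable_funM => //.
    exact: meas_pkerD.
  exact: meas_pkerB.
have KM c d (z : R * R) : `|c| <= 1 -> `|d| <= 1 ->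
    `|2^-1 * (c * pker e (z.1 + z.2) + d * pker e (z.1 - z.2))| <= 2 / e.
  move=> c1 d1; rewrite normrM ger0_norm// ler_pdivrMl//.
  rewrite (le_trans (ler_normD _ _))// (normrM c) (normrM d) mulr2n mulrDl mul1r lerD//.
    by rewrite (le_trans _ (pker_norm (z.1 + z.2) e0))// ler_piMl.
  by rewrite (le_trans _ (pker_norm (z.1 - z.2) e0))// ler_piMl.
have N1 x : `|cos x : R| <= 1 by exact: cos_max.
rewrite -RintegralD//; last 2 first.
- exact: (swap_int2 (mK _ _) (fun z => KM _ _ z (N1 _) (N1 _)) iu iv).
- exact: (swap_int2 (mK _ _) (fun z => KM _ _ z (N1 _) (N1 _)) iu iv).
apply: eq_Rintegral => t _; rewrite -mulrDr; congr (_ * _).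
rewrite -RintegralD//; last 2 first.
- exact: (rintMb iu (ksec2 t (mK _ _)) (fun s => KM _ _ (s, t) (N1 _) (N1 _))).
- exact: (rintMb iu (ksec2 t (mK _ _)) (fun s => KM _ _ (s, t) (N1 _) (N1 _))).
apply: eq_Rintegral => s _; rewrite -mulrDr; congr (_ * _).
rewrite addr0 subr0 !subrr cos0 -opprD -splitr cosN cospi.
by field.
Qed.

(** Here a + b and a - b are -pi/2 and pi/2, so both coefficients in [ctr_kernel] vanish. *)
Lemma ctr_prod_cross n u v : rint u -> rint v ->
  \int[mu]_w (damp n w * (ct u w * st v w)) = 0.
Proof.
move=> iu iv; rewrite ctr_prod ?invr_gt0//.
have c1 : cos (0 + - (pi / 2)) = 0 :> R by rewrite add0r cosN cos_pihalf.
have c2 : cos (0 - - (pi / 2)) = 0 :> R by rewrite sub0r opprK cos_pihalf.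
apply: Rint0 => t; rewrite Rint0 ?mulr0// => s.
by rewrite c1 c2 !mul0r addr0 !mulr0.
Qed.

(** Schur's test: u(s) u(t) <= (u(t)^2 + u(s)^2) / 2, and the kernel has mass at most 2 pi in each
    variable. As the constant 1 is not integrable, the squares are weighted by chi(s) and chi(t),
    where [chi] is the indicator of an interval outside which [u] vanishes. *)
Lemma plancherel_damp n u : cs2 u ->
  \int[mu]_w (damp n w * (ct u w ^+ 2 + st u w ^+ 2)) <=
  2 * pi * \int[mu]_t (u t ^+ 2).
Proof.
move=> [iu iu2 [M M0 uM]].
under eq_Rintegral do rewrite !expr2.
rewrite ctr_prod_sum//; set e := n.+1%:R^-1.
have e0 : 0 < e by rewrite invr_gt0.
pose chi : R -> R := \1_`[- M, M].
have ichi : rint chi by exact: rint_indic.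
have MM : - M < M by rewrite gtrN.
have uchi x : u x = u x * chi x.
  rewrite /chi indicE; case: (boolP (x \in _)) => [_|/negP xM]; rewrite ?mulr1// mulr0.
  apply: uM; rewrite ltNge; apply/negP => xm; apply: xM.
  by apply/mem_set; rewrite /= in_itv /= -ler_norml.
have mK := meas_pkerB e0.
have KM (z : R * R) : `|pker e (z.1 - z.2)| <= 2 / e by exact: pker_norm.
have mKs t : measurable_fun [set: R] (fun s : R => pker e (s - t)) by exact: (ksec2 t mK).
pose kap t := \int[mu]_s (chi s * pker e (s - t)).
have kapE t : kap t = \int[mu]_s (chi s * pker e (t - s)).
  by apply: eq_Rintegral => s _; rewrite -pkerN opprB.
have kap_le t : 0 <= kap t <= 2 * pi by rewrite kapE; exact: pker_itv_le.
have i1 : rint (fun t => u t ^+ 2 * kap t) := swap_int2 mK KM ichi iu2.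
have i2 : rint (fun t => chi t * \int[mu]_s (u s ^+ 2 * pker e (s - t))) := swap_int2 mK KM iu2 ichi.
have i3 : rint (fun t => u t * \int[mu]_s (u s * pker e (s - t))) := swap_int2 mK KM iu iu.
have ik w t : rint w -> rint (fun s => w s * pker e (s - t)).
  by move=> iw; apply: (rintMb iw (mKs t)) => s; exact: pker_norm.
apply: (@le_trans _ _ (\int[mu]_t (2^-1 * (u t ^+ 2 * kap t) +
    2^-1 * (chi t * \int[mu]_s (u s ^+ 2 * pker e (s - t)))))).
  apply: le_Rintegral => //; first by apply: rintD; exact: rintZ.
  move=> t _.
  have k0 := rintZ (u t) (ik u t iu).
  have k1 := rintZ (u t ^+ 2) (ik chi t ichi).
  have k2 := rintZ (chi t) (ik _ t iu2).
  have k3 := rintZ 2^-1 k1; have k4 := rintZ 2^-1 k2.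
  rewrite -!RintegralZl//; try first [exact: k1|exact: k2|exact: ik].
  rewrite -RintegralD//.
  apply: le_Rintegral => //; first exact: (rintD k3 k4).
  move=> s _; move: (pker e (s - t)) (pker_ge0 (s - t) e0) => k kge0.
  rewrite -subr_ge0.
  have -> : 2^-1 * (u t ^+ 2 * (chi s * k)) + 2^-1 * (chi t * (u s ^+ 2 * k)) - u t * (u s * k)
     = 2^-1 * k * (u t ^+ 2 * chi s + chi t * u s ^+ 2 - 2 * u t * u s) by field.
  rewrite !mulr_ge0//.
  rewrite (uchi t) (uchi s) /chi !indicE.
  case: (t \in _); case: (s \in _); rewrite /= ?(mulr1, mulr0, mul1r, mul0r, expr0n, addr0, subr0, add0r) ?sqr_ge0//=.
  have := sqr_ge0 (u t - u s); rewrite sqrrB => h; lra.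
rewrite RintegralD//; [|exact: rintZ|exact: rintZ].
rewrite !RintegralZl//.
have -> : \int[mu]_t (chi t * \int[mu]_s (u s ^+ 2 * pker e (s - t))) = \int[mu]_t (u t ^+ 2 * kap t).
  rewrite -(swap_eq mK KM iu2 ichi)/=; apply: eq_Rintegral => t _; congr (_ * _).
  by rewrite kapE.
have half (x : R) : 2^-1 * x + 2^-1 * x = x by field.
rewrite half -RintegralZl//.
apply: le_Rintegral => //; first exact: rintZ.
by move=> t _; rewrite mulrC ler_wpM2r ?sqr_ge0//; have /andP[] := kap_le t.
Qed.

Lemma sqr_ctr_meas u a : rint u -> measurable_fun [set: R] (fun w => ctr u a w ^+ 2).
Proof. by move=> iu; apply: measurable_funX; exact: meas_ctr. Qed.

Lemma plancherel u : cs2 u ->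
  [/\ rint (fun w => ct u w ^+ 2), rint (fun w => st u w ^+ 2) &
  \int[mu]_w (ct u w ^+ 2 + st u w ^+ 2) <= 2 * pi * \int[mu]_t (u t ^+ 2)].
Proof.
move=> cu; have [iu iu2 _] := cu.
have [||||h1 h2] := @rint_damp_bound (fun w => ct u w ^+ 2 + st u w ^+ 2) (2 * pi * \int[mu]_t (u t ^+ 2)).
- by apply: measurable_funD; exact: sqr_ctr_meas.
- by move=> w; rewrite addr_ge0 ?sqr_ge0.
- move=> n; have := rintD (ctr_prod_int n 0 0 iu iu) (ctr_prod_int n (- (pi / 2)) (- (pi / 2)) iu iu).
  by congr rint; apply/funext => w; rewrite -mulrDr !expr2.
- by move=> n; exact: plancherel_damp.
split => //.
- apply: (rint_le _ h1); first exact: sqr_ctr_meas.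
  by move=> w; rewrite ger0_norm ?sqr_ge0// lerDl sqr_ge0.
- apply: (rint_le _ h1); first exact: sqr_ctr_meas.
  by move=> w; rewrite ger0_norm ?sqr_ge0// lerDr sqr_ge0.
Qed.

Lemma normM_le (x y : R) : `|x * y| <= x ^+ 2 + y ^+ 2.
Proof.
have h1 := sqr_ge0 (x + y); have h2 := sqr_ge0 (x - y).
have h3 := sqr_ge0 x; have h4 := sqr_ge0 y.
by rewrite ler_norml; apply/andP; split; nra.
Qed.

Lemma rint_mul u v : measurable_fun [set: R] u -> measurable_fun [set: R] v ->
  rint (fun x => u x ^+ 2) -> rint (fun x => v x ^+ 2) -> rint (fun x => u x * v x).
Proof.
move=> mfu mfv iu iv; apply: (rint_le _ (rintD iu iv)); first exact: measurable_funM.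
move=> x; exact: normM_le.
Qed.

Lemma cs2_indic (a b : R) : cs2 (\1_`[a, b] : R -> R).
Proof.
split; first exact: rint_indic.
  have := rint_indic a b; congr rint; apply/funext => x.
  by rewrite indicE; case: (_ \in _); rewrite ?expr1n ?expr0n.
exists (`|a| + `|b| + 1).
  by rewrite ltr_pwDr// addr_ge0.
move=> x xab; rewrite indicE memNset//= in_itv/= => /andP[ax xb].
have : `|x| <= `|a| + `|b|.
  rewrite ler_norml; apply/andP; split.
    have := ler_norm (- a); have := normr_ge0 b; rewrite normrN; lra.
  have := ler_norm b; have := normr_ge0 a; lra.
lra.
Qed.

(** Both sides are limits of the same damped integral: on the frequency side by dominated
    convergence, on the time side because the Poisson integral of the indicator stays between 0 and
    2 pi and tends a.e. to 2 pi times the indicator. *)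
Lemma parseval u (a b : R) : a < b -> cs2 u ->
  \int[mu]_w (ct u w * ct \1_`[a, b] w + st u w * st \1_`[a, b] w) =
  2 * pi * \int[mu]_t (u t * \1_`[a, b] t).
Proof.
move=> ab cu; have [iu iu2 _] := cu.
have ci := cs2_indic a b; have [ii _ _] := ci.
have [u1 u2 _] := plancherel cu; have [v1 v2 _] := plancherel ci.
have ih : rint (fun w => ct u w * ct \1_`[a, b] w + st u w * st \1_`[a, b] w).
  by apply: rintD; apply: rint_mul => //; exact: meas_ctr.
have l1 := Rint_damp ih; move: l1.
under eq_cvg do rewrite ctr_prod_sum//.
move=> l1.
have l2 : \int[mu]_t (\1_`[a, b] t * \int[mu]_s (u s * pker n.+1%:R^-1 (s - t)))
     @[n --> \oo] --> \int[mu]_t (u t * (2 * pi * \1_`[a, b] t)).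
  have sw n : \int[mu]_t (\1_`[a, b] t * \int[mu]_s (u s * pker n.+1%:R^-1 (s - t))) =
     \int[mu]_s (u s * \int[mu]_t (\1_`[a, b] t * pker n.+1%:R^-1 (s - t))).
    have n0 : (0 : R) < n.+1%:R^-1 by rewrite invr_gt0.
    by rewrite -(swap_eq (meas_pkerB n0) (fun z => pker_norm _ n0) iu ii).
  under eq_cvg do rewrite sw.
  apply: (@Rint_dct _ _ (fun s => `|u s| * (2 * pi))).
  - move=> n; have n0 : (0 : R) < n.+1%:R^-1 by rewrite invr_gt0.
    exact: rint_meas (swap_int1 (meas_pkerB n0) (fun z => pker_norm _ n0) iu ii).
  - apply: measurable_funM; first exact: rint_meas.
    by apply: measurable_funM => //; exact: rint_meas.
  (* [cvg_pker_itv] leaves out a and b, which form a null set. *)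
  - have : mu.-negligible [set a; b].
      exists [set a; b]; split => //; first by apply: measurableU.
      rewrite measureU0//; exact: lebesgue_measure_set1.
    apply: negligibleS => s /= ; apply: contra_notP => /not_orP[/eqP sa /eqP sb].
    by apply: cvgM; [exact: cvg_cst|exact: cvg_pker_itv].
  - have := rintZ (2 * pi) (rint_abs iu).
    by congr rint; apply/funext => x; rewrite mulrC.
  - move=> n s; rewrite normrM ler_wpM2l//.
    have n0 : (0 : R) < n.+1%:R^-1 by rewrite invr_gt0.
    have /andP[k1 k2] := pker_itv_le s n0 ab.
    by rewrite ger0_norm.
have -> := cvg_unique (@norm_hausdorff _ _) l1 l2.
rewrite -RintegralZl//; last first.
  apply: (rintMb (M := 1) iu); first exact: rint_meas ii.
  by move=> x; rewrite indicE; case: (_ \in _); rewrite ?normr1 ?normr0.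
by apply: eq_Rintegral => t _; ring.
Qed.

Lemma ctr_cross u v : cs2 u -> cs2 v -> \int[mu]_w (ct u w * st v w) = 0.
Proof.
move=> cu cv; have [iu iu2 _] := cu; have [iv iv2 _] := cv.
have [u1 u2 _] := plancherel cu; have [v1 v2 _] := plancherel cv.
have ih : rint (fun w => ct u w * st v w).
  by apply: rint_mul => //; exact: meas_ctr.
have l1 := Rint_damp ih; move: l1.
under eq_cvg do rewrite ctr_prod_cross//.
move=> l1.
exact: (cvg_unique (@norm_hausdorff _ _) l1 (cvg_cst _)).
Qed.

End Plancherel.

(** * Functions with vanishing integrals, essential support, Cauchy-Schwarz *)

Section AlmostEverywhere.
Context {R : realType}.
Notation mu := (@lebesgue_measure R).
Implicit Types (u v k h f g : R -> R).

(** At a Lebesgue point x the mean of |u - u(x)| over small balls tends to 0; as u has integral 0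
    over each ball, this mean is at least |u(x)|. *)
Lemma ae_eq0_itv u : locally_integrable [set: R] u ->
  (forall a b : R, a < b -> \int[mu]_(t in `]a, b[) u t = 0) ->
  {ae mu, forall x, u x = 0}.
Proof.
move=> lu u0; have := lebesgue_differentiation lu.
apply: filterS; first exact: (ae_filter_ringOfSetsType mu).
move=> x /= hx; apply/eqP; rewrite -normr_le0; apply/ler_addgt0Pr => e e0.
rewrite add0r -lee_fin.
have [r [r0 hr]] : exists r : R, 0 < r /\ (davg u x r <= e%:E)%E.
  move: hx; rewrite /lebesgue_pt => /fine_cvgP[hf /cvgrPdist_le /(_ _ e0) hd].
  near (0 : R)^'+ => r; exists r; split; first by near: r; exact: nbhs_right_gt.
  have h1 : davg u x r \is a fin_num by near: r.
  have h2 : `|0 - fine (davg u x r)| <= e by near: r.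
  rewrite -(fineK h1) lee_fin; move: h2; rewrite sub0r normrN.
  exact: le_trans (ler_norm _).
apply: le_trans hr; rewrite /davg /iavg.
have mB : measurable (ball x r) by exact: measurable_ball.
have muB : mu (ball x r) = (r *+ 2)%:E by rewrite lebesgue_measure_ball// ltW.
have r2 : 0 < r *+ 2 by rewrite pmulrn_lgt0.
have iu : mu.-integrable (ball x r) (EFin \o u).
  apply: (@integrableS _ _ _ mu (closed_ball x r)) => //.
  - exact: measurable_closed_ball.
  - exact: subset_closed_ball.
  - case: lu => mfu _ hK; apply/integrableP; split.
      by apply/measurable_EFinP; exact: measurable_funS mfu.
    by apply: hK => //; exact: closed_ballR_compact.
have cB (k : R) : (\int[mu]_(y in ball x r) k%:E = (k * (r *+ 2))%:E)%E.
  transitivity (k%:E * mu (ball x r))%E; first exact: integral_cst.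
  by rewrite muB.
have ic : mu.-integrable (ball x r) (EFin \o cst (u x)).
  apply/integrableP; split; first by apply/measurable_EFinP; exact: measurable_cst.
  rewrite (_ : (\int[mu]_(y in _) _)%E = (\int[mu]_(y in ball x r) (`|u x|)%:E)%E)//.
  by rewrite cB ltry.
have int0 : (\int[mu]_(y in ball x r) (u y)%:E = 0)%E.
  have := u0 (x - r) (x + r); rewrite -ball_itv => h.
  rewrite -[LHS]fineK; last exact: integrable_fin_num.
  by congr (_%:E); apply: h; lra.
rewrite muB inver gt_eqF// lee_pdivlMl// -EFinM.
rewrite (_ : ((r *+ 2) * `|u x|)%:E = `| \int[mu]_(y in ball x r) (u y - u x)%:E |%E); last first.
  under eq_integral do rewrite EFinB.
  rewrite integralB_EFin// int0 sub0e cB abseN /=.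
  by rewrite normrM mulrC (gtr0_norm r2).
apply: le_abse_integral => //.
by apply/measurable_EFinP/measurable_funB => //; apply/measurable_EFinP; exact: (measurable_int mu).
Unshelve. all: by end_near. Qed.

(** The complement of the support is an uncountable union of open sets; the countably many intervals
    with rational endpoints on which g vanishes a.e. already cover it. *)
Lemma ess_support_ae (c : R) (g : R -> R[i]) : ess_support g `<=` `[- c, c] ->
  {ae mu, forall w, ~ (`[- c, c]%classic : set R) w -> g w = 0}.
Proof.
move=> sg.
pose P (pq : rat * rat) := {ae mu, forall w : R, (`]ratr pq.1, ratr pq.2[%classic : set R) w -> g w = 0}.
(* The exceptional null set of the n-th rational interval; empty if n codes no pair or if g does not
   vanish a.e. on the interval. *)
pose A (n : nat) : set R := if (unpickle n : option (rat * rat)) is Some pq then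
  (if `[< P pq >] then [set w : R | ~ ((`]ratr pq.1, ratr pq.2[%classic : set R) w -> g w = 0)] else set0) else set0.
have nA : mu.-negligible (\bigcup_n A n).
  apply: negligible_bigcup => n; rewrite /A.
  case: (unpickle n) => [pq|]; last exact: negligible_set0.
  by case: asboolP => // _; exact: negligible_set0.
apply: negligibleS nA => w /= /not_implyP[wc gw].
have : ~ ess_support g w by move=> /sg.
rewrite /ess_support => /contrapT[U [oU gU] Uw].
have : nbhs w U by rewrite nbhsE /=; exists U.
rewrite -nbhs_ballE => -[r /= r0 wrU].
have [p] : exists p, ratr p \in `]w - r, w[ by apply: rat_in_itvoo; lra.
have [q] : exists p, ratr p \in `]w, w + r[ by apply: rat_in_itvoo; lra.
rewrite !in_itv/= => /andP[q1 q2] /andP[p1 p2].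
exists (pickle (p, q)); first exact: I.
rewrite /A pickleK.
case: asboolP => [_|]; first by apply/not_implyP; rewrite /= in_itv/= p2 q1.
apply: contra_notP => _.
apply: (@filterS _ _ (ae_filter_ringOfSetsType mu)) gU => x /= gU' xpq.
apply: gU'; apply: wrU; move: xpq; rewrite in_itv/= => /andP[x1 x2].
by rewrite /ball/= ltr_norml; apply/andP; split; lra.
Qed.

(** The integral of (u - l v)^2 is a polynomial in l that is nowhere negative; l = B / C is its
    minimum when C > 0. *)
Lemma Rint_CS u v : measurable_fun [set: R] u -> measurable_fun [set: R] v ->
  rint (fun x => u x ^+ 2) -> rint (fun x => v x ^+ 2) ->
  (\int[mu]_x (u x * v x)) ^+ 2 <= \int[mu]_x (u x ^+ 2) * \int[mu]_x (v x ^+ 2).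
Proof.
move=> mfu mfv iu iv; have iuv := rint_mul mfu mfv iu iv.
set A := \int[mu]_x (u x ^+ 2); set C := \int[mu]_x (v x ^+ 2); set B := \int[mu]_x (u x * v x).
have h (l : R) : 0 <= A - 2 * l * B + l ^+ 2 * C.
  have -> : A - 2 * l * B + l ^+ 2 * C = \int[mu]_x (u x - l * v x) ^+ 2.
    transitivity (\int[mu]_x (u x ^+ 2 - 2 * l * (u x * v x) + l ^+ 2 * v x ^+ 2)); last first.
      by apply: eq_Rintegral => x _; ring.
    have i1 := rintZ (2 * l) iuv; have i2 := rintZ (l ^+ 2) iv.
    by rewrite RintegralD//; [rewrite RintegralB// !RintegralZl|exact: rintB].
  by apply: Rintegral_ge0 => x _; exact: sqr_ge0.
have C0 : 0 <= C by apply: Rintegral_ge0 => x _; exact: sqr_ge0.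
have [C1|C1] := eqVneq C 0.
  have [->|B0] := eqVneq B 0; first by rewrite expr0n C1 mulr0.
  (* With C = 0 the polynomial is affine, and this l gives it the value -1. *)
  have := h ((A + 1) / (2 * B)); rewrite C1 mulr0 addr0.
  have -> : 2 * ((A + 1) / (2 * B)) * B = A + 1 by field.
  lra.
have {C1}C0 : 0 < C by rewrite lt_neqAle eq_sym C1.
have := h (B / C).
have -> : A - 2 * (B / C) * B + (B / C) ^+ 2 * C = A - B ^+ 2 / C.
  by field; rewrite gt_eqF.
by rewrite subr_ge0 ler_pdivrMr.
Qed.

End AlmostEverywhere.

(** * Band-limited functions *)

Section ComplexL2.
Local Open Scope complex_scope.
Context {R : realType}.
Notation mu := (@lebesgue_measure R).
Implicit Types (u v k h : R -> R) (f g : R -> R[i]).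

Lemma RintD u v : rint u -> rint v ->
  \int[mu]_x (u x + v x) = \int[mu]_x u x + \int[mu]_x v x.
Proof. by move=> iu iv; exact: RintegralD. Qed.

Lemma RintB u v : rint u -> rint v ->
  \int[mu]_x (u x - v x) = \int[mu]_x u x - \int[mu]_x v x.
Proof. by move=> iu iv; exact: RintegralB. Qed.

Lemma RintZ (a : R) u : rint u -> \int[mu]_x (a * u x) = a * \int[mu]_x u x.
Proof. by move=> iu; exact: RintegralZl. Qed.

Notation ct u := (ctr u 0).
Notation st u := (ctr u (- (pi / 2))).

Definition nsq (z : R[i]) : R := complex.Re z ^+ 2 + complex.Im z ^+ 2.

Lemma normc_sqr (z : R[i]) : Normc.normc z ^+ 2 = nsq z.
Proof. by case: z => a b; rewrite /= sqr_sqrtr// addr_ge0 ?sqr_ge0. Qed.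

Lemma nsq_ge0 z : 0 <= nsq z.
Proof. by rewrite /nsq addr_ge0 ?sqr_ge0. Qed.

Lemma LpnormC2E D f : measurable D ->
  LpnormC 2%:E D f = ((\int[mu]_(x in D) (nsq (f x))%:E) `^ 2^-1)%E.
Proof.
move=> mD; rewrite /LpnormC unlock /=; congr (_ `^ _)%E.
rewrite [RHS]integral_mkcond; apply: eq_integral => x _.
rewrite !patchE; case: ifPn => _; last by rewrite abse0 poweR0r.
rewrite (_ : `|(Normc.normc (f x))%:E|%E = (`|Normc.normc (f x)|)%:E)// poweR_EFin; congr EFin.
by rewrite powR_mulrn// real_normK ?num_real// normc_sqr.
Qed.

Lemma L2C_rint f : L2C f -> [/\ rint (fun x => complex.Re (f x) ^+ 2),
  rint (fun x => complex.Im (f x) ^+ 2) & rint (fun x => nsq (f x))].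
Proof.
move=> [m1 m2]; rewrite LpnormC2E// => fin.
have mn : measurable_fun [set: R] (fun x => nsq (f x)).
  by apply: measurable_funD; exact: measurable_funX.
have i : rint (fun x => nsq (f x)).
  apply/integrableP; split; first exact/measurable_EFinP.
  under eq_integral do rewrite gee0_abs ?lee_fin ?nsq_ge0//.
  by apply: lty_poweRy fin; rewrite invr_eq0.
split => //; apply: (rint_le _ i) => //.
- exact: measurable_funX.
- by move=> x; rewrite ger0_norm ?sqr_ge0// /nsq lerDl sqr_ge0.
- exact: measurable_funX.
- by move=> x; rewrite ger0_norm ?sqr_ge0// /nsq lerDr sqr_ge0.
Qed.

Lemma LpnormC2_rint f : rint (fun x => nsq (f x)) ->
  LpnormC 2%:E [set: R] f = (Num.sqrt (\int[mu]_x nsq (f x)))%:E.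
Proof.
move=> i; rewrite LpnormC2E//.
rewrite -[X in (X `^ _)%E](fineK (integrable_fin_num measurableT i)) poweR_EFin.
by rewrite powR12_sqrt// fine_ge0// integral_ge0// => x _; rewrite lee_fin nsq_ge0.
Qed.

(** The truncation moves from the domain into the integrand and the phase -pi/2 turns the cosine
    into a sine, so that the results on [ctr] apply. *)
Lemma fourier_integralE (n : nat) f w :
  let f1 := fun t => complex.Re (f t) * \1_`[- n%:R, n%:R] t in
  let f2 := fun t => complex.Im (f t) * \1_`[- n%:R, n%:R] t in
  rint f1 -> rint f2 ->
  fourier_integral `[- n%:R, n%:R] f w =
  ((Num.sqrt (2 * pi))^-1 * (ct f1 w + st f2 w)) +i*
  ((Num.sqrt (2 * pi))^-1 * (ct f2 w - st f1 w)).
Proof.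
move=> f1 f2 i1 i2.
have cosS (x : R) : cos (x + - (pi / 2)) = sin x.
  by rewrite cosB cos_pihalf sin_pihalf mulr0 add0r mulr1.
have iM h (a : R) : rint h -> rint (fun t => h t * cos (t * w + a)).
  move=> ih; apply: (rintMb (M := 1) ih); first exact: meas_cos1.
  by move=> x; exact: cos_max.
rewrite /fourier_integral /Cintegral.
have -> : \int[mu]_(t in `[- n%:R, n%:R]) complex.Re (f t * cis (- (t * w))) = ct f1 w + st f2 w.
  rewrite Rintegral_mkcond /ctr -RintegralD//; [|exact: iM|exact: iM].
  apply: eq_Rintegral => t _; rewrite patchE /f1 /f2 indicE.
  case: ifPn => _; last by rewrite !mulr0 !mul0r addr0.
  rewrite !mulr1 cosS addr0 /cis cosN sinN; case: (f t) => a b /=; ring.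
have -> : \int[mu]_(t in `[- n%:R, n%:R]) complex.Im (f t * cis (- (t * w))) = ct f2 w - st f1 w.
  rewrite Rintegral_mkcond /ctr -RintegralB//; [|exact: iM|exact: iM].
  apply: eq_Rintegral => t _; rewrite patchE /f1 /f2 indicE.
  case: ifPn => _; last by rewrite !mulr0 !mul0r subr0.
  rewrite !mulr1 cosS addr0 /cis cosN sinN; case: (f t) => a b /=; ring.
set A := ct f1 w + _; set B := ct f2 w - _.
by apply/eqP; rewrite eq_complex /= !mul0r subr0 addr0 !eqxx.
Qed.

Lemma cs2_trunc h (r : R) : 0 <= r -> measurable_fun [set: R] h -> rint (fun x => h x ^+ 2) ->
  cs2 (fun t => h t * \1_`[- r, r] t).
Proof.
move=> r0 mh ih.
have m1 : measurable_fun [set: R] (\1_`[- r, r] : R -> R).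
  exact: rint_meas (rint_indic _ _).
have [_ i2 _] := cs2_indic (- r : R) r.
split.
- exact: rint_mul.
- apply: (rint_le _ ih).
    by apply: measurable_funX; exact: measurable_funM.
  move=> x; rewrite ger0_norm ?sqr_ge0// indicE; case: (_ \in _); rewrite ?mulr1// mulr0 expr0n.
  exact: sqr_ge0.
- exists (r + 1); first by rewrite ltr_wpDl.
  move=> x xn; rewrite indicE memNset ?mulr0//= in_itv/= -ler_norml => xn'; lra.
Qed.

Lemma trunc_int_le h (r : R) : 0 <= r -> measurable_fun [set: R] h -> rint (fun x => h x ^+ 2) ->
  \int[mu]_t (h t * \1_`[- r, r] t) ^+ 2 <= \int[mu]_t h t ^+ 2.
Proof.
move=> r0 mh ih; have [_ i _] := cs2_trunc r0 mh ih.
apply: le_Rintegral => // x _; rewrite indicE; case: (_ \in _); rewrite ?mulr1// mulr0 expr0n.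
exact: sqr_ge0.
Qed.

Let rearr (A B C D U V P : R) : 0 < P -> A + B <= P * U -> C + D <= P * V ->
  P^-1 * (A + D) + P^-1 * (C + B) <= U + V.
Proof. by move=> P0 ? ?; rewrite -mulrDr ler_pdivrMl//; lra. Qed.

(* The cross terms vanish because the cosine transform is even and the sine
   transform is odd. *)
Lemma plancherel_pair u v : cs2 u -> cs2 v ->
  let K := (Num.sqrt (2 * pi))^-1 : R in
  let h1 := fun w => K * (ct u w + st v w) in
  let h2 := fun w => K * (ct v w - st u w) in
  [/\ rint (fun w => h1 w ^+ 2), rint (fun w => h2 w ^+ 2) &
  \int[mu]_w (h1 w ^+ 2) + \int[mu]_w (h2 w ^+ 2) <=
  \int[mu]_t (u t ^+ 2) + \int[mu]_t (v t ^+ 2)].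
Proof.
move=> cu cv K h1 h2; have [iu iu2 _] := cu; have [iv iv2 _] := cv.
have [u1 u2 uP] := plancherel cu; have [v1 v2 vP] := plancherel cv.
have x1 : rint (fun w => ct u w * st v w) by apply: rint_mul => //; exact: meas_ctr.
have x2 : rint (fun w => ct v w * st u w) by apply: rint_mul => //; exact: meas_ctr.
have pp : (0 : R) < 2 * pi by rewrite mulr_gt0 ?pi_gt0.
have K2 : K ^+ 2 = (2 * pi)^-1 by rewrite exprVn sqr_sqrtr// ltW.
have e1 : (fun w => h1 w ^+ 2) = (fun w => K ^+ 2 * ((ct u w ^+ 2 + st v w ^+ 2) + 2 * (ct u w * st v w))).
  by apply/funext => w; rewrite /h1; ring.
have e2 : (fun w => h2 w ^+ 2) = (fun w => K ^+ 2 * ((ct v w ^+ 2 + st u w ^+ 2) - 2 * (ct v w * st u w))).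
  by apply/funext => w; rewrite /h2; ring.
have y1 := rintD (rintD u1 v2) (rintZ 2 x1).
have y2 := rintB (rintD v1 u2) (rintZ 2 x2).
split.
- by rewrite e1; exact: rintZ.
- by rewrite e2; exact: rintZ.
have E1 : \int[mu]_w (h1 w ^+ 2) = K ^+ 2 * (\int[mu]_w (ct u w ^+ 2) + \int[mu]_w (st v w ^+ 2)).
  rewrite e1 (RintZ _ y1) (RintD (rintD u1 v2) (rintZ 2 x1)) (RintD u1 v2).
  by rewrite (RintZ _ x1) (ctr_cross cu cv) mulr0 addr0.
have E2 : \int[mu]_w (h2 w ^+ 2) = K ^+ 2 * (\int[mu]_w (ct v w ^+ 2) + \int[mu]_w (st u w ^+ 2)).
  rewrite e2 (RintZ _ y2) (RintB (rintD v1 u2) (rintZ 2 x2)) (RintD v1 u2).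
  by rewrite (RintZ _ x2) (ctr_cross cv cu) mulr0 subr0.
rewrite (RintD u1 u2) in uP; rewrite (RintD v1 v2) in vP.
by apply: le_trans (rearr pp uP vP); rewrite -K2 -E1 -E2 lexx.
Qed.

End ComplexL2.

(** * Fourier inversion tested against intervals *)

Section Inversion.
Local Open Scope complex_scope.
Context {R : realType}.
Notation mu := (@lebesgue_measure R).
Implicit Types (u v k h q : R -> R) (f g : R -> R[i]).
Notation ct u := (ctr u 0).
Notation st u := (ctr u (- (pi / 2))).
Notation K := ((Num.sqrt (2 * pi))^-1 : R).

(** Weak inversion for the compactly supported function u + i v: up to the constant K, the inverse
    transform of its transform is paired with [chi]. [parseval] gives the diagonal terms and
    [ctr_cross] kills the others. *)
Lemma pair_parseval u v (a b : R) : a < b -> cs2 u -> cs2 v ->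
  let chi : R -> R := \1_`[a, b] in
  \int[mu]_w (K * (ct u w + st v w) * ct chi w - K * (ct v w - st u w) * st chi w) =
    K * (2 * pi * \int[mu]_t (u t * chi t)) /\
  \int[mu]_w (K * (ct u w + st v w) * st chi w + K * (ct v w - st u w) * ct chi w) =
    K * (2 * pi * \int[mu]_t (v t * chi t)).
Proof.
move=> ab cu cv chi; have [iu iu2 _] := cu; have [iv iv2 _] := cv.
have ck : cs2 chi by exact: cs2_indic.
have [ik _ _] := ck.
have [u1 u2 _] := plancherel cu; have [v1 v2 _] := plancherel cv; have [k1 k2 _] := plancherel ck.
have m h a' : rint h -> measurable_fun [set: R] (ctr h a') by exact: meas_ctr.
have r1 := rint_mul (m _ _ iu) (m _ _ ik) u1 k1.
have r2 := rint_mul (m _ _ iu) (m _ _ ik) u2 k2.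
have r3 := rint_mul (m _ _ iu) (m _ _ ik) u1 k2.
have r4 := rint_mul (m _ _ ik) (m _ _ iu) k1 u2.
have s1 := rint_mul (m _ _ iv) (m _ _ ik) v1 k1.
have s2 := rint_mul (m _ _ iv) (m _ _ ik) v2 k2.
have s3 := rint_mul (m _ _ iv) (m _ _ ik) v1 k2.
have s4 := rint_mul (m _ _ ik) (m _ _ iv) k1 v2.
split.
- rewrite -(parseval ab cu).
  transitivity (\int[mu]_w (K * ((ct u w * ct chi w + st u w * st chi w) + (ct chi w * st v w - ct v w * st chi w)))).
    by apply: eq_Rintegral => w _; ring.
  rewrite (RintZ _ (rintD (rintD r1 r2) (rintB s4 s3))) (RintD (rintD r1 r2) (rintB s4 s3)).
  by rewrite (RintB s4 s3) (ctr_cross ck cv) (ctr_cross cv ck) subrr addr0.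
- rewrite -(parseval ab cv).
  transitivity (\int[mu]_w (K * ((ct v w * ct chi w + st v w * st chi w) + (ct u w * st chi w - ct chi w * st u w)))).
    by apply: eq_Rintegral => w _; ring.
  rewrite (RintZ _ (rintD (rintD s1 s2) (rintB r3 r4))) (RintD (rintD s1 s2) (rintB r3 r4)).
  by rewrite (RintB r3 r4) (ctr_cross cu ck) (ctr_cross ck cu) subrr addr0.
Qed.

Lemma rint_sqB u v : measurable_fun [set: R] u -> measurable_fun [set: R] v ->
  rint (fun x => u x ^+ 2) -> rint (fun x => v x ^+ 2) -> rint (fun x => (u x - v x) ^+ 2).
Proof.
move=> mfu mfv iu iv; apply: (rint_le _ (rintZ 2 (rintD iu iv))).
  by apply: measurable_funX; exact: measurable_funB.
move=> x; rewrite ger0_norm ?sqr_ge0//.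
have := sqr_ge0 (u x + v x); nra.
Qed.

(** By Cauchy-Schwarz, pairing with a fixed square integrable [k] is continuous for L^2
    convergence. *)
Lemma Rint_mul_cvg (h_ : nat -> R -> R) u k :
  measurable_fun [set: R] u -> measurable_fun [set: R] k ->
  (forall n, measurable_fun [set: R] (h_ n)) ->
  rint (fun x => u x ^+ 2) -> rint (fun x => k x ^+ 2) ->
  (forall n, rint (fun x => h_ n x ^+ 2)) ->
  \int[mu]_x (u x - h_ n x) ^+ 2 @[n --> \oo] --> (0 : R) ->
  \int[mu]_x (h_ n x * k x) @[n --> \oo] --> \int[mu]_x (u x * k x).
Proof.
move=> mu' mk mh iu ik ih d0.
have iuk := rint_mul mu' mk iu ik.
have ihk n := rint_mul (mh n) mk (ih n) ik.
have bnd n : (\int[mu]_x (u x * k x) - \int[mu]_x (h_ n x * k x)) ^+ 2 <=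
    \int[mu]_x (u x - h_ n x) ^+ 2 * \int[mu]_x k x ^+ 2.
  rewrite -(RintB iuk (ihk n)).
  rewrite (_ : \int[mu]_x _ = \int[mu]_x ((u x - h_ n x) * k x)); last first.
    by apply: eq_Rintegral => x _; rewrite mulrBl.
  apply: Rint_CS => //; first exact: measurable_funB.
  exact: rint_sqB.
set C := \int[mu]_x k x ^+ 2 in bnd.
have C0 : 0 <= C by apply: Rintegral_ge0 => x _; exact: sqr_ge0.
apply/cvgrPdist_le => e e0.
(* C may be 0, hence the denominator C + 1. *)
have e2 : 0 < e ^+ 2 / (C + 1) by rewrite divr_gt0 ?exprn_gt0// ltr_wpDl.
have /cvgrPdist_le /(_ _ e2) := d0.
apply: filterS => n; rewrite sub0r normrN => dn.
rewrite -(@ler_pXn2r _ 2)// ?nnegrE ?(ltW e0)// real_normK ?num_real//.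
rewrite (le_trans (bnd n))//.
rewrite (@le_trans _ _ (e ^+ 2 / (C + 1) * (C + 1)))//; last by rewrite divfK// gt_eqF// ltr_wpDl.
apply: ler_pM => //; last by rewrite lerDl.
  by apply: Rintegral_ge0 => x _; exact: sqr_ge0.
exact: le_trans (ler_norm _) dn.
Qed.

Lemma ae_eq_Rint u v : measurable_fun [set: R] u -> measurable_fun [set: R] v ->
  {ae mu, forall x, u x = v x} -> \int[mu]_x u x = \int[mu]_x v x.
Proof.
move=> mfu mfv uv; rewrite /Rintegral; congr fine; apply: ae_eq_integral => //.
- exact/measurable_EFinP.
- exact/measurable_EFinP.
- by apply: (@filterS _ _ (ae_filter_ringOfSetsType mu)) uv => x /= -> _.
Qed.

Lemma ctr_swap u v (a : R) : rint u -> rint v ->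
  \int[mu]_w (u w * ctr v a w) = \int[mu]_t (v t * ctr u a t).
Proof.
move=> iu iv.
have E := @swap_eq R (fun z => cos (z.2 * z.1 + a)) 1 u v (meas_cosM' a) (fun z => cos_max _) iu iv.
apply: (etrans E); apply: eq_Rintegral => t _; congr (_ * _); apply: eq_Rintegral => s _.
by rewrite /= [t * s]mulrC.
Qed.

(** Passes a norm bound to an L^2 limit without the triangle inequality in L^2: from |g|^2 <=
    (1+e)|h|^2 + (1+1/e)|g-h|^2, n is chosen for a fixed e, and e is arbitrary. *)
Lemma limit_le (G F : R) (d : nat -> R) : 0 <= F ->
  d n @[n --> \oo] --> (0 : R) ->
  (forall n e, 0 < e -> G <= (1 + e) * F + (1 + e^-1) * d n) -> G <= F.
Proof.
move=> F0 d0 h; apply/ler_addgt0Pr => e e0.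
pose t := e / (2 * (F + 1)).
have F1 : 0 < F + 1 by rewrite ltr_wpDl.
have t0 : 0 < t by rewrite divr_gt0// mulr_gt0.
have s0 : 0 < e / (2 * (1 + t^-1)).
  by rewrite divr_gt0// mulr_gt0// addr_gt0// invr_gt0.
have /cvgrPdist_le /(_ _ s0) [n _ /(_ n (leqnn n))] := d0.
rewrite sub0r normrN => dn.
apply: (le_trans (h n t t0)).
have h1 : t * F <= e / 2.
  rewrite /t invfM mulrA -mulrA ler_piMr ?divr_ge0 ?ltW//.
  by rewrite mulrC ltr_pdivrMr// mul1r ltrDl.
have h2 : (1 + t^-1) * d n <= e / 2.
  have p0 : 0 < 1 + t^-1 by rewrite addr_gt0// invr_gt0.
  have := le_trans (ler_norm _) dn.
  by rewrite invfM mulrA ler_pdivlMr// mulrC.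
rewrite mulrDl mul1r -addrA lerD2l; lra.
Qed.

(** Reduces to [ae_eq0_itv] for the difference, which is locally integrable since q is bounded and
    |u| <= 1 + u^2. *)
Lemma ae_eq_of_itv u q (B : R) : measurable_fun [set: R] u -> measurable_fun [set: R] q ->
  rint (fun x => u x ^+ 2) -> (forall x, `|q x| <= B) ->
  (forall a b : R, a < b -> \int[mu]_t (u t * \1_`[a, b] t) = \int[mu]_t (\1_`[a, b] t * q t)) ->
  {ae mu, forall x, u x = q x}.
Proof.
move=> mfu mfq iu qB huq.
have B0 : 0 <= B by rewrite (le_trans _ (qB 0)).
have mI (a b : R) : measurable_fun [set: R] (\1_`[a, b] : R -> R).
  exact: rint_meas (rint_indic _ _).
suff : {ae mu, forall x, u x - q x = 0}.
  by apply: (@filterS _ _ (ae_filter_ringOfSetsType mu)) => x /= /eqP; rewrite subr_eq0 => /eqP.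
apply: ae_eq0_itv.
  split; [exact: measurable_funB|exact: openT|move=> A _ cA].
  have mA : measurable A by exact: compact_measurable.
  have iA : mu.-integrable A (EFin \o (fun x => 1 + B + u x ^+ 2)).
    apply: (@eq_integrable _ _ _ mu A mA (fun x => (1 + B)%:E + (u x ^+ 2)%:E)%E) => //.
    apply: integrableD => //.
      apply/integrableP; split; first exact: measurable_cst.
      rewrite integral_cst//.
      by apply: lte_mul_pinfty => //; exact: compact_finite_measure cA.
    exact: (@integrableS _ _ _ mu setT).
  move/integrableP : iA => [_]; apply: le_lt_trans.
  apply: ge0_le_integral => //.
  + by apply/measurable_EFinP; apply: measurable_funTS; apply: measurableT_comp => //; exact: measurable_funB.
  + apply: measurable_funTS; apply: measurableT_comp => //; apply/measurable_EFinP.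
    by apply: measurable_funD => //; exact: measurable_funX.
  + move=> x _; rewrite /= lee_fin (@ger0_norm _ (1 + B + _)); last by rewrite !addr_ge0 ?sqr_ge0.
    rewrite (le_trans (ler_normB _ _))//.
    have h1 := sqr_ge0 (`|u x| - 1); rewrite sqrrB1 real_normK ?num_real// in h1.
    have h2 := qB x; have h3 := normr_ge0 (u x); move: (u x ^+ 2) `|u x| `|q x| h1 h2 h3 => U V W; lra.
move=> a b ab.
have iuI : rint (fun t => u t * \1_`[a, b] t).
  by apply: rint_mul => //; have [] := cs2_indic a b.
have iqI : rint (fun t => \1_`[a, b] t * q t).
  by apply: (rintMb (M := B)) => //; exact: rint_indic.
have E : \int[mu]_(t in `[a, b]) (u t - q t) = 0.
  rewrite Rintegral_mkcond.
  transitivity (\int[mu]_t (u t * \1_`[a, b] t - \1_`[a, b] t * q t)).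
    apply: eq_Rintegral => t _; rewrite patchE indicE.
    by case: ifPn => _; rewrite ?mulr1 ?mul1r// mulr0 mul0r subr0.
  by rewrite (RintB iuI iqI) (huq _ _ ab) subrr.
have iab : mu.-integrable `[a, b] (EFin \o (fun t => u t - q t)).
  apply: (@eq_integrable _ _ _ mu _ (measurable_itv _)
      (EFin \o (fun t => u t * \1_`[a, b] t - \1_`[a, b] t * q t))).
    by move=> t tab; rewrite /= indicE tab mulr1 mul1r.
  by apply: integrableS (rintB iuI iqI).
have iSub (i : interval R) : [set` i] `<=` `[a, b] -> mu.-integrable [set` i] (EFin \o (fun t => u t - q t)).
  by move=> s; apply: integrableS iab.
rewrite Rintegral_itv_bndo_bndc; last first.
  by apply: iSub => x /=; exact: subset_itv_oo_cc.
rewrite Rintegral_itv_obnd_cbnd//.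
by apply: iSub => x /=; exact: subset_itv_oc_cc.
Qed.

End Inversion.

(** * Representation of bandlimited functions *)

Section Representation.
Local Open Scope complex_scope.
Context {R : realType}.
Notation mu := (@lebesgue_measure R).
Implicit Types (u v k h q : R -> R) (f g : R -> R[i]).
Notation ct u := (ctr u 0).
Notation st u := (ctr u (- (pi / 2))).
Notation K := ((Num.sqrt (2 * pi))^-1 : R).

Let KK (x : R) : K * (K * (2 * pi * x)) = x.
Proof.
have pp : (0 : R) < 2 * pi by rewrite mulr_gt0 ?pi_gt0.
have h : K * K * (2 * pi) = 1.
  by rewrite -expr2 exprVn sqr_sqrtr ?(ltW pp)// mulVf// gt_eqF.
by rewrite mulrA mulrA h mul1r.
Qed.

(* Both sides of each identity have the same integral over every interval. *)
Lemma bandlimited_repr (c : R) f : 0 < c -> bandlimited c f ->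
  exists u v, [/\ cs2 u /\ cs2 v,
    (forall w, w \notin `[- c, c] -> u w = 0 /\ v w = 0),
    \int[mu]_w (u w ^+ 2) + \int[mu]_w (v w ^+ 2) <= \int[mu]_t nsq (f t),
    {ae mu, forall x, complex.Re (f x) = K * (ct u x - st v x)} &
    {ae mu, forall x, complex.Im (f x) = K * (st u x + ct v x)}].
Proof.
move=> c0 [L2f [g [L2g gcvg] gsupp]].
have [mf1 mf2 _] := L2f; have [if1 if2 inf] := L2C_rint L2f.
have [mg1 mg2 _] := L2g; have [ig1 ig2 ing] := L2C_rint L2g.
set f1 := fun x => complex.Re (f x) in mf1 if1 *.
set f2 := fun x => complex.Im (f x) in mf2 if2 *.
set g1 := fun x => complex.Re (g x) in mg1 ig1.
set g2 := fun x => complex.Im (g x) in mg2 ig2.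
pose tr (n : nat) h := fun t => h t * \1_`[- n%:R : R, n%:R] t.
have ctr1 n : cs2 (tr n f1) by apply: cs2_trunc => //; exact: ler0n.
have ctr2 n : cs2 (tr n f2) by apply: cs2_trunc => //; exact: ler0n.
(* [h1 n] and [h2 n] are the real and imaginary parts of the transform of f truncated to [-n, n]. *)
pose h1 (n : nat) w := K * (ct (tr n f1) w + st (tr n f2) w).
pose h2 (n : nat) w := K * (ct (tr n f2) w - st (tr n f1) w).
have iT1 n : rint (tr n f1) by have [] := ctr1 n.
have iT2 n : rint (tr n f2) by have [] := ctr2 n.
have mh1 n : measurable_fun [set: R] (h1 n).
  by apply: measurable_funM => //; apply: measurable_funD; exact: meas_ctr.
have mh2 n : measurable_fun [set: R] (h2 n).
  by apply: measurable_funM => //; apply: measurable_funB; exact: meas_ctr.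
have PP n := plancherel_pair (ctr1 n) (ctr2 n).
have ih1 n : rint (fun w => h1 n w ^+ 2) by have [] := PP n.
have ih2 n : rint (fun w => h2 n w ^+ 2) by have [] := PP n.
pose F := \int[mu]_t nsq (f t).
have hF n : \int[mu]_w (h1 n w ^+ 2) + \int[mu]_w (h2 n w ^+ 2) <= F.
  have [_ _ hle] := PP n; apply: (le_trans hle).
  rewrite /F /nsq (RintD if1 if2) lerD//; apply: trunc_int_le => //; exact: ler0n.
have nsqE n w : nsq (g w - fourier_integral `[- n%:R, n%:R] f w) =
    (g1 w - h1 n w) ^+ 2 + (g2 w - h2 n w) ^+ 2.
  rewrite fourier_integralE//; last 2 first.
  - exact: iT1.
  - exact: iT2.
  by rewrite /nsq /g1 /g2; case: (g w) => a b.
have id1 n := rint_sqB mg1 (mh1 n) ig1 (ih1 n).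
have id2 n := rint_sqB mg2 (mh2 n) ig2 (ih2 n).
pose d n := \int[mu]_w ((g1 w - h1 n w) ^+ 2 + (g2 w - h2 n w) ^+ 2).
have d_cvg : d n @[n --> \oo] --> (0 : R).
  have sd : Num.sqrt (d n) @[n --> \oo] --> (0 : R).
    move/fine_cvg : gcvg; apply: cvg_trans; apply: near_eq_cvg; apply: nearW => n.
    rewrite /= LpnormC2_rint /=.
      by congr (Num.sqrt _); apply: eq_Rintegral => w _; rewrite nsqE.
    have := rintD (id1 n) (id2 n); congr rint.
    by apply/funext => w; rewrite nsqE.
  have -> : d = (fun n => Num.sqrt (d n) * Num.sqrt (d n)).
    apply/funext => n; rewrite -expr2 sqr_sqrtr//.
    by apply: Rintegral_ge0 => w _; rewrite addr_ge0 ?sqr_ge0.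
  have dd : Num.sqrt (d n) * Num.sqrt (d n) @[n --> \oo] --> (0 * 0 : R) by exact: cvgM.
  by rewrite mulr0 in dd.
have d1_cvg : \int[mu]_w ((g1 w - h1 n w) ^+ 2) @[n --> \oo] --> (0 : R).
  apply: (squeeze_cvgr _ (cvg_cst 0) d_cvg); apply: nearW => n; apply/andP; split.
    by apply: Rintegral_ge0 => w _; exact: sqr_ge0.
  rewrite /d (RintD (id1 n) (id2 n)) lerDl.
  by apply: Rintegral_ge0 => w _; exact: sqr_ge0.
have d2_cvg : \int[mu]_w ((g2 w - h2 n w) ^+ 2) @[n --> \oo] --> (0 : R).
  apply: (squeeze_cvgr _ (cvg_cst 0) d_cvg); apply: nearW => n; apply/andP; split.
    by apply: Rintegral_ge0 => w _; exact: sqr_ge0.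
  rewrite /d (RintD (id1 n) (id2 n)) lerDr.
  by apply: Rintegral_ge0 => w _; exact: sqr_ge0.
have GF : \int[mu]_w (g1 w ^+ 2) + \int[mu]_w (g2 w ^+ 2) <= F.
  apply: (limit_le _ d_cvg).
    by apply: Rintegral_ge0 => w _; exact: nsq_ge0.
  move=> n e e0.
  have e1 : 0 <= 1 + e by rewrite addr_ge0 ?ltW.
  apply: (@le_trans _ _ ((1 + e) * (\int[mu]_w (h1 n w ^+ 2) + \int[mu]_w (h2 n w ^+ 2)) + (1 + e^-1) * d n)); last first.
    by rewrite lerD2r ler_wpM2l.
  rewrite -(RintD ig1 ig2) -(RintD (ih1 n) (ih2 n)).
  rewrite -(RintZ (1 + e) (rintD (ih1 n) (ih2 n))).
  rewrite -(RintZ (1 + e^-1) (rintD (id1 n) (id2 n))).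
  have r1 := rintZ (1 + e) (rintD (ih1 n) (ih2 n)).
  have r2 := rintZ (1 + e^-1) (rintD (id1 n) (id2 n)).
  rewrite -(RintD r1 r2).
  apply: le_Rintegral => //; first exact: rintD.
  have yg (a b : R) : a ^+ 2 <= (1 + e) * b ^+ 2 + (1 + e^-1) * (a - b) ^+ 2.
    rewrite -subr_ge0.
    have -> : (1 + e) * b ^+ 2 + (1 + e^-1) * (a - b) ^+ 2 - a ^+ 2 = e^-1 * (e * b - (a - b)) ^+ 2.
      by field; rewrite gt_eqF.
    by rewrite mulr_ge0 ?sqr_ge0// invr_ge0 ltW.
  move=> w _; rewrite !mulrDr addrACA lerD//; exact: yg.
(* As g vanishes a.e. outside [-c, c], cutting it there changes it on a null set only and puts it
   into the class [cs2]. *)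
pose u w := g1 w * \1_`[- c, c] w.
pose v w := g2 w * \1_`[- c, c] w.
have c0' := ltW c0.
have cu : cs2 u by exact: cs2_trunc.
have cv : cs2 v by exact: cs2_trunc.
have [iu iu2 _] := cu; have [iv iv2 _] := cv.
have gae := ess_support_ae gsupp.
have uae : {ae mu, forall w, g1 w = u w}.
  apply: (@filterS _ _ (ae_filter_ringOfSetsType mu)) gae => w /= gw.
  rewrite /u indicE; case: (boolP (w \in _)) => [_|/negP wc]; first by rewrite mulr1.
  by rewrite mulr0 /g1 gw// => wc'; apply: wc; exact/mem_set.
have vae : {ae mu, forall w, g2 w = v w}.
  apply: (@filterS _ _ (ae_filter_ringOfSetsType mu)) gae => w /= gw.
  rewrite /v indicE; case: (boolP (w \in _)) => [_|/negP wc]; first by rewrite mulr1.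
  by rewrite mulr0 /g2 gw// => wc'; apply: wc; exact/mem_set.
have key (a b : R) : a < b ->
    \int[mu]_t (f1 t * \1_`[a, b] t) = \int[mu]_t (\1_`[a, b] t * (K * (ct u t - st v t))) /\
    \int[mu]_t (f2 t * \1_`[a, b] t) = \int[mu]_t (\1_`[a, b] t * (K * (st u t + ct v t))).
  move=> ab; set chi : R -> R := \1_`[a, b].
  have ck : cs2 chi by exact: cs2_indic.
  have [ik ik2 _] := ck.
  have [k1 k2 _] := plancherel ck.
  have mk a' : measurable_fun [set: R] (ctr chi a') by exact: meas_ctr.
  have l1 := Rint_mul_cvg mg1 (mk _) mh1 ig1 k1 ih1 d1_cvg.
  have l2 := Rint_mul_cvg mg2 (mk _) mh2 ig2 k2 ih2 d2_cvg.
  have l3 := Rint_mul_cvg mg1 (mk _) mh1 ig1 k2 ih1 d1_cvg.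
  have l4 := Rint_mul_cvg mg2 (mk _) mh2 ig2 k1 ih2 d2_cvg.
  (* Once [-n, n] contains [a, b], [chi] does not see the truncation: the sequences below are
     eventually constant. *)
  have trE h : \forall n \near \oo, \int[mu]_t (tr n h t * chi t) = \int[mu]_t (h t * chi t).
    near=> n; apply: eq_Rintegral => t _.
    rewrite /tr /chi !indicE; case: (boolP (t \in `[a, b]%classic)); last by rewrite !mulr0.
    move=> /set_mem /=; rewrite in_itv /= => /andP[ta tb].
    rewrite mem_set ?mulr1//= in_itv/= -ler_norml.
    have nab : `|a| + `|b| <= n%:R by near: n; exact: nbhs_infty_ger.
    apply: le_trans nab; rewrite ler_norml; apply/andP; split.
      have := ler_norm (- a); have := normr_ge0 b; rewrite normrN; lra.
    have := ler_norm b; have := normr_ge0 a; lra.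
  have lc1 : \int[mu]_x (h1 n x * ct chi x) - \int[mu]_x (h2 n x * st chi x) @[n --> \oo] -->
     K * (2 * pi * \int[mu]_t (f1 t * chi t)).
    apply: cvg_near_cst; near=> n.
    rewrite -(RintB (rint_mul (mh1 n) (mk _) (ih1 n) k1) (rint_mul (mh2 n) (mk _) (ih2 n) k2)).
    have [-> _] := pair_parseval ab (ctr1 n) (ctr2 n).
    by congr (_ * (_ * _)); near: n; exact: trE.
  have lc2 : \int[mu]_x (h1 n x * st chi x) + \int[mu]_x (h2 n x * ct chi x) @[n --> \oo] -->
     K * (2 * pi * \int[mu]_t (f2 t * chi t)).
    apply: cvg_near_cst; near=> n.
    rewrite -(RintD (rint_mul (mh1 n) (mk _) (ih1 n) k2) (rint_mul (mh2 n) (mk _) (ih2 n) k1)).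
    have [_ ->] := pair_parseval ab (ctr1 n) (ctr2 n).
    by congr (_ * (_ * _)); near: n; exact: trE.
  have E1 : \int[mu]_x (g1 x * ct chi x) - \int[mu]_x (g2 x * st chi x) =
      K * (2 * pi * \int[mu]_t (f1 t * chi t)).
    exact: (cvg_unique (@norm_hausdorff _ _) (cvgB l1 l2) lc1).
  have E2 : \int[mu]_x (g1 x * st chi x) + \int[mu]_x (g2 x * ct chi x) =
      K * (2 * pi * \int[mu]_t (f2 t * chi t)).
    exact: (cvg_unique (@norm_hausdorff _ _) (cvgD l3 l4) lc2).
  (* The transform passes from [chi] to u and v; g is replaced here with its cut-off version. *)
  have sw h w a' : measurable_fun [set: R] h -> rint w -> {ae mu, forall x, h x = w x} ->
      \int[mu]_x (h x * ctr chi a' x) = \int[mu]_x (chi x * ctr w a' x).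
    move=> mh iw hw; rewrite -(ctr_swap _ iw ik); apply: ae_eq_Rint.
    - by apply: measurable_funM.
    - by apply: measurable_funM => //; exact: rint_meas.
    - by apply: (@filterS _ _ (ae_filter_ringOfSetsType mu)) hw => x /= ->.
  rewrite !(sw _ _ _ mg1 iu uae) !(sw _ _ _ mg2 iv vae) in E1 E2.
  have ikc h a' : rint h -> rint (fun x => chi x * ctr h a' x).
    move=> ih; apply: (rintMb ik (meas_ctr _ ih)) => x; exact: ctr_bound.
  split.
  - rewrite -[LHS]KK.
    rewrite -E1 -(RintB (ikc _ _ iu) (ikc _ _ iv)).
    rewrite -(RintZ _ (rintB (ikc _ _ iu) (ikc _ _ iv))).
    by apply: eq_Rintegral => x _; ring.
  - rewrite -[LHS]KK.
    rewrite -E2 -(RintD (ikc _ _ iu) (ikc _ _ iv)).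
    rewrite -(RintZ _ (rintD (ikc _ _ iu) (ikc _ _ iv))).
    by apply: eq_Rintegral => x _; ring.
have mct h a' : rint h -> measurable_fun [set: R] (ctr h a') by exact: meas_ctr.
exists u, v; split.
- by split.
- move=> w wc; rewrite /u /v indicE (_ : (w \in `[- c, c]%classic) = false) ?mulr0//.
  by apply/negP => /set_mem /=; exact/negP.
- by apply: le_trans GF; rewrite lerD//; exact: trunc_int_le.
- apply: (@ae_eq_of_itv _ f1 _ (K * (\int[mu]_t `|u t| + \int[mu]_t `|v t|))) => //.
  + by apply: measurable_funM => //; apply: measurable_funB; exact: mct.
  + move=> x; rewrite normrM ger0_norm ?invr_ge0 ?sqrtr_ge0// ler_wpM2l ?invr_ge0 ?sqrtr_ge0//.
    by rewrite (le_trans (ler_normB _ _))// lerD//; exact: ctr_bound.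
  + by move=> a b ab; have [] := key a b ab.
- apply: (@ae_eq_of_itv _ f2 _ (K * (\int[mu]_t `|u t| + \int[mu]_t `|v t|))) => //.
  + by apply: measurable_funM => //; apply: measurable_funD; exact: mct.
  + move=> x; rewrite normrM ger0_norm ?invr_ge0 ?sqrtr_ge0// ler_wpM2l ?invr_ge0 ?sqrtr_ge0//.
    by rewrite (le_trans (ler_normD _ _))// lerD//; exact: ctr_bound.
  + by move=> a b ab; have [] := key a b ab.
Unshelve. all: by end_near. Qed.

End Representation.

(** * Legendre polynomials *)

Section SymmetricInterval.
Context {R : realType}.
Notation mu := (@lebesgue_measure R).
Implicit Types (h g : R -> R) (p q : {poly R}).

Definition I11 h : R := \int[mu]_(x in `[- 1, 1]) h x.

Lemma int_I11 h : continuous h -> mu.-integrable `[- 1, 1] (EFin \o h).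
Proof.
move=> ch; apply: continuous_compact_integrable; first exact: segment_compact.
exact: continuous_subspaceT.
Qed.

Lemma I11D h g : continuous h -> continuous g ->
  I11 (fun x => h x + g x) = I11 h + I11 g.
Proof. by move=> ch cg; apply: RintegralD => //; exact: int_I11. Qed.

Lemma I11B h g : continuous h -> continuous g ->
  I11 (fun x => h x - g x) = I11 h - I11 g.
Proof. by move=> ch cg; apply: RintegralB => //; exact: int_I11. Qed.

Lemma I11Z (a : R) h : continuous h -> I11 (fun x => a * h x) = a * I11 h.
Proof. by move=> ch; apply: RintegralZl => //; exact: int_I11. Qed.

Lemma eq_I11 h g : (forall x, h x = g x) -> I11 h = I11 g.
Proof. by move=> hg; congr I11; exact/funext. Qed.

Lemma I11_le h g : continuous h -> continuous g ->
  (forall x, -1 <= x <= 1 -> h x <= g x) -> I11 h <= I11 g.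
Proof.
move=> ch cg hg; apply: le_Rintegral => //; try exact: int_I11.
Qed.

Lemma I11_cst (a : R) : I11 (fun=> a) = 2 * a.
Proof.
rewrite /I11 Rintegral_cst//= lebesgue_measure_itv/= lte_fin.
by rewrite ifT; [rewrite -EFinB/=; ring|lra].
Qed.

Lemma I11_norm h (M : R) : continuous h -> (forall x, -1 <= x <= 1 -> `|h x| <= M) -> `|I11 h| <= 2 * M.
Proof.
move=> ch hM; rewrite -I11_cst; apply: (le_trans (le_normr_Rintegral _ (int_I11 ch))) => //.
apply: I11_le => //; last by move=> x; exact: cst_continuous.
move=> x; apply: continuous_comp; [exact: ch|exact: norm_continuous].
Qed.

Lemma I11_FTC h H : continuous h -> (forall x : R, is_derive x (1 : R) H (h x)) ->
  I11 h = H 1 - H (-1).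
Proof.
move=> ch dH; have cH : continuous H.
  by move=> x; have [dh _] := dH x; exact/differentiable_continuous/derivable1_diffP.
have lt11 : (-1 : R) < 1 by rewrite (lt_trans (ltrN10 _)).
rewrite /I11 /Rintegral (@continuous_FTC2 _ _ H)//.
- exact: continuous_subspaceT.
- split; first by move=> x _; have [] := dH x.
  + exact/cvg_at_right_filter/cH.
  + exact/cvg_at_left_filter/cH.
- by move=> x _; rewrite derive1E; have [_] := dH x.
Qed.

Lemma I11_odd h : continuous h -> (forall x, h (- x) = - h x) -> I11 h = 0.
Proof.
move=> ch oh; suff : I11 h = - I11 h by move=> ?; lra.
rewrite -[RHS]mulN1r -I11Z//.
rewrite /I11 /Rintegral; congr fine.
have := @integration_by_substitution_oppr R h (-1) 1; rewrite opprK => ->.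
- by apply: eq_integral => x _; rewrite /= oh mulN1r.
- lra.
- exact: continuous_subspaceT.
Qed.

Lemma is_derive_horner p (x : R) : is_derive x (1 : R) (horner p) p^`().[x].
Proof.
split; first exact: derivable_horner.
by rewrite -derive1E -derivE.
Qed.

Lemma continuousM_ h g : continuous h -> continuous g -> continuous (fun x => h x * g x).
Proof. by move=> ch cg x; apply: cvgM; [exact: ch|exact: cg]. Qed.

Lemma continuousD_ h g : continuous h -> continuous g -> continuous (fun x => h x + g x).
Proof. by move=> ch cg x; apply: cvgD; [exact: ch|exact: cg]. Qed.

Lemma I11_parts h h' p : (forall x : R, is_derive x (1 : R) h (h' x)) -> continuous h' ->
  p.[1] = 0 -> p.[-1] = 0 ->
  I11 (fun x => h x * p^`().[x]) = - I11 (fun x => h' x * p.[x]).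
Proof.
move=> dh ch' p1 pN1.
have ch : continuous h.
  by move=> x; have [d _] := dh x; exact/differentiable_continuous/derivable1_diffP.
have c1 := continuousM_ ch (@continuous_horner _ p^`()).
have c2 := continuousM_ ch' (@continuous_horner _ p).
have dp (x : R) : is_derive x (1 : R) (fun x => h x * p.[x]) (h x * p^`().[x] + h' x * p.[x]).
  have d1 := dh x; have d2 := is_derive_horner p x.
  by apply: is_derive_eq; rewrite /GRing.scale /= [p.[x] * _]mulrC.
apply/eqP; rewrite -addr_eq0 -I11D//.
by rewrite (I11_FTC (continuousD_ c1 c2) dp) p1 pN1 !mulr0 subrr.
Qed.

Definition W (k : nat) : {poly R} := ('X ^+ 2 - 1) ^+ k.

(** Each derivative costs at most one factor x^2 - 1, so derivatives of order below k vanish at 1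
    and -1 and the integrations by parts have no boundary terms. *)
Lemma dvd_derivn_W k j : (j <= k)%N -> exists r, (W k)^`(j) = W (k - j) * r.
Proof.
elim: j => [_|j IH jk]; first by exists 1; rewrite derivn0 subn0 mulr1.
have [r Er] := IH (ltnW jk).
exists (('X *+ 2 * r) *+ (k - j) + ('X ^+ 2 - 1) * r^`()).
rewrite derivnS Er derivM /W deriv_exp derivB derivXn derivC subr0 expr1.
have -> : (k - j = (k - j.+1).+1)%N by rewrite subnSK.
move: (k - j.+1)%N => m; rewrite /= (exprS _ m) !mulrnAl mulrDr !mulrnAr.
set Z := _ ^+ m; set Y := _ - 1; clearbody Z Y.
congr (_ + _); last by ring.
by congr (_ *+ _); ring.
Qed.

Lemma W_pm1 k (x : R) : (0 < k)%N -> x ^+ 2 = 1 -> (W k).[x] = 0.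
Proof.
by move=> k0 x2; rewrite /W !hornerE x2 subrr expr0n gtn_eqF.
Qed.

Lemma derivn_W_pm1 k j (x : R) : (j < k)%N -> x ^+ 2 = 1 -> (W k)^`(j).[x] = 0.
Proof.
move=> jk x2; have [r ->] := dvd_derivn_W (ltnW jk).
by rewrite hornerM W_pm1 ?mul0r// subn_gt0.
Qed.

(** k integrations by parts. [H] lists a function with all its derivatives, a form that fits
    polynomials as well as cosines with a phase. *)
Lemma I11_rodrigues (H : nat -> R -> R) k :
  (forall j (x : R), is_derive x (1 : R) (H j) (H j.+1 x)) ->
  I11 (fun x => H 0 x * (W k)^`(k).[x]) = (-1) ^+ k * I11 (fun x => H k x * (W k).[x]).
Proof.
move=> dH.
have cH j : continuous (H j).
  by move=> x; have [d _] := dH j x; exact/differentiable_continuous/derivable1_diffP.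
suff h j : (j <= k)%N -> I11 (fun x => H 0 x * (W k)^`(k).[x]) =
    (-1) ^+ j * I11 (fun x => H j x * (W k)^`(k - j).[x]).
  by rewrite (h k (leqnn k)) subnn.
elim: j => [_|j IH jk]; first by rewrite expr0 mul1r subn0.
rewrite IH ?(ltnW jk)// exprSr -mulrA mulN1r; congr (_ * _).
have -> : (k - j = (k - j.+1).+1)%N by rewrite subnSK.
rewrite derivnS; apply: (I11_parts (dH j) (cH j.+1)).
  by rewrite derivn_W_pm1 ?expr1n// ltn_subrL (leq_ltn_trans _ jk).
by rewrite derivn_W_pm1 ?sqrrN ?expr1n// ltn_subrL (leq_ltn_trans _ jk).
Qed.

Notation A k := (I11 (fun x => (1 - x ^+ 2) ^+ k)).

Lemma I11_W (h : R -> R) k : continuous h ->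
  (-1) ^+ k * I11 (fun x => h x * (W k).[x]) = I11 (fun x => h x * (1 - x ^+ 2) ^+ k).
Proof.
move=> ch; rewrite -I11Z; last exact: (continuousM_ ch (@continuous_horner _ (W k))).
apply: eq_I11 => x; have -> : (W k).[x] = (x ^+ 2 - 1) ^+ k by rewrite /W !hornerE.
by rewrite mulrCA -exprMn mulN1r opprB.
Qed.

Lemma continuous_bump k : continuous (fun x : R => (1 - x ^+ 2) ^+ k).
Proof.
rewrite (_ : (fun x => _) = horner ((1 - 'X ^+ 2) ^+ k : {poly R})).
  exact: continuous_horner.
by apply/funext => x; rewrite !hornerE.
Qed.

(** The difference of the two integrands is the derivative of x (1 - x^2)^(k+1), which vanishes at
    both endpoints. *)
Lemma bump_int_rec k : (2 * k + 3)%:R * A k.+1 = (2 * k + 2)%:R * A k.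
Proof.
apply/eqP; rewrite -subr_eq0.
rewrite -!I11Z; [|exact: continuous_bump|exact: continuous_bump].
rewrite -I11B; last 2 first.
- by apply: continuousM_; [move=> x; exact: cst_continuous|exact: continuous_bump].
- by apply: continuousM_; [move=> x; exact: cst_continuous|exact: continuous_bump].
pose p : {poly R} := 'X * (1 - 'X ^+ 2) ^+ k.+1.
have E x : (2 * k + 3)%:R * (1 - x ^+ 2) ^+ k.+1 - (2 * k + 2)%:R * (1 - x ^+ 2) ^+ k = p^`().[x].
  have dq : ('X * (1 - 'X ^+ 2) ^+ k.+1 : {poly R})^`() =
      (1 - 'X ^+ 2) * (1 - 'X ^+ 2) ^+ k - ('X * 'X * (1 - 'X ^+ 2) ^+ k) *+ (2 * k.+1).
    rewrite derivM derivX deriv_exp derivB derivC sub0r derivXn /= (exprS _ k) mul1r.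
    congr (_ + _); rewrite mulrnAr mulrnA expr1 mulNr mulrN mulNrn; congr (- _).
    by rewrite mulrnAl mulrnAr mulrA.
  have -> : p^`().[x] = (1 - x ^+ 2) * (1 - x ^+ 2) ^+ k - (x * x * (1 - x ^+ 2) ^+ k) * (2 * (k%:R + 1)).
    rewrite /p dq hornerD hornerN hornerMn -[_ *+ (2 * k.+1)]mulr_natr natrM -[k.+1%:R]natr1.
    by congr (_ - _ * _); rewrite !hornerE.
  rewrite (exprS _ k).
  have -> : (2 * k + 3)%:R = 2 * k%:R + 3 :> R by rewrite natrD natrM.
  have -> : (2 * k + 2)%:R = 2 * k%:R + 2 :> R by rewrite natrD natrM.
  by move: ((1 - x ^+ 2) ^+ k) (k%:R : R) => Z n; ring.
rewrite (eq_I11 E) (I11_FTC (@continuous_horner _ _) (is_derive_horner p)).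
by rewrite /p !hornerE !expr1n sqrrN expr1n !subrr !expr0n/= !mulr0 subrr.
Qed.

Lemma bump_int0 : A 0 = 2.
Proof. by rewrite (@eq_I11 _ (fun=> 1)) ?I11_cst ?mulr1// => x; rewrite expr0. Qed.

(* (2k - 1)!! *)
Definition odd_fact (k : nat) : R := \prod_(i < k) (2 * i + 1)%:R.

Lemma odd_factS k : odd_fact k.+1 = (2 * k + 1)%:R * odd_fact k.
Proof. by rewrite /odd_fact big_ord_recr /= mulrC. Qed.

Lemma odd_fact_gt0 k : 0 < odd_fact k.
Proof. by apply: prodr_gt0 => i _; rewrite ltr0n addn1. Qed.

Lemma fact2 k : (2 * k)`!%:R = 2 ^+ k * k`!%:R * odd_fact k :> R.
Proof.
elim: k => [|k IH]; first by rewrite muln0 fact0 expr0 /odd_fact big_ord0 !mul1r.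
rewrite (_ : 2 * k.+1 = (2 * k).+2)%N; last by rewrite mulnS.
rewrite !factS !natrM IH odd_factS exprS.
have -> : (2 * k).+2%:R = 2 * (k%:R + 1) :> R by rewrite -addn2 natrD natrM; ring.
have -> : (2 * k).+1%:R = (2 * k + 1)%:R :> R by rewrite addn1.
rewrite -[k.+1%:R]natr1.
move: (k`!%:R) (odd_fact k) (2 ^+ k) ((2 * k + 1)%:R) => a b c d; ring.
Qed.

(** The value 2 * 2^k k! / (2k+1)!! of a Wallis integral, cleared of denominators so that
    [bump_int_rec] gives the induction. *)
Lemma bump_int_val k : odd_fact k * A k * (2 * k + 1)%:R = 2 * (2 ^+ k * k`!%:R).
Proof.
elim: k => [|k IH].
  by rewrite bump_int0 /odd_fact big_ord0 expr0 fact0 muln0 add0n; ring.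
rewrite odd_factS exprS factS natrM.
have -> : (2 * k.+1 + 1 = 2 * k + 3)%N by rewrite mulnS; ring.
rewrite -mulrA [A k.+1 * _]mulrC bump_int_rec.
have -> : (2 * k + 2)%:R = 2 * k.+1%:R :> R by rewrite -addn1 natrD natrM natrD; ring.
transitivity (2 * k.+1%:R * (odd_fact k * A k * (2 * k + 1)%:R)).
  move: (A k) (odd_fact k) ((2 * k + 1)%:R) => a b d; ring.
rewrite IH; move: (k`!%:R) (2 ^+ k) => a b; ring.
Qed.

Lemma bump_int_gt0 k : 0 < A k.
Proof.
have h := bump_int_val k.
have n1 : 0 < (2 * k + 1)%:R :> R by rewrite ltr0n addn1.
rewrite -(pmulr_lgt0 _ n1) -(pmulr_rgt0 _ (odd_fact_gt0 k)) mulrA h.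
by rewrite !mulr_gt0 ?exprn_gt0 ?ltr0n ?fact_gt0.
Qed.

Notation P k := (@legendre R k).
Notation nk k := (2 ^+ k * k`!%:R : R).

Let nk_gt0 k : 0 < nk k.
Proof. by rewrite mulr_gt0 ?exprn_gt0 ?ltr0n ?fact_gt0. Qed.

Lemma legendreE k x : (P k).[x] = (nk k)^-1 * (W k)^`(k).[x].
Proof. by rewrite /legendre hornerZ. Qed.

Lemma I11_legendre (H : nat -> R -> R) k :
  (forall j (x : R), is_derive x (1 : R) (H j) (H j.+1 x)) ->
  I11 (fun x => H 0 x * (P k).[x]) = (nk k)^-1 * I11 (fun x => H k x * (1 - x ^+ 2) ^+ k).
Proof.
move=> dH.
have cH j : continuous (H j).
  by move=> x; have [d _] := dH j x; exact/differentiable_continuous/derivable1_diffP.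
rewrite -I11_W; last exact: cH.
rewrite -I11_rodrigues//.
rewrite -I11Z; last exact: continuousM_ (cH 0) (@continuous_horner _ _).
by apply: eq_I11 => x; rewrite legendreE mulrCA.
Qed.

Lemma I11_legendre_poly q k :
  I11 (fun x => q.[x] * (P k).[x]) = (nk k)^-1 * I11 (fun x => q^`(k).[x] * (1 - x ^+ 2) ^+ k).
Proof.
rewrite -(@I11_legendre (fun j => horner q^`(j))) => //.
Qed.

Lemma size_W k : size (W k) = (2 * k).+1.
Proof.
have s2 : size ('X ^+ 2 - 1 : {poly R}) = 3%N by rewrite size_XnsubC.
have := size_exp ('X ^+ 2 - 1 : {poly R}) k; rewrite s2 -/(W k) /= => h.
rewrite -h prednK// lt0n size_poly_eq0 expf_neq0//.
by rewrite -size_poly_eq0 s2.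
Qed.

Lemma W_monic k : W k \is monic.
Proof. by apply: monic_exp; exact: monicXnsubC. Qed.

Lemma derivn_W k : (W k)^`(2 * k) = (2 * k)`!%:R%:P.
Proof.
apply/polyP => i; rewrite coef_derivn coefC.
case: i => [|i] /=.
  rewrite addn0 ffactnn; have := W_monic k; rewrite monicE /lead_coef size_W /= => /eqP ->.
  by [].
by rewrite nth_default ?mul0rn// size_W addnS ltnS leq_addr.
Qed.

Lemma legendre_deriv k : (P k)^`(k) = (odd_fact k)%:P.
Proof.
rewrite /legendre derivnZ /derivn -iterD addnn -mul2n -/(derivn _ _) derivn_W.
by rewrite -mul_polyC -polyCM fact2 mulKf// gt_eqF// nk_gt0.
Qed.

Lemma size_legendre k : size (P k) = k.+1.
Proof.
have h1 : (size (P k) <= k.+1)%N.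
  rewrite /legendre (leq_trans (size_scale_leq _ _))//.
  apply/leq_sizeP => j kj; rewrite coef_derivn nth_default ?mul0rn// size_W.
  by rewrite mul2n -addnn -addnS leq_add2l.
apply/eqP; rewrite eqn_leq h1 ltnNge; apply/negP => h2.
have := legendre_deriv k; rewrite derivn_poly0// => /esym/eqP; rewrite polyC_eq0.
by rewrite gt_eqF// odd_fact_gt0.
Qed.

Lemma I11_legendre_lt q k : (size q <= k)%N -> I11 (fun x => q.[x] * (P k).[x]) = 0.
Proof.
move=> qk; rewrite I11_legendre_poly derivn_poly0//.
by rewrite (@eq_I11 _ (fun=> 0)) ?I11_cst ?mulr0// => x; rewrite horner0 mul0r.
Qed.

(** k integrations by parts leave the k-th derivative of P_k, the constant (2k-1)!!, against the
    weight (1 - x^2)^k. *)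
Lemma I11_legendre_sqr k : (k%:R + 1 / 2) * I11 (fun x => (P k).[x] * (P k).[x]) = 1.
Proof.
rewrite I11_legendre_poly legendre_deriv.
under eq_fun do rewrite hornerC.
rewrite I11Z; last exact: continuous_bump.
have h := bump_int_val k; have := nk_gt0 k; move: (nk k) h => N h N0.
have -> : k%:R + 1 / 2 = 2^-1 * (2 * k + 1)%:R :> R by rewrite natrD natrM; field.
transitivity (2^-1 * N^-1 * (odd_fact k * A k * (2 * k + 1)%:R)); first by ring.
by rewrite h; field; rewrite gt_eqF.
Qed.

Lemma I11_legendre_orth k j : k != j -> I11 (fun x => (P j).[x] * (P k).[x]) = 0.
Proof.
move=> kj; have [lt|gt|/eqP] := ltngtP j k; last by rewrite eq_sym (negbTE kj).
  by apply: I11_legendre_lt; rewrite size_legendre.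
rewrite (@eq_I11 _ (fun x => (P k).[x] * (P j).[x])); last by move=> x; rewrite mulrC.
by apply: I11_legendre_lt; rewrite size_legendre.
Qed.

(** The factor k + 1/2 is the square of the normalisation in [nlegendre]. There is no indicator
    here; [proj_ae] makes the link inside (-1, 1). *)
Definition Lproj (N : nat) h (x : R) : R :=
  \sum_(0 <= k < N.+1) (k%:R + 1 / 2) * I11 (fun t => h t * (P k).[t]) * (P k).[x].

Lemma LprojB N h g x : continuous h -> continuous g ->
  Lproj N (fun t => h t - g t) x = Lproj N h x - Lproj N g x.
Proof.
move=> ch cg; rewrite /Lproj -sumrB; apply: eq_bigr => k _.
rewrite -mulrBl -mulrBr -I11B; [|exact: continuousM_ ch (@continuous_horner _ _)|exact: continuousM_ cg (@continuous_horner _ _)].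
by congr (_ * _ * _); apply: eq_I11 => t; rewrite mulrBl.
Qed.

(** Subtracting from q the multiple of P_n with the same coefficient of degree n lowers the degree;
    orthogonality separates the two parts. *)
Lemma Lproj_poly N q x : (size q <= N.+1)%N -> Lproj N (horner q) x = q.[x].
Proof.
rewrite /Lproj; elim: N.+1 q => {N}[|n IH] q sq.
  by rewrite big_nil; move: sq; rewrite leqn0 size_poly_eq0 => /eqP ->; rewrite horner0.
have cP j := @continuous_horner _ (P j).
have lP : lead_coef (P n) != 0 by rewrite lead_coef_eq0 -size_poly_eq0 size_legendre.
pose a := q`_n / lead_coef (P n); pose r := q - a *: P n.
have sr : (size r <= n)%N.
  apply/leq_sizeP => j; rewrite leq_eqVlt => /predU1P[<-|nj]; rewrite coefB coefZ.
    have lE : lead_coef (P n) = (P n)`_n by rewrite /lead_coef size_legendre.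
    by rewrite -lE /a divfK// subrr.
  by rewrite !nth_default ?mulr0 ?subr0// ?size_legendre// (leq_trans sq).
have Iq k : I11 (fun t => q.[t] * (P k).[t]) =
    I11 (fun t => r.[t] * (P k).[t]) + a * I11 (fun t => (P n).[t] * (P k).[t]).
  have c1 := continuousM_ (cP n) (cP k).
  rewrite -I11Z// -I11D.
  - by apply: eq_I11 => t; rewrite /r hornerD hornerN (hornerZ a) mulrBl -mulrA subrK.
  - exact: continuousM_ (@continuous_horner _ r) (cP k).
  - exact: continuousM_ (fun x => @cst_continuous _ _ _ _) c1.
rewrite big_nat_recr//= Iq I11_legendre_lt// add0r.
have -> : (n%:R + 1 / 2) * (a * I11 (fun t => (P n).[t] * (P n).[t])) = a.
  by rewrite mulrCA I11_legendre_sqr mulr1.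
rewrite (_ : \sum_(0 <= i < n) _ = r.[x]).
  by rewrite /r hornerD hornerN (hornerZ a) subrK.
rewrite -(IH r sr); apply: eq_big_nat => k /andP[_ kn].
by rewrite Iq I11_legendre_orth ?mulr0 ?addr0// neq_ltn kn.
Qed.

Lemma derivn_mulX n p : ('X * p)^`(n) = 'X * p^`(n) + p^`(n.-1) *+ n.
Proof.
elim: n => [|n IH]; first by rewrite !derivn0 mulr0n addr0.
rewrite derivnS IH derivD derivM derivX mul1r derivMn derivnS /=.
case: n {IH} => [|n]; first by rewrite mulr0n addr0 mulr1n addrC.
by rewrite -derivnS /= (mulrS _ n.+1) -addrA addrC -addrA [X in _ + X]addrC.
Qed.

Lemma W_deriv k : ('X * ('X * (W k)^`()) - (W k)^`()) = ('X * W k) *+ (2 * k).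
Proof.
case: k => [|k]; first by rewrite /W expr0 derivC !mulr0 subrr muln0 mulr0n.
rewrite /W deriv_exp derivB derivXn derivC subr0 expr1 /= (exprS _ k).
rewrite [in RHS]mulnC [in RHS]mulrnA.
set Z := _ ^+ k; set Y := ('X ^+ 2 - 1).
have -> : 'X * ('X * ('X *+ 2 * Z *+ k.+1)) - 'X *+ 2 * Z *+ k.+1 = (('X ^+ 2 - 1) * ('X *+ 2 * Z)) *+ k.+1.
  by rewrite !mulrnAr mulrBl mulrnBl mul1r expr2 !mulrA.
rewrite -/Y; rewrite [in RHS]mulrnAC; congr (_ *+ _).
by rewrite mulrnAl mulrnAr; congr (_ *+ _); rewrite mulrCA mulrA.
Qed.

(** (x^2 - 1) W' = 2k x W for W = (x^2 - 1)^k; differentiating k + 1 times by Leibniz' rule gives an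
    equation for the k-th derivative of W, hence for P_k. *)
Lemma legendre_ode k (x : R) :
  (x ^+ 2 - 1) * (P k)^`()^`().[x] + 2 * x * (P k)^`().[x] = k%:R * (k%:R + 1) * (P k).[x].
Proof.
have := congr1 (derivn k.+1) (W_deriv k).
rewrite derivnB derivnMn; set V := (W k)^`(); set Y := (W k)^`(k).
(* The multiplicity k makes this true for k = 0 as well, where [k.-1] is 0. *)
have V0 : V^`(k.-1) *+ k = Y *+ k.
  by rewrite /Y /V; case: (k) => // j; rewrite -derivSn.
have V1 : V^`(k) = Y^`() by rewrite /V -derivSn derivnS.
have V2 : V^`(k.+1) = Y^`()^`() by rewrite derivnS V1.
have -> : ('X * ('X * V))^`(k.+1) = 'X * ('X * Y^`()^`() + Y^`() *+ k.+1) + ('X * Y^`() + Y *+ k) *+ k.+1.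
  by rewrite derivn_mulX derivn_mulX V2 [_.+1.-1]/= V1 derivn_mulX V1 V0.
have -> : ('X * W k)^`(k.+1) = 'X * Y^`() + Y *+ k.+1 by rewrite derivn_mulX derivnS.
rewrite V2 => /(congr1 (fun p => p.[x])).
rewrite !(hornerD, hornerN, hornerM, hornerMn, hornerX).
have -> : (P k)^`()^`().[x] = (nk k)^-1 * Y^`()^`().[x] by rewrite /legendre !derivZ hornerZ.
have -> : (P k)^`().[x] = (nk k)^-1 * Y^`().[x] by rewrite /legendre !derivZ hornerZ.
have -> : (P k).[x] = (nk k)^-1 * Y.[x] by rewrite /legendre hornerZ.
move: (nk k)^-1 Y.[x] Y^`().[x] Y^`()^`().[x] => c y0 y1 y2.
move=> h.
have {}h : x * (x * y2 + k.+1%:R * y1) + k.+1%:R * (x * y1 + k%:R * y0) - y2 =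
    (2 * k)%:R * (x * y1 + k.+1%:R * y0) by rewrite !mulr_natl.
rewrite natrM -[k.+1%:R]natr1 in h; move: (k%:R : R) h => n h.
have -> : (x ^+ 2 - 1) * (c * y2) + 2 * x * (c * y1) = c * ((x ^+ 2 - 1) * y2 + 2 * x * y1) by ring.
rewrite mulrCA; congr (_ * _).
have -> : (x ^+ 2 - 1) * y2 + 2 * x * y1 = x * (x * y2 + (n + 1) * y1) + (n + 1) * (x * y1 + n * y0) - y2
    - (2 * n * (x * y1 + (n + 1) * y0)) + n * (n + 1) * y0 by ring.
by rewrite h subrr add0r.
Qed.

(** All k derivatives must fall on the power of X - a, or a factor X - a survives. With [W_factor]
    this gives the values of P_k at 1 and -1. *)
Lemma horner_XsubC_exp k (q : {poly R}) (a : R) :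
  ((('X - a%:P) ^+ k * q)^`(k)).[a] = k`!%:R * q.[a].
Proof.
elim: k q => [|k IH] q; first by rewrite derivn0 expr0 mul1r fact0 mul1r.
have -> : (('X - a%:P) ^+ k.+1 * q)^`(k.+1) = (('X - a%:P) ^+ k * (q *+ k.+1 + ('X - a%:P) * q^`()))^`(k).
  rewrite derivSn derivM deriv_exp derivXsubC mul1r /= exprSr; congr (_^`(k)).
  by rewrite [in RHS]mulrDr [in RHS]mulrnAr mulrnAl mulrA.
by rewrite IH hornerD hornerMn hornerM hornerXsubC subrr mul0r addr0 factS natrM -[_ *+ k.+1]mulr_natl mulrA [_ * k.+1%:R]mulrC.
Qed.

Lemma W_factor k : W k = ('X - 1%:P) ^+ k * ('X - (-1)%:P) ^+ k.
Proof.
by rewrite -exprMn; congr (_ ^+ k); rewrite polyCN polyC1 opprK -subr_sqr expr1n.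
Qed.

Lemma legendre1 k : (P k).[1] = 1.
Proof.
rewrite legendreE W_factor horner_XsubC_exp horner_exp hornerXsubC opprK.
by rewrite [_ * (1 + 1) ^+ k]mulrC mulVf// gt_eqF// nk_gt0.
Qed.

Lemma legendreN1_sqr k : (P k).[-1] ^+ 2 = 1.
Proof.
rewrite legendreE W_factor [('X - 1%:P) ^+ k * _]mulrC horner_XsubC_exp horner_exp hornerXsubC.
have -> : (-1 - 1 : R) = (-1) * 2 by ring.
suff -> : (2 ^+ k * k`!%:R)^-1 * (k`!%:R * (-1 * 2) ^+ k) = (-1) ^+ k :> R by rewrite sqrr_sign.
rewrite (exprMn k).
have a0 : 2 ^+ k != 0 :> R by rewrite expf_neq0.
have b0 : k`!%:R != 0 :> R by rewrite pnatr_eq0 -lt0n fact_gt0.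
by move: (2 ^+ k) (k`!%:R) ((-1) ^+ k) a0 b0 => a b s a0 b0; field; rewrite a0 b0.
Qed.

(* By the differential equation, k (k+1) P_k^2 + (1 - x^2) P_k'^2 increases with |x|. *)
Lemma legendre_le1 k (x : R) : -1 <= x <= 1 -> `|(P k).[x]| <= 1.
Proof.
move=> /andP[xN1 x1]; case: k => [|k].
  have -> : P 0 = 1 by rewrite /legendre expr0 derivn0 expr0 fact0 mulr1 invr1 scale1r.
  by rewrite hornerC normr1.
pose n : R := k.+1%:R * (k.+1%:R + 1).
have n0 : 0 < n by rewrite mulr_gt0// ?ltr0n// ltr_wpDl// ler0n.
pose G : {poly R} := n *: (P k.+1) ^+ 2 + (1 - 'X ^+ 2) * (P k.+1)^`() ^+ 2.
have dG y : G^`().[y] = 2 * y * (P k.+1)^`().[y] ^+ 2.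
  have h := legendre_ode k.+1 y; rewrite -/n in h.
  rewrite /G; move: (P k.+1) h => Q h.
  rewrite !expr2 !(derivD, derivN, derivZ, derivM, derivC, derivX).
  rewrite !(hornerD, hornerN, hornerM, hornerX, hornerZ, hornerC).
  move: Q.[y] Q^`().[y] Q^`()^`().[y] h => a b d h.
  rewrite (_ : n * (b * a + a * b) = 2 * b * (n * a)); last by ring.
  rewrite -h; ring.
have Gx y : (1 - y ^+ 2) * (P k.+1)^`().[y] ^+ 2 + n * (P k.+1).[y] ^+ 2 = G.[y].
  by rewrite /G !(hornerD, hornerN, hornerM, hornerX, hornerZ, hornerC, horner_exp) addrC.
have G1 y : y ^+ 2 = 1 -> (P k.+1).[y] ^+ 2 = 1 -> G.[y] = n.
  by move=> y2 Py; rewrite -Gx y2 subrr mul0r add0r Py mulr1.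
have dGy y : derivable (horner G) y 1 by exact: derivable_horner.
have dGE y : (horner G)^`()%classic y = 2 * y * (P k.+1)^`().[y] ^+ 2 by rewrite -derivE dG.
have Gn : G.[x] <= n.
  have [x0|x0] := leP 0 x.
    rewrite -(G1 1) ?expr1n ?legendre1 ?expr1n//.
    apply: (@ger0_derive1_le_cc _ (horner G) 0 1) => //.
    - by move=> y; rewrite in_itv/= => /andP[y0 _]; rewrite dGE mulr_ge0 ?sqr_ge0// mulr_ge0// ltW.
    - exact: continuous_subspaceT (@continuous_horner _ G).
    - by rewrite in_itv/= x0.
    - by rewrite in_itv/= ler01 lexx.
  rewrite -(G1 (-1)) ?sqrrN ?expr1n ?legendreN1_sqr//.
  apply: (@ler0_derive1_le_cc _ (horner G) (-1) 0) => //.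
  - move=> y; rewrite in_itv/= => /andP[_ y0]; rewrite dGE -oppr_ge0 -mulNr -mulrN mulr_ge0 ?sqr_ge0//.
    by rewrite mulr_ge0// oppr_ge0 ltW.
  - exact: continuous_subspaceT (@continuous_horner _ G).
  - by rewrite in_itv/= xN1 ltW.
  - by rewrite in_itv/= lexx lerN10.
have x2 : 0 <= 1 - x ^+ 2.
  by rewrite subr_ge0 -real_normK ?num_real// expr_le1// ler_norml xN1.
have : n * (P k.+1).[x] ^+ 2 <= n.
  by apply: le_trans Gn; rewrite -Gx lerDr mulr_ge0// sqr_ge0.
rewrite -[leRHS]mulr1 ler_pM2l// => h.
by rewrite -(@ler_pXn2r _ 2) ?nnegrE// expr1n real_normK// num_real.
Qed.

End SymmetricInterval.

(** * Legendre coefficients of a cosine *)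

Section Taylor.
Context {R : realType}.
Implicit Types (F : nat -> R -> R) (B : nat -> R).

Definition taylor (n : nat) (a : nat -> R) : {poly R} := \poly_(i < n) (a i / i`!%:R).

Lemma horner_taylor n a (x : R) : (taylor n a).[x] = \sum_(i < n) a i / i`!%:R * x ^+ i.
Proof. by rewrite /taylor horner_poly. Qed.

Lemma deriv_taylor n a : (taylor n.+1 a)^`() = taylor n (fun i => a i.+1).
Proof.
apply/polyP => i; rewrite coef_deriv !coef_poly ltnS; case: ifP => // _; last by rewrite mul0rn.
rewrite -[LHS]mulr_natr -[LHS]mulrA; congr (_ * _).
by rewrite factS natrM invfM mulrAC mulVf ?mul1r// pnatr_eq0.
Qed.

Lemma taylor0 n a : (taylor n.+1 a).[0] = a 0%N.
Proof. by rewrite horner_coef0 coef_poly/= fact0 divr1. Qed.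

Lemma is_derive_continuous (h : R -> R) (h' : R -> R) :
  (forall x : R, is_derive x (1 : R) h (h' x)) -> continuous h.
Proof. by move=> dh x; have [d _] := dh x; exact/differentiable_continuous/derivable1_diffP. Qed.

Lemma ge0_of_derive (h h' : R -> R) (y : R) : (forall x : R, is_derive x (1 : R) h (h' x)) ->
  (forall x, 0 <= x -> 0 <= h' x) -> 0 <= h 0 -> 0 <= y -> 0 <= h y.
Proof.
move=> dh h'0 h0 y0; apply: (le_trans h0).
apply: (@ger0_derive1_le_cc _ h 0 y) => //.
- move=> x; rewrite in_itv/= => /andP[x0 _].
  by rewrite derive1E; have [_ ->] := dh x; exact/h'0/ltW.
- exact/continuous_subspaceT/(is_derive_continuous dh).
- by rewrite in_itv/= lexx.
- by rewrite in_itv/= lexx y0.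
Qed.

(** Induction through derivatives: the derivative of the remainder [D] is dominated by that of [G]
    and both vanish at 0, so G + D and G - D increase from 0. [F] and [B] are sequences so that the
    induction hypothesis applies to the shifted ones. *)
Lemma taylor_ge0 n F B (x : R) :
  (forall j (y : R), is_derive y (1 : R) (F j) (F j.+1 y)) ->
  (forall y, `|F n y| <= B n) -> 0 <= x ->
  `|F 0%N x - (taylor n (fun j => F j 0)).[x]| <= B n * x ^+ n / n`!%:R.
Proof.
elim: n F B x => [|n IH] F B x dF FB x0.
  by rewrite horner_taylor big_ord0 subr0 expr0 mulr1 fact0 divr1.
pose D y := F 0%N y - (taylor n.+1 (fun j => F j 0)).[y].
pose G y := B n.+1 * y ^+ n.+1 / n.+1`!%:R.
have dD (y : R) : is_derive y (1 : R) D (F 1%N y - (taylor n (fun j => F j.+1 0)).[y]).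
  by rewrite -(deriv_taylor n (fun j => F j 0)); apply: is_deriveB; exact: is_derive_horner.
have dG (y : R) : is_derive y (1 : R) G (B n.+1 * y ^+ n / n`!%:R).
  have -> : G = horner ((B n.+1 / n.+1`!%:R) *: 'X ^+ n.+1).
    by apply/funext => z; rewrite /G hornerZ hornerXn mulrAC.
  have -> : B n.+1 * y ^+ n / n`!%:R = ((B n.+1 / n.+1`!%:R) *: 'X ^+ n.+1 : {poly R})^`().[y].
    rewrite derivZ derivXn hornerZ hornerMn hornerXn factS natrM invfM -[_ *+ n.+1]mulr_natr.
    have : n.+1%:R != 0 :> R by rewrite pnatr_eq0.
    by have := fact_gt0 n; rewrite lt0n -(pnatr_eq0 R) => b a /=; rewrite -[X in _ = _ * X]mulr_natr; move: (n.+1%:R) (n`!%:R) a b => p q a b; field; rewrite ?a ?b.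
  exact: is_derive_horner.
have Dx y : 0 <= y -> `|F 1%N y - (taylor n (fun j => F j.+1 0)).[y]| <= B n.+1 * y ^+ n / n`!%:R.
  by move=> y0; exact: (IH (fun j => F j.+1) (fun j => B j.+1)).
have D0 : D 0 = 0 by rewrite /D taylor0 subrr.
have G0 : G 0 = 0 by rewrite /G expr0n/= mulr0 mul0r.
rewrite -/(D x) -/(G x).
have dS (y : R) := is_deriveD (dD y) (dG y).
have dS' (y : R) := is_deriveB (dG y) (dD y).
rewrite ler_norml; apply/andP; split.
  rewrite -subr_ge0 opprK; apply: (ge0_of_derive dS) => // [y y0|].
    by have := Dx _ y0; rewrite ler_norml => /andP[]; lra.
  by rewrite -[(D + G) 0]/(D 0 + G 0) D0 G0 addr0.
rewrite -subr_ge0; apply: (ge0_of_derive dS') => // [y y0|].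
  by have := Dx _ y0; rewrite ler_norml => /andP[]; lra.
by rewrite -[(G - D) 0]/(G 0 - D 0) D0 G0 subr0.
Qed.

Lemma taylor_le n F B (x : R) :
  (forall j (y : R), is_derive y (1 : R) (F j) (F j.+1 y)) ->
  (forall y, `|F n y| <= B n) ->
  `|F 0%N x - (taylor n (fun j => F j 0)).[x]| <= B n * `|x| ^+ n / n`!%:R.
Proof.
move=> dF FB; have [x0|x0] := leP 0 x; first by rewrite (ger0_norm x0); exact: taylor_ge0.
(* Reflection with the sign (-1)^j again gives a sequence of successive derivatives. *)
pose G j y := (-1) ^+ j * F j (- y).
have dG j (y : R) : is_derive y (1 : R) (G j) (G j.+1 y).
  have dN : is_derive (- y) (1 : R) (F j) (F j.+1 (- y)) by exact: dF.
  have dc := is_derive1_comp (f := F j) (g := -%R) (x := y) dN (is_deriveN (is_derive_id y (1 : R))).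
  apply: (is_derive_eq (is_deriveZ ((-1) ^+ j) dc)).
  by rewrite /G /GRing.scale/= exprS; ring.
have := @taylor_ge0 n G B (- x) dG; rewrite /G expr0 mul1r opprK (ltr0_norm x0) => h.
rewrite [X in _ - X](_ : _ = (taylor n (fun j => (-1) ^+ j * F j (-0))).[- x]).
  by apply: h; rewrite ?oppr_ge0 ?ltW// => y; rewrite normrM normrX normrN1 expr1n mul1r.
rewrite !horner_taylor; apply: eq_bigr => i _.
rewrite oppr0 [(- x) ^+ i]exprNn; have : ((-1) ^+ i) ^+ 2 = 1 :> R by rewrite sqrr_sign.
by move: ((-1) ^+ i : R) (F i 0) (x ^+ i) (i`!%:R^-1) => s a b d s2; transitivity (s ^+ 2 * (a * d * b)); [rewrite s2 mul1r|ring].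
Qed.

End Taylor.

(** * Bessel-type integrals and their decay *)

Section Bessel.
Context {R : realType}.
Notation A k := (I11 (fun x : R => (1 - x ^+ 2) ^+ k)).
Notation P k := (@legendre R k).
Notation nk k := (2 ^+ k * k`!%:R : R).
Implicit Types (w : R) (k : nat).

(** Poisson's integral: up to a constant, J_(k+1/2)(w) / w^(k+1/2), or j_k(w) / w^k with the
    spherical Bessel function j_k. *)
Definition bessel k w : R := I11 (fun x => cos (w * x) * (1 - x ^+ 2) ^+ k).

Definition phi k w : R := bessel k w / A k.

Let continuous_cosM w : continuous (fun x : R => cos (w * x)).
Proof.
rewrite (_ : (fun x => _) = (fun x => cos (w * x + 0))); first exact: continuous_cosDZ.
by apply/funext => x; rewrite addr0.
Qed.

Let continuous_sinM w : continuous (fun x : R => sin (w * x)).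
Proof.
apply: (@is_derive_continuous _ _ (fun x => w * cos (w * x + 0))) => x.
rewrite (_ : (fun x => _) = (fun x => sin (w * x + 0))); first exact: is_derive_sinDZ.
by apply/funext => y; rewrite addr0.
Qed.

(** The j-th derivative of cos(w x + a): each differentiation multiplies by w and advances the phase
    by pi/2. *)
Definition dcos w a (j : nat) (x : R) := w ^+ j * cos (w * x + (a + pi / 2 *+ j)).

Lemma is_derive_dcos w a j (x : R) : is_derive x (1 : R) (dcos w a j) (dcos w a j.+1 x).
Proof.
apply: (is_derive_eq (is_deriveZ (w ^+ j) (is_derive_cosDZ w (a + pi / 2 *+ j) x))).
have hc : cos (w * x + (a + pi / 2 *+ j.+1)) = - sin (w * x + (a + pi / 2 *+ j)).
  by rewrite mulrSr !addrA cosDpihalf.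
rewrite /dcos hc /GRing.scale/= exprS; ring.
Qed.

Lemma dcos0 w a x : dcos w a 0 x = cos (w * x + a).
Proof. by rewrite /dcos expr0 mul1r mulr0n addr0. Qed.

Lemma norm_dcos w a j x : `|dcos w a j x| <= `|w| ^+ j.
Proof. by rewrite normrM normrX ler_piMr ?exprn_ge0// cos_max. Qed.

(** k integrations by parts; in the k-th derivative of the cosine only the part in cos(w x)
    survives, the part in sin(w x) being odd. *)
Lemma I11_cos_legendre w a k :
  I11 (fun x => cos (w * x + a) * (P k).[x]) =
  (nk k)^-1 * (w ^+ k * (cos (a + pi / 2 *+ k) * bessel k w)).
Proof.
pose H := dcos w a; have dH := is_derive_dcos w a.
rewrite (@eq_I11 _ _ (fun x => H 0 x * (P k).[x])); last first.
  by move=> x; rewrite /H dcos0.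
rewrite (I11_legendre k dH); congr (_ * _).
pose b := a + pi / 2 *+ k.
have c1 := continuousM_ (@continuous_cosM w) (@continuous_bump R k).
have c2 := continuousM_ (@continuous_sinM w) (@continuous_bump R k).
have s0 : I11 (fun x => sin (w * x) * (1 - x ^+ 2) ^+ k) = 0.
  by apply: I11_odd => // x; rewrite mulrN sinN sqrrN mulNr.
transitivity (I11 (fun x => w ^+ k * (cos b * (cos (w * x) * (1 - x ^+ 2) ^+ k) - sin b * (sin (w * x) * (1 - x ^+ 2) ^+ k)))).
  by apply: eq_I11 => x; rewrite /H /dcos cosD -/b; ring.
have cc (r : R) : continuous (fun _ : R => r) by move=> x; exact: cst_continuous.
have c3 := continuousM_ (cc (cos b)) c1.
have c4 := continuousM_ (cc (sin b)) c2.
rewrite I11Z; last by move=> x; apply: cvgB; [exact: c3|exact: c4].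
by rewrite I11B// !I11Z// s0 mulr0 subr0.
Qed.

(** With v = 1 - x^2 and u = v^(k+2), the function w u sin(w x) + u' cos(w x) vanishes at 1 and -1
    and has derivative (w^2 u + u'') cos(w x); since x^2 = 1 - v, u'' is a combination of v^k and
    v^(k+1). *)
Lemma bessel_rec k w :
  w ^+ 2 * bessel k.+2 w =
  (k.+2 * (4 * k + 6))%:R * bessel k.+1 w - (4 * k.+1 * k.+2)%:R * bessel k w.
Proof.
pose v : {poly R} := 1 - 'X ^+ 2.
have dv : v^`() = - 'X *+ 2 by rewrite /v derivB derivC derivXn expr1 sub0r mulNrn.
have vE (x : R) : v.[x] = 1 - x ^+ 2 by rewrite /v !(hornerD, hornerN, hornerC, hornerXn).
pose u : {poly R} := v ^+ k.+2.
have uE (x : R) : u.[x] = (1 - x ^+ 2) ^+ k.+2 by rewrite horner_exp vE.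
have du : u^`() = - (2 * k.+2)%:R *: ('X * v ^+ k.+1).
  rewrite /u deriv_exp dv -!mul_polyC polyCN polyC_natr mulnC natrM; ring.
have d2u : u^`()^`() = (4 * k.+1 * k.+2)%:R *: v ^+ k - (k.+2 * (4 * k + 6))%:R *: v ^+ k.+1.
  rewrite du derivZ derivM derivX mul1r deriv_exp dv -!mul_polyC polyCN !polyC_natr /= exprS.
  have x2 : 'X * 'X = 1 - v :> {poly R} by rewrite /v; ring.
  have key (X y z K : {poly R}) : X * X = 1 - y ->
      - (2 * (K + 2)) * (y * z + X * ((- X * 2) * z * (K + 1))) =
      4 * (K + 1) * (K + 2) * z - (K + 2) * (4 * K + 6) * (y * z).
    move=> X2; transitivity (- (2 * (K + 2)) * (y * z - 2 * z * (K + 1) * (X * X))); first ring.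
    rewrite X2; ring.
  have := key 'X v (v ^+ k) k%:R x2; rewrite -[_ *+ k.+1]mulr_natr -[- 'X *+ 2]mulr_natr.
  rewrite !natrM natrD natrM -[k.+2%:R]natr1 -[k.+1%:R]natr1 => h.
  transitivity (- (2 * (k%:R + 2)) * (v * v ^+ k + 'X * (- 'X * 2 * v ^+ k * (k%:R + 1)))); first ring.
  rewrite h; ring.
pose G x := w * (u.[x] * sin (w * x)) + u^`().[x] * cos (w * x).
pose g x := w ^+ 2 * (cos (w * x) * (1 - x ^+ 2) ^+ k.+2) + ((4 * k.+1 * k.+2)%:R * (cos (w * x) * (1 - x ^+ 2) ^+ k) - (k.+2 * (4 * k + 6))%:R * (cos (w * x) * (1 - x ^+ 2) ^+ k.+1)).
have dc (x : R) : is_derive x (1 : R) (fun x => cos (w * x)) (- w * sin (w * x)).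
  have := is_derive_cosDZ w 0 x; rewrite addr0.
  by rewrite (_ : (fun x => _) = (fun x => cos (w * x)))//; apply/funext => y; rewrite addr0.
have ds (x : R) : is_derive x (1 : R) (fun x => sin (w * x)) (w * cos (w * x)).
  have := is_derive_sinDZ w 0 x; rewrite addr0.
  by rewrite (_ : (fun x => _) = (fun x => sin (w * x)))//; apply/funext => y; rewrite addr0.
have dG (x : R) : is_derive x (1 : R) G (g x).
  have h1 := is_deriveZ w (is_deriveM (is_derive_horner u x) (ds x)).
  have h2 := is_deriveM (is_derive_horner u^`() x) (dc x).
  apply: (is_derive_eq (is_deriveD h1 h2)).
  rewrite uE d2u hornerD hornerN !hornerZ !horner_exp !vE /g /GRing.scale/=.
  move: (u^`().[x]) ((k.+2 * (4 * k + 6))%:R) ((4 * k.+1 * k.+2)%:R) => u' p q; ring.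
have c j := continuousM_ (@continuous_cosM w) (@continuous_bump R j).
have cc (r : R) : continuous (fun _ : R => r) by move=> x; exact: cst_continuous.
have c' j (r : R) := continuousM_ (cc r) (c j).
have cB j r i s : continuous (fun x => r * (cos (w * x) * (1 - x ^+ 2) ^+ j) - s * (cos (w * x) * (1 - x ^+ 2) ^+ i)).
  by move=> x; apply: cvgB; exact: c'.
have cg : continuous g by apply: continuousD_; [exact: c'|exact: cB].
have u0 x : x ^+ 2 = 1 -> u.[x] = 0 /\ u^`().[x] = 0.
  move=> x2; rewrite uE du hornerZ hornerM horner_exp vE x2 subrr !exprS !mul0r !mulr0.
  by [].
have : I11 g = 0.
  rewrite (I11_FTC cg dG) /G.
  have [-> ->] := u0 1 (expr1n _ _); have [-> ->] : u.[-1] = 0 /\ u^`().[-1] = 0 by apply: u0; rewrite sqrrN expr1n.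
  by rewrite !mul0r mulr0 subrr.
rewrite /g I11D; [|exact: c'|exact: cB].
rewrite I11B; [|exact: c'|exact: c'].
rewrite !I11Z; try exact: c.
rewrite -!/(bessel _ _); lra.
Qed.

Lemma natr2D k m : (2 * k + m)%:R = 2 * k%:R + m%:R :> R.
Proof. by rewrite natrD natrM. Qed.

(** Solved for the lowest index: the recurrence is run downwards from large k, where phi_k is close
    to 1. *)
Lemma phi_rec k w :
  phi k w = phi k.+1 w - w ^+ 2 / ((2 * k + 3) * (2 * k + 5))%:R * phi k.+2 w.
Proof.
have := bessel_rec k w; rewrite /phi.
have := bump_int_rec (R := R) k; have := bump_int_rec (R := R) k.+1.
have := bump_int_gt0 (R := R) k; have := bump_int_gt0 (R := R) k.+1; have := bump_int_gt0 (R := R) k.+2.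
move: (A k) (A k.+1) (A k.+2) (bessel k w) (bessel k.+1 w) (bessel k.+2 w) => a b d x y z.
rewrite !natrM !natr2D natrD natrM -[k.+2%:R]natr1 -[k.+1%:R]natr1.
have := ler0n R k; move: (k%:R) => t t0 d0 b0 a0 h2 h1 h.
have bE : b = a * (2 * t + 2) / (2 * t + 3) by rewrite -[a * _]mulrC -h1; field; lra.
have dE : d = a * (2 * t + 2) * (2 * t + 4) / ((2 * t + 3) * (2 * t + 5)).
  transitivity (b * (2 * t + 4) / (2 * t + 5)); last by rewrite bE; field; rewrite ?gt_eqF//; lra.
  apply/esym; rewrite (_ : b * _ = (2 * (t + 1) + 3) * d); first by field; lra.
  rewrite h2; ring.
have xE : x = ((t + 1 + 1) * (4 * t + 6) * y - w ^+ 2 * z) / (4 * (t + 1) * (t + 1 + 1)).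
  by rewrite h; field; rewrite ?gt_eqF//; lra.
by rewrite xE dE bE; field; rewrite ?gt_eqF//; lra.
Qed.

Lemma phi_norm_le1 k w : `|phi k w| <= 1.
Proof.
have a0 := bump_int_gt0 (R := R) k; rewrite normrM normfV (gtr0_norm a0) ler_pdivrMr// mul1r.
have c1 := continuousM_ (@continuous_cosM w) (@continuous_bump R k).
have bx (x : R) : -1 <= x <= 1 -> `|cos (w * x) * (1 - x ^+ 2) ^+ k| <= (1 - x ^+ 2) ^+ k.
  move=> x1; have x2 : 0 <= 1 - x ^+ 2 by rewrite subr_ge0 -real_normK ?num_real// expr_le1// ler_norml.
  by rewrite normrM [X in _ * X]ger0_norm ?exprn_ge0// ler_piMl ?exprn_ge0// cos_max.
rewrite ler_norml; apply/andP; split.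
  rewrite -mulN1r -I11Z; last exact: continuous_bump.
  apply: I11_le => //; first exact: continuousM_ (fun x => @cst_continuous _ _ _ _) (@continuous_bump R k).
  by move=> x /bx; rewrite ler_norml mulN1r => /andP[].
apply: I11_le => //; first exact: continuous_bump.
by move=> x /bx; rewrite ler_norml => /andP[].
Qed.

Lemma cos_ge1Bsqr (y : R) : 1 - y ^+ 2 / 2 <= cos y.
Proof.
have := @taylor_le _ 2 (dcos 1 0) (fun=> 1) y (is_derive_dcos 1 0).
have -> : (taylor 2 ((dcos 1 0)^~ 0)).[y] = 1.
  rewrite horner_taylor !big_ord_recr big_ord0 /= add0r dcos0 /dcos mulr0 !add0r mulr1n cos0 cos_pihalf.
  by rewrite mulr0 !mul0r addr0 divr1 mul1r expr0.
rewrite dcos0 mul1r addr0.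
rewrite real_normK ?num_real// mul1r => h; have {h}/ler_normlP[] : `|cos y - 1| <= y ^+ 2 / 2.
  by apply: h => z; apply: (le_trans (norm_dcos _ _ _ _)); rewrite normr1 expr1n.
lra.
Qed.

(** cos y >= 1 - y^2/2, and by [bump_int_rec] the mean of x^2 for the weight (1 - x^2)^k is
    1/(2k+3). *)
Lemma phi_ge k w : 1 - w ^+ 2 / (2 * (2 * k + 3)%:R) <= phi k w.
Proof.
have a0 := bump_int_gt0 (R := R) k; rewrite /phi ler_pdivlMr//.
have c1 := continuousM_ (@continuous_cosM w) (@continuous_bump R k).
have cb j := @continuous_bump R j.
have cZ (r : R) j : continuous (fun x : R => r * (1 - x ^+ 2) ^+ j).
  exact: continuousM_ (fun x => @cst_continuous _ _ _ _) (cb j).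
have cB : continuous (fun x : R => (1 - w ^+ 2 / 2) * (1 - x ^+ 2) ^+ k + w ^+ 2 / 2 * (1 - x ^+ 2) ^+ k.+1).
  exact: continuousD_.
have -> : (1 - w ^+ 2 / (2 * (2 * k + 3)%:R)) * A k = (1 - w ^+ 2 / 2) * A k + w ^+ 2 / 2 * A k.+1.
  have := bump_int_rec (R := R) k; rewrite !natr2D; move: (A k) (A k.+1) => a b.
  have := ler0n R k; move: (k%:R) => t t0 h.
  have -> : b = a * (2 * t + 2) / (2 * t + 3) by rewrite -[a * _]mulrC -h; field; lra.
  by field; lra.
rewrite -!I11Z// -I11D//; apply: I11_le => // x x1.
have x2 : 0 <= 1 - x ^+ 2 by rewrite subr_ge0 -real_normK ?num_real// expr_le1// ler_norml.
apply: le_trans (ler_wpM2r (exprn_ge0 k x2) (cos_ge1Bsqr (w * x))).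
rewrite (exprS _ k) le_eqVlt; apply/orP; left; apply/eqP; rewrite exprMn.
move: ((1 - x ^+ 2) ^+ k) => z; by field.
Qed.

Section PhiBound.
Variables (w : R) (M : nat).
Hypothesis wM : 4 * w ^+ 2 <= ((2 * M + 3) * (2 * M + 5))%:R.

(** The coefficient in [phi_rec]; the hypothesis [wM] says that it is at most 1/4 at k = M, hence
    from there on. *)
Let d k : R := w ^+ 2 / ((2 * k + 3) * (2 * k + 5))%:R.

Let den_gt0 k : 0 < ((2 * k + 3) * (2 * k + 5))%:R :> R.
Proof. by rewrite ltr0n muln_gt0 !addn_gt0 !orbT. Qed.

Let d_ge0 k : 0 <= d k.
Proof. by rewrite divr_ge0 ?sqr_ge0// ltW. Qed.

Let d_le k : (M <= k)%N -> d k <= 4^-1.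
Proof.
move=> Mk; rewrite ler_pdivrMr// -ler_pdivrMl ?invr_gt0// invrK (le_trans wM)// ler_nat.
by rewrite leq_mul// leq_add2r leq_mul2l Mk orbT.
Qed.

(** Downward induction, [n] counting the steps to an index from which [phi_ge] gives phi_k >= 1/2.
    In the step, d <= 1/4 and phi_(k+2) <= 2 phi_(k+1) give phi_k >= phi_(k+1) / 2: the ratio 2
    reproduces itself. *)
Lemma phi_pos k : (M <= k)%N -> 0 < phi k w /\ phi k.+1 w <= 2 * phi k w.
Proof.
pose K := Num.bound (w ^+ 2).
have [K0 hK] : exists K, forall k, (K <= k)%N -> w ^+ 2 <= (2 * k + 3)%:R.
  exists K => j Kj; have /ltW h : w ^+ 2 < K%:R by rewrite archi_boundP ?sqr_ge0.
  by apply: (le_trans h); rewrite ler_nat; lia.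
suff H n : forall k, (M <= k)%N -> (K0 <= k + n)%N -> 0 < phi k w /\ phi k.+1 w <= 2 * phi k w.
  by move=> Mk; apply: (H K0) => //; rewrite leq_addl.
elim: n => {k}[|n IH] k Mk; rewrite ?addn0 => Kk.
  have h := phi_ge k w; have := hK _ Kk => hw.
  have h2 : w ^+ 2 / (2 * (2 * k + 3)%:R) <= 2^-1.
    by rewrite invfM mulrCA ler_piMr// ler_pdivrMr ?mul1r// ltr0n addn_gt0 orbT.
  have := phi_norm_le1 k.+1 w; rewrite ler_norml => /andP[_ h1]; split; lra.
have [p0 p1] : 0 < phi k.+1 w /\ phi k.+2 w <= 2 * phi k.+1 w by apply: IH; [exact: leqW|rewrite addSnnS].
have := phi_rec k w; rewrite -/(d k).
have := d_le Mk; have := d_ge0 k; move: (d k) (phi k w) (phi k.+1 w) (phi k.+2 w) p0 p1.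
move=> D x y z y0 zy D0 D1 ->; have : D * z <= D * (2 * y) by rewrite ler_wpM2l.
have : D * y <= 4^-1 * y by rewrite ler_pM2r.
by split; nra.
Qed.

(** By positivity and the recurrence, phi_(k+1) <= phi_(k+2). Putting the smaller one into the
    recurrence at k leaves the factor 1 - d_k <= exp(-d_k). *)
Lemma phi_step k : (M <= k)%N -> phi k w <= expR (- d k) * phi k.+1 w.
Proof.
move=> Mk; have [p0 _] := phi_pos (leqW Mk).
apply: (@le_trans _ _ ((1 - d k) * phi k.+1 w)); last by rewrite ler_pM2r// expR_ge1Dx.
have h : phi k.+1 w <= phi k.+2 w.
  have [q0 _] := phi_pos (leqW (leqW Mk)); have [r0 _] := phi_pos (leqW (leqW (leqW Mk))).
  by rewrite (phi_rec k.+1) lerBlDr lerDl mulr_ge0 ?d_ge0// ltW.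
by rewrite (phi_rec k) -/(d k) mulrBl mul1r lerD2l lerN2 ler_wpM2l.
Qed.

Let c k : R := w ^+ 2 / (2 * (2 * k + 3)%:R).

(** The c_k telescope: c_k - c_(k+1) = d_k. Hence phi_j exp(c_j) is nondecreasing in j, and its
    limit is at most 1 because c_j tends to 0 and phi_j <= 1. *)
Lemma phi_le_exp k : (M <= k)%N -> phi k w <= expR (- c k).
Proof.
move=> Mk; pose g j := phi j w * expR (c j).
have gS j : (M <= j)%N -> g j <= g j.+1.
  move=> Mj; rewrite /g; apply: (le_trans (ler_wpM2r (expR_ge0 _) (phi_step Mj))).
  rewrite mulrAC mulrC -expRD (_ : - d j + c j = c j.+1)//.
  rewrite /d /c natrM !natr2D -[j.+1%:R]natr1; have := ler0n R j; move: (j%:R) => t t0.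
  by field; rewrite ?gt_eqF//; lra.
have gk j : g k <= g (k + j)%N.
  by elim: j => [|j IH]; rewrite ?addn0// addnS (le_trans IH)// gS// (leq_trans Mk)// leq_addr.
have gj j : g k * (1 - c (k + j)%N) <= 1.
  have g0 : 0 < g k by rewrite mulr_gt0 ?expR_gt0//; have [] := phi_pos Mk.
  apply: (@le_trans _ _ (g (k + j)%N * expR (- c (k + j)%N))).
    by apply: (le_trans (ler_wpM2l (ltW g0) (expR_ge1Dx _))); rewrite ler_pM2r ?expR_gt0.
  rewrite /g -mulrA -expRD subrr expR0 mulr1.
  by have := phi_norm_le1 (k + j) w; rewrite ler_norml => /andP[].
have g1 : g k <= 1.
  (* If g_k > 1, then g_k (1 - c_(k+j)) <= 1 fails once j exceeds g_k w^2 / (g_k - 1). *)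
  rewrite leNgt; apply/negP => g1.
  have g0 : 0 <= g k * w ^+ 2 / (g k - 1).
    have g00 : 0 <= g k by exact: le_trans ler01 (ltW g1).
    by apply: divr_ge0; [exact: mulr_ge0 g00 (sqr_ge0 _)|rewrite subr_ge0 ltW].
  have := archi_boundP g0; set j := Num.bound _ => hj; have := gj j.
  rewrite mulrBr mulr1 lerBlDr -lerBlDl leNgt => /negP; apply.
  rewrite ltr_pdivrMr ?subr_gt0// in hj.
  rewrite /c mulrA ltr_pdivrMr; last by rewrite mulr_gt0// ltr0n addn_gt0 orbT.
  apply: (lt_le_trans hj); rewrite mulrC ler_pM2l ?subr_gt0// -natrM ler_nat; lia.
by rewrite expRN -ler_pdivlMr ?expR_gt0 ?invrK// in g1 *; rewrite -[leRHS]mul1r.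
Qed.

(** With z = w^2 / (2k+3) this becomes z exp(-z) <= 1/e, that is, 1 + (z - 1) <= exp(z - 1). *)
Lemma phi_sqr_le k : (M <= k)%N -> w ^+ 2 * phi k w ^+ 2 <= (2 * k + 3)%:R / expR 1.
Proof.
move=> Mk; have [p0 _] := phi_pos Mk.
have h := phi_le_exp Mk; pose z := w ^+ 2 / (2 * k + 3)%:R.
have n0 : 0 < (2 * k + 3)%:R :> R by rewrite ltr0n addn_gt0 orbT.
have h2 : phi k w ^+ 2 <= expR (- z).
  rewrite (_ : - z = - c k + - c k); last by rewrite /z /c; field; rewrite gt_eqF.
  by rewrite expRD expr2 ler_pM// ltW.
apply: (le_trans (ler_wpM2l (sqr_ge0 _) h2)).
rewrite (_ : w ^+ 2 = (2 * k + 3)%:R * z); last by rewrite /z; field; rewrite gt_eqF.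
rewrite -mulrA ler_pM2l// -expRN.
have -> : - 1 = (z - 1) + - z :> R by ring.
by rewrite expRD ler_pM2r ?expR_gt0// (le_trans _ (expR_ge1Dx _))// addrC subrK.
Qed.

End PhiBound.

End Bessel.

(** * Error of the Legendre projection of a cosine *)

Section ProjectionError.
Context {R : realType}.
Notation A k := (I11 (fun x : R => (1 - x ^+ 2) ^+ k)).
Notation P k := (@legendre R k).
Notation nk k := (2 ^+ k * k`!%:R : R).
Implicit Types (w a x : R) (k n N : nat).

(** The phases a = 0 and a = -pi/2 give the real and the imaginary part of E_w(x). *)
Definition cos_err N a w x : R :=
  cos (w * x + a) - Lproj N (fun t => cos (w * t + a)) x.

Definition cos_term k w : R := `|w| ^+ k * `|phi k w| / odd_fact k.

(** [bump_int_val] supplies the constant and [legendre_le1] the size of P_k. The factor |cos(a + k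
    pi/2)| is kept: for the two phases used it is 0 or 1 according to the parity of k. *)
Lemma legendre_term_le k w a x : -1 <= x <= 1 ->
  `|(k%:R + 1 / 2) * I11 (fun t => cos (w * t + a) * (P k).[t]) * (P k).[x]|
    <= `|cos (a + pi / 2 *+ k)| * cos_term k w.
Proof.
move=> x1; rewrite normrM (le_trans (ler_piMr _ (legendre_le1 k x1)))//.
rewrite I11_cos_legendre /cos_term.
have a0 := bump_int_gt0 (R := R) k; have d0 := odd_fact_gt0 (R := R) k.
have n0 : 0 < nk k by rewrite mulr_gt0 ?exprn_gt0 ?ltr0n ?fact_gt0.
have -> : (k%:R + 1 / 2) * ((nk k)^-1 * (w ^+ k * (cos (a + pi / 2 *+ k) * bessel k w))) =
   (w ^+ k * phi k w / odd_fact k) * cos (a + pi / 2 *+ k).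
  have -> : bessel k w = phi k w * A k by rewrite /phi divfK// gt_eqF.
  have := bump_int_val (R := R) k; rewrite natr2D.
  move: (A k) (odd_fact k) (nk k) (k%:R) (cos _) (phi _ _) (w ^+ k) a0 d0 n0 => b d n t c p z b0 d0 n0 h.
  transitivity (z * p * c / n / 2 * (d * b * (2 * t + 1)) / d); first by field; rewrite ?gt_eqF.
  by rewrite h; field; rewrite ?gt_eqF.
by rewrite normrM mulrC normrM normrM normrX normfV (gtr0_norm d0).
Qed.

(** The weights alternate, so a geometric majorant sums to al_m (1 + q^2 + ...) + be_m (q + q^3 +
    ...). Splitting off the first term exchanges [al] and [be], hence the induction over all m. *)
Lemma parity_sum (al be s : nat -> R) (q : R) M n :
  (forall k, al k.+1 = be k) -> (forall k, be k.+1 = al k) -> (forall k, 0 <= al k) -> (forall k, 0 <= be k) ->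
  0 <= q < 1 -> (forall k, 0 <= s k) -> (forall k, (M <= k)%N -> s k.+1 <= q * s k) ->
  forall m, (M <= m)%N -> \sum_(m <= k < m + n) al k * s k <= (al m + q * be m) / (1 - q ^+ 2) * s m.
Proof.
move=> alS beS al0 be0 /andP[q0 q1] s0 sS.
have den : 0 < 1 - q ^+ 2 by rewrite subr_gt0 expr_lt1.
have c0 a b : 0 <= a -> 0 <= b -> 0 <= (a + q * b) / (1 - q ^+ 2).
  by move=> a0 b0; apply: divr_ge0; [rewrite addr_ge0 ?mulr_ge0|exact: ltW].
elim: n => [|n IH] m Mm.
  by rewrite addn0 big_geq// mulr_ge0// c0.
rewrite big_ltn ?addnS ?ltnS ?leq_addr// -addSn.
apply: (le_trans (lerD (lexx _) (IH m.+1 (leqW Mm)))).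
rewrite alS beS.
apply: (le_trans (lerD (lexx _) (ler_wpM2l (c0 _ _ (be0 m) (al0 m)) (sS m Mm)))).
rewrite le_eqVlt; apply/orP; left; apply/eqP; by field; rewrite gt_eqF.
Qed.

Definition abs_cos k : R := `|cos (pi / 2 *+ k)|.
Definition abs_sin k : R := `|cos (- (pi / 2) + pi / 2 *+ k)|.

Lemma abs_cosS k : abs_cos k.+1 = abs_sin k.
Proof.
rewrite /abs_cos /abs_sin (mulrSr _ k) cosDpihalf normrN [X in cos X]addrC cosD.
by rewrite cosN sinN cos_pihalf sin_pihalf mulr0 mulrN mulr1 sub0r opprK.
Qed.

Lemma abs_sinS k : abs_sin k.+1 = abs_cos k.
Proof. by rewrite /abs_sin (mulrS _ k) addrA addNr add0r. Qed.

Lemma abs_cos_sin k : abs_cos k = 1 /\ abs_sin k = 0 \/ abs_cos k = 0 /\ abs_sin k = 1.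
Proof.
elim: k => [|k]; last by rewrite abs_cosS abs_sinS => -[] [-> ->]; [right|left].
by left; rewrite /abs_cos /abs_sin mulr0n addr0 cos0 cosN cos_pihalf normr0 normr1.
Qed.

(** A crude bound, (N+1)^2 being the sum of the 2k + 1; for [tail_cvg0] it only has to be polynomial
    in N. *)
Lemma Lproj_bound N (h : R -> R) (r : R) x : continuous h -> -1 <= x <= 1 ->
  (forall t, -1 <= t <= 1 -> `|h t| <= r) -> `|Lproj N h x| <= r * N.+1%:R ^+ 2.
Proof.
move=> ch x1 hr; rewrite /Lproj; apply: (le_trans (ler_norm_sum _ _ _)).
have r0 : 0 <= r by apply: (le_trans _ (hr 0 _)) => //; rewrite lerN10 ler01.
apply: (@le_trans _ _ (\sum_(0 <= k < N.+1) (k%:R + 1 / 2) * (2 * r))).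
  apply: ler_sum => k _; rewrite normrM (le_trans (ler_piMr _ (legendre_le1 k x1)))//.
  have k0 : 0 <= k%:R + 1 / 2 :> R by have := ler0n R k; lra.
  rewrite normrM ger0_norm// ler_wpM2l//.
  apply: I11_norm; first exact: continuousM_ ch (@continuous_horner _ (P k)).
  by move=> t t1; rewrite normrM (le_trans (ler_piMr _ (legendre_le1 k t1)))// hr.
rewrite -mulr_suml le_eqVlt; apply/orP; left; apply/eqP.
elim: N => [|n IH]; first by rewrite big_nat1; by field.
rewrite big_nat_recr//= mulrDl IH -[n.+2%:R]natr1 -[n.+1%:R]natr1; by field.
Qed.

(** The projection fixes the Taylor polynomial of degree n, so the error is that of the Taylor
    remainder. The factorial beats the square, which proves the convergence of the Legendre series
    of a cosine without a completeness argument. *)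
Lemma cos_err_tail n a w x : -1 <= x <= 1 ->
  `|cos_err n a w x| <= (`|w| ^+ n.+1 / n.+1`!%:R) * (1 + n.+1%:R ^+ 2).
Proof.
move=> x1; pose T := taylor n.+1 (fun j => dcos w a j 0).
have hT t : -1 <= t <= 1 -> `|cos (w * t + a) - T.[t]| <= `|w| ^+ n.+1 / n.+1`!%:R.
  move=> t1; rewrite -dcos0.
  have := @taylor_le _ n.+1 (dcos w a) (fun j => `|w| ^+ j) t (is_derive_dcos w a) (norm_dcos w a n.+1).
  move=> /le_trans; apply; rewrite ler_wpM2r ?invr_ge0// ler_piMr ?exprn_ge0//.
  by rewrite exprn_ile1// ler_norml.
have cc : continuous (fun t => cos (w * t + a)) := @continuous_cosDZ R w a.
have cT := @continuous_horner _ T.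
have -> : cos_err n a w x = (cos (w * x + a) - T.[x]) - Lproj n (fun t => cos (w * t + a) - T.[t]) x.
  rewrite (@LprojB _ n (fun t => cos (w * t + a)) (horner T))// Lproj_poly; last exact: size_poly.
  by rewrite /cos_err; ring.
apply: (le_trans (ler_normB _ _)); rewrite mulrDr mulr1 lerD ?hT//.
by apply: Lproj_bound => // t; apply: cvgB; [exact: cc|exact: cT].
Qed.

Lemma cos_err_split N n a w x : (N <= n)%N -> -1 <= x <= 1 ->
  `|cos_err N a w x| <= (`|w| ^+ n.+1 / n.+1`!%:R) * (1 + n.+1%:R ^+ 2) +
     \sum_(N.+1 <= k < n.+1) `|cos (a + pi / 2 *+ k)| * cos_term k w.
Proof.
move=> Nn x1.
have -> : cos_err N a w x = cos_err n a w x +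
    \sum_(N.+1 <= k < n.+1) (k%:R + 1 / 2) * I11 (fun t => cos (w * t + a) * (P k).[t]) * (P k).[x].
  by rewrite /cos_err /Lproj (@big_cat_nat _ _ _ N.+1 0 n.+1)//=; ring.
apply: (le_trans (ler_normD _ _)); apply: lerD; first exact: cos_err_tail.
apply: (le_trans (ler_norm_sum _ _ _)); apply: ler_sum => k _; exact: legendre_term_le.
Qed.

(** 1 + m^2 <= 4^m reduces the sequence to the general term of the exponential series at 4|w|. *)
Lemma tail_cvg0 w : (fun n : nat => (`|w| ^+ n.+1 / n.+1`!%:R) * (1 + n.+1%:R ^+ 2)) @ \oo --> (0 : R).
Proof.
have h : (fun n => exp_coeff (4 * `|w|) n.+1) @ \oo --> (0 : R).
  by rewrite (cvg_shiftS (exp_coeff (4 * `|w|))); exact: cvg_exp_coeff.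
apply: (squeeze_cvgr _ (cvg_cst 0) h); near=> n.
rewrite mulr_ge0 ?divr_ge0 ?exprn_ge0 ?addr_ge0 ?sqr_ge0//=.
rewrite /exp_coeff /= exprMn mulrAC [leRHS]mulrAC [leRHS]mulrC -!mulrA ler_wpM2l ?exprn_ge0// mulrC.
rewrite [leRHS]mulrC ler_wpM2l ?invr_ge0//.
rewrite -!natrX -(natrD _ 1) ler_nat; elim: n.+1 => // m IH.
by rewrite (expnS 4); move: IH; rewrite -!mulnn; move: (4 ^ m)%N => z; nia.
Unshelve. all: by end_near. Qed.

Lemma cos_err_le N a w x (C : R) : -1 <= x <= 1 ->
  (forall n, (N <= n)%N -> \sum_(N.+1 <= k < n.+1) `|cos (a + pi / 2 *+ k)| * cos_term k w <= C) ->
  `|cos_err N a w x| <= C.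
Proof.
move=> x1 hC.
have h : (fun n : nat => (`|w| ^+ n.+1 / n.+1`!%:R) * (1 + n.+1%:R ^+ 2) + C) @ \oo --> 0 + C.
  by apply: cvgD; [exact: tail_cvg0|exact: cvg_cst].
rewrite add0r in h.
rewrite -(cvg_lim (@Rhausdorff R) h); apply: limr_ge; first by apply/cvg_ex; exists C.
near=> n; apply: (le_trans (@cos_err_split N n a w x _ x1)); first by near: n; exact: nbhs_infty_ge.
by rewrite lerD2l hC//; near: n; exact: nbhs_infty_ge.
Unshelve. all: by end_near. Qed.

(** At k = N + 1 one phase has weight 1 and the other 0, so the two errors receive the even and the
    odd part of the geometric series; the squares of 1/(1-q^2) and q/(1-q^2) add up to the
    constant. *)
Lemma cos_err_sqr N w x (s : nat -> R) (q : R) : -1 <= x <= 1 ->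
  0 <= q < 1 -> (forall k, 0 <= s k) ->
  (forall k, (N < k)%N -> cos_term k w <= s k) -> (forall k, (N < k)%N -> s k.+1 <= q * s k) ->
  (cos_err N 0 w x) ^+ 2 + (cos_err N (- (pi / 2)) w x) ^+ 2 <=
    (1 + q ^+ 2) / (1 - q ^+ 2) ^+ 2 * s N.+1 ^+ 2.
Proof.
move=> x1 /andP[q0 q1] s0 ts sS.
have den : 0 < 1 - q ^+ 2 by rewrite subr_gt0 expr_lt1.
pose al := abs_cos; pose be := abs_sin.
have al0 k : 0 <= al k by exact: normr_ge0.
have be0 k : 0 <= be k by exact: normr_ge0.
have q01 : 0 <= q < 1 by rewrite q0.
have E1 : `|cos_err N 0 w x| <= (al N.+1 + q * be N.+1) / (1 - q ^+ 2) * s N.+1.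
  apply: cos_err_le => // n Nn; apply: le_trans (@parity_sum al be s q N.+1 (n - N) abs_cosS abs_sinS al0 be0 q01 s0 sS N.+1 (leqnn _)).
  rewrite addSn subnKC// big_seq [leRHS]big_seq; apply: ler_sum => k.
  by rewrite mem_index_iota add0r => /andP[Nk _]; rewrite ler_wpM2l// ts.
have E2 : `|cos_err N (- (pi / 2)) w x| <= (be N.+1 + q * al N.+1) / (1 - q ^+ 2) * s N.+1.
  apply: cos_err_le => // n Nn; apply: le_trans (@parity_sum be al s q N.+1 (n - N) abs_sinS abs_cosS be0 al0 q01 s0 sS N.+1 (leqnn _)).
  rewrite addSn subnKC// big_seq [leRHS]big_seq; apply: ler_sum => k.
  by rewrite mem_index_iota => /andP[Nk _]; rewrite ler_wpM2l// ts.
have sq (z u : R) : `|z| <= u -> z ^+ 2 <= u ^+ 2.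
  by move=> zu; rewrite -real_normK ?num_real// ler_pXn2r// nnegrE (le_trans _ zu).
apply: (le_trans (lerD (sq _ _ E1) (sq _ _ E2))).
rewrite !exprMn -mulrDl ler_wpM2r ?sqr_ge0// -mulrDl exprVn ler_wpM2r ?invr_ge0 ?sqr_ge0//.
case: (abs_cos_sin N.+1); rewrite -/(al _) -/(be _) => -[-> ->]; rewrite ?mulr0 ?mulr1 ?addr0 ?add0r; lra.
Qed.

End ProjectionError.

(** * Numerical bounds *)

Section Numerics.
Context {R : realType}.
Local Notation E := (expR (1 : R)).

Lemma expR1_ge : 2718 / 1000 <= E.
Proof.
have h : series (exp_coeff (1 : R)) 7 <= E.
  apply: nondecreasing_cvgn_le; last exact: is_cvg_series_exp_coeff.
  by apply: nondecreasing_series => n _ _; exact: exp_coeff_ge0.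
apply: le_trans h.
have t k m : k`! = m -> exp_coeff (1 : R) k = m%:R^-1.
  by move=> <-; rewrite /exp_coeff /= expr1n div1r.
have -> : series (exp_coeff (1 : R)) 7 = exp_coeff 1 0 + exp_coeff 1 1 + exp_coeff 1 2 +
    exp_coeff 1 3 + exp_coeff 1 4 + exp_coeff 1 5 + exp_coeff 1 6.
  by rewrite /series /= big_mkord !big_ord_recr big_ord0 /= add0r.
rewrite (t 0 1)// (t 1 1)// (t 2 2)// (t 3 6)// (t 4 24)// (t 5 120)// (t 6 720)//.
lra.
Qed.

(** 1 - 1/16 <= exp(-1/16), raised to the power 16; (16/15)^16 is about 2.8085. *)
Lemma expR1_le : E <= 281 / 100.
Proof.
have h : (1 - 16^-1) ^+ 16 * E <= 1.
  have -> : E = expR (16^-1) ^+ 16 by rewrite -expRM_natl mulfV.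
  rewrite -exprMn exprn_ile1 ?mulr_ge0 ?expR_ge0//; first lra.
  rewrite -ler_pdivlMr ?expR_gt0// div1r -expRN; exact: expR_ge1Dx.
have p0 : 0 < (1 - 16^-1) ^+ 16 :> R by rewrite exprn_gt0//; lra.
have : E <= ((1 - 16^-1) ^+ 16)^-1 by rewrite -[leRHS]mul1r ler_pdivlMr// mulrC.
move=> /le_trans; apply; rewrite -[leRHS]invrK lef_pV2 ?posrE ?invr_gt0//; lra.
Qed.

(** If pi < 3 then cos(3/2) <= 0, while Taylor's formula of order 6 gives cos(3/2) >= 0.07. *)
Lemma pi_ge3 : 3 <= pi :> R.
Proof.
rewrite leNgt; apply/negP => p3.
have h := @taylor_le _ 6 (dcos 1 0) (fun=> 1) (3 / 2 : R) (is_derive_dcos 1 0).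
have T : (taylor 6 ((dcos 1 0)^~ 0)).[3 / 2 : R] = 1 - (3 / 2) ^+ 2 / 2 + (3 / 2) ^+ 4 / 24.
  have d k : dcos (1 : R) 0 k.+2 0 = - dcos 1 0 k 0.
    rewrite /dcos !expr1n !mul1r !add0r -(addn2 k) mulrnDr -[pi / 2 *+ 2]mulr_natr divfK// cosDpi//.
  have d0 : dcos (1 : R) 0 0 0 = 1 by rewrite dcos0 mulr0 addr0 cos0.
  have d1 : dcos (1 : R) 0 1 0 = 0 by rewrite /dcos mulr0 !add0r mulr1n cos_pihalf mulr0.
  rewrite horner_taylor !big_ord_recr big_ord0 /= !d d0 d1.
  have -> : 2`!%:R = 2 :> R by [].
  have -> : 4`!%:R = 24 :> R by [].
  rewrite !oppr0 !opprK !mul0r fact0; lra.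
have : cos (3 / 2 : R) <= 0.
  by rewrite ltW// -(@cos_pihalf R) ltr_cos ?in_itv/=; have := @pi_ge2 R; lra.
have {}h : `|cos (3 / 2 : R) - (1 - (3 / 2) ^+ 2 / 2 + (3 / 2) ^+ 4 / 24)| <= (3 / 2) ^+ 6 / 720.
  have n0 : 0 <= 3 / 2 :> R by lra.
  rewrite -T; move: h; rewrite dcos0 mul1r addr0 mul1r (ger0_norm n0) => h; apply: h => y.
  by rewrite (le_trans (norm_dcos _ _ _ _))// normr1 expr1n.
move: h => /ler_normlP[]; lra.
Qed.

(* Up to a factor linear in M, the ratio between the square of the M-th term of the
   Legendre expansion of a cosine of frequency c and the bound (e c / (2M+3))^(2M). *)
Definition growth (M : nat) : R := ((2 * M + 3)%:R / E) ^+ (2 * M) / odd_fact M ^+ 2.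

Lemma growth_ge0 M : 0 <= growth M.
Proof. by rewrite divr_ge0 ?sqr_ge0// exprn_ge0// divr_ge0 ?expR_ge0. Qed.

(** With y = 2M + 3, the inequality (1 + 2/y)^y <= e^2 bounds the ratio of consecutive values by y^3
    / ((y+2)(y-2)^2); what is left is y^3 (y-4) <= (y+2)(y-2)^3. *)
Lemma growth_step M : (0 < M)%N ->
  growth M.+1 / (2 * M%:R + 1) <= growth M / (2 * M%:R - 1).
Proof.
move=> M0; have m1 : 1 <= M%:R :> R by rewrite ler1n.
pose y : R := (2 * M + 3)%:R; have yE : y = 2 * M%:R + 3 by rewrite /y natr2D.
have y0 : 0 < y by rewrite yE; lra.
have e0 := expR_gt0 (1 : R); have d0 := odd_fact_gt0 (R := R) M.
have h : (y + 2) ^+ (2 * M + 2) * (y + 2) <= E ^+ 2 * y ^+ (2 * M + 3).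
  have : (1 + 2 / y) ^+ (2 * M + 3) <= E ^+ 2.
    have -> : E ^+ 2 = expR (2 / y) ^+ (2 * M + 3).
      by rewrite -!expRM_natl -/y; congr expR; field; rewrite gt_eqF.
    rewrite lerXn2r ?nnegrE ?expR_ge0 ?expR_ge1Dx//.
    by apply: addr_ge0 => //; apply: divr_ge0 => //; exact: ltW.
  rewrite -(ler_pM2r (exprn_gt0 (2 * M + 3) y0)) -(exprMn (2 * M + 3)) => /(le_trans _); apply.
  rewrite -exprSr -addnS le_eqVlt; apply/orP; left; apply/eqP; congr (_ ^+ _).
  by field; rewrite gt_eqF.
have -> : growth M.+1 = (y + 2) ^+ (2 * M + 2) / (E ^+ (2 * M) * E ^+ 2 * (2 * M%:R + 1) ^+ 2 * odd_fact M ^+ 2).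
  rewrite /growth odd_factS exprMn natr2D (_ : 2 * M.+1 + 3 = (2 * M + 3) + 2)%N; last lia.
  rewrite natrD -/y (_ : 2 * M.+1 = 2 * M + 2)%N; last lia.
  rewrite exprVn (exprD E); field; rewrite !expf_neq0 ?gt_eqF//; lra.
have -> : growth M = y ^+ (2 * M) / (E ^+ (2 * M) * odd_fact M ^+ 2).
  rewrite /growth expr_div_n -/y; field; rewrite !expf_neq0 ?gt_eqF//.
rewrite (exprD y) in h.
have [tE s1] : 2 * M%:R + 1 = y - 2 /\ 2 * M%:R - 1 = y - 4 by split; lra.
have y4 : 0 < y - 4 by lra.
rewrite tE s1.
move: (y ^+ (2 * M)) (E ^+ (2 * M)) (odd_fact M) ((y + 2) ^+ (2 * M + 2)) (E ^+ 2) h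
  (exprn_gt0 (2 * M) y0) (exprn_gt0 (2 * M) e0) d0 (exprn_gt0 2 e0) => Y D o Z E2 h Y0 D0 o0 E20.
have hZ : Z <= E2 * (Y * y ^+ 3) / (y + 2) by rewrite ler_pdivlMr//; lra.
have den : 0 < D * E2 * (y - 2) ^+ 2 * o ^+ 2 * (y - 2) by rewrite !mulr_gt0 ?exprn_gt0//; lra.
rewrite -mulrA -invfM; apply: (@le_trans _ _ (E2 * (Y * y ^+ 3) / (y + 2) / (D * E2 * (y - 2) ^+ 2 * o ^+ 2 * (y - 2)))).
  by rewrite ler_pM2r ?invr_gt0.
rewrite [leLHS](_ : _ = Y / (D * o ^+ 2) * (y ^+ 3 / ((y + 2) * (y - 2) ^+ 3))); last first.
  by field; rewrite ?gt_eqF//; lra.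
apply: ler_wpM2l; first by rewrite ltW// divr_gt0// mulr_gt0// exprn_gt0.
rewrite ler_pdivrMr; last by rewrite mulr_gt0 ?exprn_gt0//; lra.
rewrite mulrC ler_pdivlMr//; lra.
Qed.

Lemma growth_prod M : growth M = \prod_(i < M) (((2 * M + 3)%:R / E) ^+ 2 / (2 * i + 1)%:R ^+ 2).
Proof.
by rewrite /growth big_split/= prodr_const card_ord -exprM prodfV /odd_fact -prodrXl.
Qed.

(** [Z] is a decimal rounding from above of the squared base, which keeps the rationals in the
    product small. *)
Let growth_num M (Z : R) : ((2 * M + 3)%:R / (2718 / 1000)) ^+ 2 <= Z ->
  growth M <= \prod_(i < M) (Z / (2 * i + 1)%:R ^+ 2).
Proof.
move=> hZ; rewrite growth_prod; apply: ler_prod => i _.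
rewrite divr_ge0 ?sqr_ge0//= ler_wpM2r ?invr_ge0 ?sqr_ge0// (le_trans _ hZ)//.
have l0 : 0 < 2718 / 1000 :> R by lra.
have h : (2 * M + 3)%:R / E <= (2 * M + 3)%:R / (2718 / 1000).
  by apply: ler_wpM2l => //; rewrite lef_pV2 ?posrE ?expR_gt0//; exact: expR1_ge.
have h0 : 0 <= (2 * M + 3)%:R / E by apply: divr_ge0 => //; exact: expR_ge0.
by rewrite ler_pXn2r// nnegrE; exact: le_trans h0 h.
Qed.

Let odd_sqr : ((2 * 0 + 1)%:R ^+ 2 = 1 :> R) * ((2 * 1 + 1)%:R ^+ 2 = 9 :> R) *
  ((2 * 2 + 1)%:R ^+ 2 = 25 :> R) * ((2 * 3 + 1)%:R ^+ 2 = 49 :> R) *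
  ((2 * 4 + 1)%:R ^+ 2 = 81 :> R) * ((2 * 5 + 1)%:R ^+ 2 = 121 :> R).
Proof. by rewrite -!natrX. Qed.

Lemma growth2 : growth 2 <= 489 / 100.
Proof.
apply: (le_trans (@growth_num 2 (6 + 6329 / 10000) _)); first by rewrite -[(_ + _)%N]/7%N; lra.
by rewrite !big_ord_recr big_ord0 /= !odd_sqr; lra.
Qed.

Lemma growth3 : growth 3 <= 586 / 100.
Proof.
apply: (le_trans (@growth_num 3 (10 + 9645 / 10000) _)); first by rewrite -[(_ + _)%N]/9%N; lra.
by rewrite !big_ord_recr big_ord0 /= !odd_sqr; lra.
Qed.

Lemma growth4 : growth 4 <= 653 / 100.
Proof.
apply: (le_trans (@growth_num 4 (16 + 3793 / 10000) _)); first by rewrite -[(_ + _)%N]/11%N; lra.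
by rewrite !big_ord_recr big_ord0 /= !odd_sqr; lra.
Qed.

Lemma growth5 : growth 5 <= 703 / 100.
Proof.
apply: (le_trans (@growth_num 5 (22 + 8767 / 10000) _)); first by rewrite -[(_ + _)%N]/13%N; lra.
by rewrite !big_ord_recr big_ord0 /= !odd_sqr; lra.
Qed.

Lemma growth6 : growth 6 <= 7392 / 1000.
Proof.
apply: (le_trans (@growth_num 6 (30 + 4568 / 10000) _)); first by rewrite -[(_ + _)%N]/15%N; lra.
by rewrite !big_ord_recr big_ord0 /= !odd_sqr; lra.
Qed.

(** The constant comes from [growth6]: 7.392 = 0.672 * 11. [growth_step] propagates it. *)
Lemma growth_ge6 M : (6 <= M)%N -> growth M <= 672 / 1000 * (2 * M%:R - 1).
Proof.
elim: M => // M IH; rewrite leq_eqVlt => /predU1P[<-|M6].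
  by apply: (le_trans growth6); lra.
have m1 : 6 <= M%:R :> R by rewrite ler_nat.
have := growth_step (leq_trans (isT : 0 < 6)%N M6).
have := IH M6; rewrite -ler_pdivrMr; last lra.
move=> h1 h2; have := le_trans h2 h1; rewrite ler_pdivrMr; last lra.
by rewrite -natr1; lra.
Qed.

End Numerics.

(** * The projection error *)

Section ErrorIntegral.
Context {R : realType}.
Notation mu := (@lebesgue_measure R).
Notation P k := (@legendre R k).
Local Notation E := (expR (1 : R)).
Implicit Types (u : R -> R) (w x a c q : R).

Lemma Rint_indicM (a b : R) (h : R -> R) :
  \int[mu]_t (\1_`[a, b] t * h t) = \int[mu]_(t in `[a, b]) h t.
Proof.
rewrite [RHS]Rintegral_mkcond; congr Rintegral; apply/funext => t.
by rewrite patchE indicE; case: (t \in _); rewrite ?mul1r ?mul0r.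
Qed.

(** Cutting P_k to [-1, 1] makes the Legendre coefficient of a cosine of frequency w a transform
    [ctr] in w, for which measurability, bounds and the exchange of integrals are available. *)
Definition leg_ind k : R -> R := fun t => \1_`[- 1, 1] t * (P k).[t].

Lemma rint_leg_ind k : rint (leg_ind k).
Proof.
have := int_I11 (@continuous_horner R (P k)); rewrite /rint integrable_mkcond//.
congr (_.-integrable _ _); apply/funext => t.
by rewrite patchE /= /leg_ind indicE; case: (t \in _); rewrite ?mul1r ?mul0r.
Qed.

Lemma I11_ctr a w k : I11 (fun t => cos (w * t + a) * (P k).[t]) = ctr (leg_ind k) a w.
Proof.
rewrite /I11 -Rint_indicM; congr Rintegral; apply/funext => t.
by rewrite /leg_ind mulrCA -!mulrA [w * t]mulrC [_ * cos _]mulrC mulrA [_ * (P k).[t]]mulrC; ring.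
Qed.

Lemma cos_errE N a w x : cos_err N a w x =
  cos (w * x + a) - \sum_(0 <= k < N.+1) (k%:R + 1 / 2) * ctr (leg_ind k) a w * (P k).[x].
Proof. by congr (_ - _); apply: eq_bigr => k _; rewrite I11_ctr. Qed.

Lemma meas_cos_err N a x : measurable_fun [set: R] (fun w => cos_err N a w x).
Proof.
under eq_fun do rewrite cos_errE.
apply: measurable_funB; first exact: meas_cos1.
apply: measurable_sum => k; apply: measurable_funM => //; apply: measurable_funM => //.
by apply: meas_ctr; exact: rint_leg_ind.
Qed.

Lemma cos_err_bound N a x : exists M : R, forall w, `|cos_err N a w x| <= M.
Proof.
exists (1 + \sum_(0 <= k < N.+1) `|k%:R + 1 / 2| * (\int[mu]_t `|leg_ind k t|) * `|(P k).[x]|) => w.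
rewrite cos_errE; apply: (le_trans (ler_normB _ _)); apply: lerD; first exact: cos_max.
apply: (le_trans (ler_norm_sum _ _ _)); apply: ler_sum => k _.
by rewrite !normrM ler_wpM2r// ler_wpM2l// ctr_bound// rint_leg_ind.
Qed.

Lemma rint_cos_errM N a x u : rint u -> rint (fun w => u w * cos_err N a w x).
Proof.
by move=> iu; have [M hM] := cos_err_bound N a x; apply: (rintMb (M := M) iu) => //; exact: meas_cos_err.
Qed.

(** The projection commutes with the superposition over w: [ctr_swap] moves each coefficient under
    the integral in w. *)
Lemma ctr_err N a x u : rint u ->
  ctr u a x - \sum_(0 <= k < N.+1) (k%:R + 1 / 2) * I11 (fun t => ctr u a t * (P k).[t]) * (P k).[x] =
  \int[mu]_w (u w * cos_err N a w x).
Proof.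
move=> iu; have ik k := rint_leg_ind k.
have iuc k : rint (fun w => u w * ctr (leg_ind k) a w).
  by apply: (rintMb iu (meas_ctr a (ik k))) => w; exact: ctr_bound.
have Ik k : I11 (fun t => ctr u a t * (P k).[t]) = \int[mu]_w (u w * ctr (leg_ind k) a w).
  rewrite (ctr_swap a iu (ik k)) /I11 -Rint_indicM; congr Rintegral; apply/funext => t.
  rewrite /leg_ind; ring.
under eq_bigr do rewrite Ik.
pose S n w := \sum_(0 <= k < n) (k%:R + 1 / 2) * ctr (leg_ind k) a w * (P k).[x].
have HS n : rint (fun w => u w * S n w) /\
    \int[mu]_w (u w * S n w) = \sum_(0 <= k < n) (k%:R + 1 / 2) * (\int[mu]_w (u w * ctr (leg_ind k) a w)) * (P k).[x].
  elim: n => [|n [IH1 IH2]].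
    rewrite big_nil Rint0//; last by move=> w; rewrite /S big_nil mulr0.
    split=> //; have := rintZ 0 iu; congr rint; apply/funext => w.
    by rewrite /S big_nil mulr0 mul0r.
  have SE : (fun w => u w * S n.+1 w) =
      (fun w => u w * S n w + (n%:R + 1 / 2) * (P n).[x] * (u w * ctr (leg_ind n) a w)).
    by apply/funext => w; rewrite /S big_nat_recr//=; ring.
  have i2 := rintZ ((n%:R + 1 / 2) * (P n).[x]) (iuc n).
  rewrite SE; split; first exact: rintD.
  by rewrite (RintD IH1 i2) RintZ// IH2 [RHS]big_nat_recr//=; congr (_ + _); ring.
have [S1 <-] := HS N.+1.
have iuw : rint (fun w => u w * cos (w * x + a)).
  by apply: (rintMb (M := 1) iu); [exact: meas_cos1|move=> w; exact: cos_max].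
rewrite /ctr -(RintB iuw S1); congr Rintegral; apply/funext => w.
by rewrite cos_errE mulrBr.
Qed.

Notation Ec N x := (fun w => cos_err N 0 w x).
Notation Es N x := (fun w => cos_err N (- (pi / 2)) w x).

Let rotation_sqr (K a b p q s t : R) : a = K * (p - t) -> b = K * (q + s) ->
  a ^+ 2 + b ^+ 2 = K * (a * p + b * q + (b * s - a * t)).
Proof. by move=> aE bE; rewrite expr2 {2}aE expr2 {2}bE; ring. Qed.

Let le_half (z r : R) : r <= 2^-1 * z + 2^-1 * r -> r <= z.
Proof. by lra. Qed.

(* AM-GM: [2 (u X + v Y) <= l (u^2 + v^2) + (X^2 + Y^2) / l], with [l] chosen so
   that the last term integrates to the left-hand side. *)
Lemma err_sqr_le N x u v (c B e1 e2 : R) : cs2 u -> cs2 v ->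
  (forall w, w \notin `[- c, c] -> u w = 0 /\ v w = 0) -> 0 < B ->
  \int[mu]_(w in `[- c, c]) (Ec N x w ^+ 2 + Es N x w ^+ 2) <= B ->
  e1 = (Num.sqrt (2 * pi))^-1 * (\int[mu]_w (u w * Ec N x w) - \int[mu]_w (v w * Es N x w)) ->
  e2 = (Num.sqrt (2 * pi))^-1 * (\int[mu]_w (u w * Es N x w) + \int[mu]_w (v w * Ec N x w)) ->
  e1 ^+ 2 + e2 ^+ 2 <= B / (2 * pi) * (\int[mu]_w (u w ^+ 2) + \int[mu]_w (v w ^+ 2)).
Proof.
move=> [iu iu2 _] [iv iv2 _] uv0 B0 hB e1E e2E.
pose K : R := (Num.sqrt (2 * pi))^-1; rewrite -/K in e1E e2E.
have K0 : 0 < K by rewrite invr_gt0 sqrtr_gt0 mulr_gt0// pi_gt0.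
pose chi : R -> R := \1_`[- c, c].
(* X + i Y is (e1 + i e2) times the conjugate of the error pair. Thus e1^2 + e2^2 becomes a real
   pairing of (u, v) with (X, Y), and X^2 + Y^2 is r times the squared error. *)
pose X w := e1 * Ec N x w + e2 * Es N x w; pose Y w := e2 * Ec N x w - e1 * Es N x w.
have iX (g : R -> R) : rint g -> rint (fun w => g w * X w).
  move=> iw; have := rintD (rintZ e1 (rint_cos_errM N 0 x iw)) (rintZ e2 (rint_cos_errM N (- (pi / 2)) x iw)).
  by congr rint; apply/funext => w; rewrite /X; ring.
have iY (g : R -> R) : rint g -> rint (fun w => g w * Y w).
  move=> iw; have := rintB (rintZ e2 (rint_cos_errM N 0 x iw)) (rintZ e1 (rint_cos_errM N (- (pi / 2)) x iw)).
  by congr rint; apply/funext => w; rewrite /Y; ring.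
pose r := e1 ^+ 2 + e2 ^+ 2.
have rE : r = K * \int[mu]_w (u w * X w + v w * Y w).
  have c1 := rint_cos_errM N 0 x iu; have c2 := rint_cos_errM N (- (pi / 2)) x iu.
  have c3 := rint_cos_errM N 0 x iv; have c4 := rint_cos_errM N (- (pi / 2)) x iv.
  rewrite (_ : (fun w => _) = (fun w => (e1 * (u w * Ec N x w) + e2 * (u w * Es N x w)) +
     (e2 * (v w * Ec N x w) - e1 * (v w * Es N x w)))); last first.
    by apply/funext => w; rewrite /X /Y; ring.
  rewrite RintD; [|exact: rintD (rintZ _ c1) (rintZ _ c2)|exact: rintB (rintZ _ c3) (rintZ _ c4)].
  rewrite RintD; [|exact: rintZ|exact: rintZ].
  rewrite RintB; [|exact: rintZ|exact: rintZ].
  rewrite !RintZ//.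
  exact: rotation_sqr e1E e2E.
have ichi : rint chi by exact: rint_indic.
pose Q w := chi w * (Ec N x w ^+ 2 + Es N x w ^+ 2).
have iQ : rint Q.
  have := rintD (rint_cos_errM N 0 x (rint_cos_errM N 0 x ichi))
    (rint_cos_errM N (- (pi / 2)) x (rint_cos_errM N (- (pi / 2)) x ichi)).
  by congr rint; apply/funext => w; rewrite /Q; ring.
have hQ : \int[mu]_w Q w <= B by rewrite Rint_indicM.
pose l := K * B; have l0 : 0 < l by rewrite mulr_gt0.
have pt w : u w * X w + v w * Y w <= 2^-1 * (l * (u w ^+ 2 + v w ^+ 2) + r / l * Q w).
  have XY : X w ^+ 2 + Y w ^+ 2 = r * (Ec N x w ^+ 2 + Es N x w ^+ 2) by rewrite /X /Y /r; ring.
  rewrite /Q /chi indicE mem_setE; case: (boolP (w \in _)) => wc; last first.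
    by have [-> ->] := uv0 _ wc; rewrite !mul0r expr0n/= !mulr0 !addr0 !mulr0.
  rewrite mul1r [r / l * _]mulrAC -XY.
  have h1 := sqr_ge0 (l * u w - X w); have h2 := sqr_ge0 (l * v w - Y w).
  rewrite -subr_ge0 (_ : _ - _ = (2 * l)^-1 * ((l * u w - X w) ^+ 2 + (l * v w - Y w) ^+ 2)).
    by rewrite mulr_ge0 ?invr_ge0 ?addr_ge0// mulr_ge0// ltW.
  by field; rewrite gt_eqF.
have iG : rint (fun w => u w ^+ 2 + v w ^+ 2) by exact: rintD.
have h : r <= K * (2^-1 * (l * (\int[mu]_w (u w ^+ 2) + \int[mu]_w (v w ^+ 2)) + r / l * B)).
  rewrite rE ler_pM2l//; apply: (@le_trans _ _ (\int[mu]_w (2^-1 * (l * (u w ^+ 2 + v w ^+ 2) + r / l * Q w)))).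
    apply: le_Rintegral => //; first exact: rintD (iX _ iu) (iY _ iv).
    exact: rintZ (rintD (rintZ _ iG) (rintZ _ iQ)).
  rewrite RintZ; last exact: rintD (rintZ _ iG) (rintZ _ iQ).
  rewrite RintD; [|exact: rintZ|exact: rintZ].
  rewrite !RintZ// RintD// ler_pM2l ?invr_gt0// lerD2l -rE ler_wpM2l//.
  by apply: divr_ge0; [rewrite addr_ge0 ?sqr_ge0|exact: ltW].
move: h; rewrite -/r; move: (_ + \int[mu]_w _) r {rE pt} => G r h.
have K2 : K ^+ 2 = (2 * pi)^-1 by rewrite exprVn sqr_sqrtr// mulr_ge0// pi_ge0.
have : K * (2^-1 * (l * G + r / l * B)) = 2^-1 * (K ^+ 2 * B * G) + 2^-1 * r.
  by rewrite /l; field; rewrite !gt_eqF.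
rewrite K2 => E1; rewrite {}E1 in h.
have -> : B / (2 * pi) * G = (2 * pi)^-1 * B * G by ring.
exact: le_half h.
Qed.

End ErrorIntegral.

(** * Pointwise error bounds and their integrals over [-c, c] *)

Section ErrorIntegralBounds.
Context {R : realType}.
Notation mu := (@lebesgue_measure R).
Local Notation E := (expR (1 : R)).
Implicit Types (w x c q : R).
Notation Ec N x := (fun w => cos_err N 0 w x).
Notation Es N x := (fun w => cos_err N (- (pi / 2)) w x).
Notation amp q := ((1 + q ^+ 2) / (1 - q ^+ 2) ^+ 2).

Lemma int_itv_pow n c : 0 < c ->
  \int[mu]_(w in `[- c, c]) w ^+ (2 * n) = 2 * c ^+ (2 * n).+1 / (2 * n).+1%:R.
Proof.
move=> c0; pose F := horner ((2 * n).+1%:R^-1 *: 'X ^+ (2 * n).+1 : {poly R}).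
have Fd (x : R) : is_derive x (1 : R) F (x ^+ (2 * n)).
  apply: (is_derive_eq (is_derive_horner _ x)).
  by rewrite derivZ derivXn hornerZ hornerMn hornerXn /= -[x ^+ _ *+ _]mulr_natl mulrA mulVf ?mul1r// pnatr_eq0.
have cF : continuous F by exact: continuous_horner.
rewrite /Rintegral (@continuous_FTC2 _ _ F) /=.
- rewrite /F !hornerZ !hornerXn exprNn (exprS (-1)) exprM sqrrN !expr1n; ring.
- by rewrite gtrN.
- exact/continuous_subspaceT/exprn_continuous.
- split; first by move=> x _; have [] := Fd x.
  + exact/cvg_at_right_filter/cF.
  + exact/cvg_at_left_filter/cF.
- by move=> x _; rewrite derive1E; have [_] := Fd x.
Qed.

Lemma err_int_le N n x c (D : R) : 0 < c ->
  (forall w, `|w| <= c -> Ec N x w ^+ 2 + Es N x w ^+ 2 <= D * w ^+ (2 * n)) ->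
  \int[mu]_(w in `[- c, c]) (Ec N x w ^+ 2 + Es N x w ^+ 2) <= D * (2 * c ^+ (2 * n).+1 / (2 * n).+1%:R).
Proof.
move=> c0 h; have ichi := rint_indic (- c) c.
have cp : continuous (fun w : R => D * w ^+ (2 * n)).
  by move=> w; apply: cvgM; [exact: cvg_cst|exact: exprn_continuous].
have ip (f : R -> R) : continuous f -> mu.-integrable `[- c, c] (EFin \o f).
  move=> cf; apply: continuous_compact_integrable; first exact: segment_compact.
  exact: continuous_subspaceT.
rewrite -int_itv_pow// -RintegralZl//; last exact: (ip _ (@exprn_continuous R (2 * n))).
apply: le_Rintegral => //; last 2 first.
- exact: ip.
- by move=> w /=; rewrite in_itv/= -ler_norml => /h.
have : rint (fun w => \1_`[- c, c] w * (Ec N x w ^+ 2 + Es N x w ^+ 2)).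
  have := rintD (rint_cos_errM N 0 x (rint_cos_errM N 0 x ichi))
    (rint_cos_errM N (- (pi / 2)) x (rint_cos_errM N (- (pi / 2)) x ichi)).
  by congr rint; apply/funext => w; ring.
rewrite [X in _ -> X]integrable_mkcond//; congr (_.-integrable _ _); apply/funext => w.
by rewrite patchE /= indicE; case: (_ \in _); rewrite ?mul1r ?mul0r.
Qed.

Let expr_even_norm n w : w ^+ (2 * n) = (`|w| ^+ n) ^+ 2.
Proof. by rewrite exprM -(real_normK (num_real w)) -!exprM mulnC. Qed.

(** Uses |phi_k| <= 1: the majorant |w|^k / (2k-1)!! has ratio |w| / (2k+1), largest at k = N +
    1. *)
Lemma cos_err_sqr_le N w x q : -1 <= x <= 1 -> 0 <= q < 1 ->
  `|w| <= q * (2 * N.+1 + 1)%:R ->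
  Ec N x w ^+ 2 + Es N x w ^+ 2 <= amp q / odd_fact N.+1 ^+ 2 * w ^+ (2 * N.+1).
Proof.
move=> x1 q01 wq.
have := @cos_err_sqr _ N w x (fun k => `|w| ^+ k / odd_fact k) q x1 q01.
have -> : amp q / odd_fact N.+1 ^+ 2 * w ^+ (2 * N.+1) = amp q * (`|w| ^+ N.+1 / odd_fact N.+1) ^+ 2.
  by rewrite expr_even_norm exprMn exprVn; ring.
apply.
- by move=> k; rewrite divr_ge0 ?exprn_ge0// ltW// odd_fact_gt0.
- move=> k _; rewrite /cos_term ler_pM2r ?invr_gt0 ?odd_fact_gt0//.
  by rewrite ler_piMr ?exprn_ge0// phi_norm_le1.
- move=> k Nk; have n0 : 0 < (2 * k + 1)%:R :> R by rewrite ltr0n addn1.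
  rewrite odd_factS exprS invfM mulrACA ler_wpM2r ?divr_ge0 ?exprn_ge0 ?(ltW (odd_fact_gt0 _))//.
  rewrite ler_pdivrMr// (le_trans wq)// ler_wpM2l//; first by case/andP: q01.
  by rewrite ler_nat leq_add2r leq_mul2l.
Qed.

(** [phi_sqr_le] with M = N + 1 trades one factor |w| for sqrt((2k+3)/e). The ratio of the majorant
    becomes |w| sqrt((2k+5)/(2k+3)) / (2k+1), at most |w| / (2k): hence 2(N+1) and not 2(N+1) + 1 in
    the hypothesis. *)
Lemma cos_err_sqr_le_exp N w x q : (0 < N)%N -> -1 <= x <= 1 -> 0 <= q < 1 ->
  `|w| <= q * (2 * N.+1)%:R -> 4 * w ^+ 2 <= ((2 * N.+1 + 3) * (2 * N.+1 + 5))%:R ->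
  Ec N x w ^+ 2 + Es N x w ^+ 2 <=
    amp q / odd_fact N.+1 ^+ 2 * ((2 * N.+1 + 3)%:R / E) * w ^+ (2 * N).
Proof.
move=> N0 x1 /andP[q0 q1] wq w2.
have e0 := expR_gt0 (1 : R).
pose g k : R := (2 * k + 3)%:R / E; have g0 k : 0 <= g k by rewrite divr_ge0// ltW.
pose s k := `|w| ^+ k.-1 * Num.sqrt (g k) / odd_fact k.
have -> : amp q / odd_fact N.+1 ^+ 2 * ((2 * N.+1 + 3)%:R / E) * w ^+ (2 * N) = amp q * s N.+1 ^+ 2.
  by rewrite /s -/(g N.+1) expr_even_norm !exprMn sqr_sqrtr// exprVn; ring.
have s0 k : 0 <= s k by rewrite divr_ge0 ?mulr_ge0 ?exprn_ge0// ltW// odd_fact_gt0.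
apply: (@cos_err_sqr _ N w x s q) => //; first by rewrite q0.
- move=> k Nk; rewrite /cos_term /s ler_pM2r ?invr_gt0 ?odd_fact_gt0//.
  case: k Nk => // k Nk; rewrite exprSr -mulrA ler_wpM2l ?exprn_ge0//.
  rewrite -(@ler_pXn2r _ 2) ?nnegrE ?mulr_ge0// sqr_sqrtr// exprMn !real_normK ?num_real//.
  exact: (phi_sqr_le w2).
- case=> // k Nk; rewrite /s [k.+2.-1]/= [k.+1.-1]/= (odd_factS k.+1) (exprS _ k) invfM.
  have n0 : 0 < (2 * k.+1 + 1)%:R :> R by rewrite ltr0n addn1.
  have o0 := odd_fact_gt0 (R := R) k.+1.
  have h1 : `|w| * Num.sqrt (g k.+2) / (2 * k.+1 + 1)%:R <= q * Num.sqrt (g k.+1).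
    rewrite ler_pdivrMr//.
    have : (2 * k.+1)%:R * Num.sqrt (g k.+2) <= (2 * k.+1 + 1)%:R * Num.sqrt (g k.+1).
      rewrite -(@ler_pXn2r _ 2) ?nnegrE ?mulr_ge0// !exprMn !sqr_sqrtr// /g !mulrA ler_pM2r ?invr_gt0//.
      rewrite -!natrX -!natrM ler_nat; nia.
    move=> h; have {}h := ler_wpM2l q0 h; rewrite -mulrA [Num.sqrt _ * _]mulrC; apply: le_trans h.
    rewrite mulrA ler_wpM2r// (le_trans wq)// ler_wpM2l// ler_nat leq_mul2l; exact: Nk.
  rewrite [leLHS](_ : _ = `|w| ^+ k / odd_fact k.+1 * (`|w| * Num.sqrt (g k.+2) / (2 * k.+1 + 1)%:R)); last by ring.
  rewrite [leRHS](_ : _ = `|w| ^+ k / odd_fact k.+1 * (q * Num.sqrt (g k.+1))); last by ring.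
  by rewrite ler_wpM2l// divr_ge0 ?exprn_ge0// ltW.
Qed.

End ErrorIntegralBounds.

(** * Explicit bounds for the error integral *)

Section ErrorIntegralFinal.
Context {R : realType}.
Notation mu := (@lebesgue_measure R).
Local Notation E := (expR (1 : R)).
Implicit Types (w x c q : R).
Notation Ec N x := (fun w => cos_err N 0 w x).
Notation Es N x := (fun w => cos_err N (- (pi / 2)) w x).
(* (1 - q^2)^-1 and q (1 - q^2)^-1 are the sums of the even and of the odd powers
   of q. *)
Definition amp q : R := (1 + q ^+ 2) / (1 - q ^+ 2) ^+ 2.

Lemma amp_ge0 q : 0 <= amp q.
Proof. by rewrite /amp divr_ge0 ?addr_ge0 ?sqr_ge0. Qed.

(** 7/19 is slightly above 1/e, and c <= 2N/e keeps all ratios below 1/e. At N = 3 and N = 4 the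
    uniform estimate is too tight for 7/19; there c/(2N+3) <= 1/4 and c/(2N+2) <= 59/200
    respectively. *)
Lemma amp_7_19 : amp (7 / 19) <= 153 / 100.
Proof. by rewrite /amp ler_pdivrMr; [lra|rewrite exprn_gt0//; lra]. Qed.

Lemma amp_59_200 : amp (59 / 200) <= 131 / 100.
Proof. by rewrite /amp ler_pdivrMr; [lra|rewrite exprn_gt0//; lra]. Qed.

Lemma amp_1_4 : amp (1 / 4) <= 121 / 100.
Proof. by rewrite /amp ler_pdivrMr; [lra|rewrite exprn_gt0//; lra]. Qed.

Let natA N : (2 * N.+1 + 3 = 2 * N + 5)%N. Proof. by lia. Qed.
Let natB N : (2 * N.+1 = 2 * N + 2)%N. Proof. by lia. Qed.
Let natC N : ((2 * N.+1).+1 = 2 * N + 3)%N. Proof. by lia. Qed.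
Let nat3 N : (N < 4)%N -> (3 < N.+1)%N -> N = 3%N. Proof. by lia. Qed.

(** What remains of the L^2 estimate, with M = N + 1, once the powers of c and z are cancelled. *)
Lemma growth_bound_L2 M : (2 <= M)%N -> 2 * amp (7 / 19) * growth M <= pi * (2 * M%:R + 1).
Proof.
move=> M2; have p3 := @pi_ge3 R; have M0 : 0 <= M%:R :> R by [].
apply: (@le_trans _ _ (3 * (2 * M%:R + 1))); last by rewrite ler_wpM2r//; lra.
apply: (@le_trans _ _ (306 / 100 * growth M)).
  by have h := amp_7_19; apply: ler_wpM2r; [exact: growth_ge0|lra].
case: (leqP 6 M) => [M6|].
  have := @growth_ge6 R M M6; have : 6 <= M%:R :> R by rewrite ler_nat.
  lra.
case: M M2 M0 => // -[|[|[|[|[|m]]]]]// _ _ _.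
- by have := @growth2 R; lra.
- by have := @growth3 R; lra.
- by have := @growth4 R; lra.
- by have := @growth5 R; lra.
Qed.

(** What remains of the uniform estimate under |phi_k| <= 1: the surplus z^2 is estimated by e c <=
    2N = 2(M - 1), whence the square. *)
Lemma growth_bound_low M q : (2 <= M <= 4)%N -> q = (if (M <= 3)%N then 7 / 19 else 1 / 4) ->
  amp q * growth M * (4 * (M%:R - 1) ^+ 2) <= pi * (2 * M%:R + 1) * (2 * M%:R + 3).
Proof.
move=> M24 ->; have p3 := @pi_ge3 R; have M0 : 0 <= M%:R :> R by [].
apply: (@le_trans _ _ (3 * (2 * M%:R + 1) * (2 * M%:R + 3))); last first.
  by rewrite !ler_wpM2r//; lra.
case: M M24 M0 => [|[|[|[|[|m]]]]]// _ _ /=.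
- by have := ler_pM (amp_ge0 _) (growth_ge0 2) amp_7_19 growth2; lra.
- by have := ler_pM (amp_ge0 _) (growth_ge0 3) amp_7_19 growth3; lra.
- by have := ler_pM (amp_ge0 _) (growth_ge0 4) amp_1_4 growth4; lra.
Qed.

(** What remains of the uniform estimate when w^2 is traded for (2M+3)/e, whence the factor e. A
    linear bound on [growth] is enough here, so [growth_ge6] covers all M >= 6. *)
Lemma growth_bound_high M q : (5 <= M)%N -> q = (if M == 5 then 59 / 200 else 7 / 19) ->
  amp q * growth M * E <= pi * (2 * M%:R - 1).
Proof.
move=> M5 ->; have p3 := @pi_ge3 R; have m5 : 5 <= M%:R :> R by rewrite ler_nat.
have g0 := @growth_ge0 R M; have e1 := @expR1_le R.
apply: (@le_trans _ _ (3 * (2 * M%:R - 1))); last by rewrite ler_wpM2r//; lra.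
apply: (le_trans (ler_wpM2l (mulr_ge0 (amp_ge0 _) g0) e1)).
case: eqP => [M5E|/eqP M6].
  by rewrite {}M5E in g0 *; have := ler_pM (amp_ge0 _) (growth_ge0 5) amp_59_200 growth5; lra.
have M6' : (6 <= M)%N by rewrite ltn_neqAle eq_sym M6.
by have := ler_pM (amp_ge0 _) g0 amp_7_19 (@growth_ge6 R M M6'); lra.
Qed.

Section Fixed.
Variables (N : nat) (c x : R).
Hypotheses (c0 : 0 < c) (hN : E * c <= 2 * N%:R) (x1 : -1 <= x <= 1).

Let e0 : 0 < E. Proof. exact: expR_gt0. Qed.

Let N0 : (0 < N)%N.
Proof.
case: N hN => // h; have : 0 < E * c by rewrite mulr_gt0.
by rewrite ltNge; move: h; rewrite mulr0 => ->.
Qed.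

Let c_le : c <= 1000 / 2718 * (2 * N%:R).
Proof.
have := @expR1_ge R => h; have : 2718 / 1000 * c <= 2 * N%:R by rewrite (le_trans _ hN)// ler_pM2r.
lra.
Qed.

Let n1 : 1 <= N%:R :> R. Proof. by rewrite ler1n. Qed.

Let z : R := E * c / (2 * N + 5)%:R.
Let p : R := ((2 * N + 5)%:R / E) ^+ (2 * N).

Let y_gt0 : 0 < (2 * N + 5)%:R :> R. Proof. by rewrite ltr0n addn_gt0 orbT. Qed.

Let p0 : 0 < p. Proof. by rewrite exprn_gt0// divr_gt0. Qed.

Let cE : c ^+ (2 * N) = z ^+ (2 * N) * p.
Proof. by rewrite /p -exprMn /z; congr (_ ^+ _); field; rewrite !gt_eqF. Qed.

Let gE : growth N.+1 = p * ((2 * N + 5)%:R / E) ^+ 2 / odd_fact N.+1 ^+ 2.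
Proof.
by rewrite /growth natA natB exprD.
Qed.

Let ofE : (odd_fact N.+1 ^+ 2)^-1 = growth N.+1 / (p * ((2 * N + 5)%:R / E) ^+ 2).
Proof. by rewrite gE; field; rewrite !gt_eqF// odd_fact_gt0. Qed.

Let err_low q : 0 <= q < 1 -> c <= q * (2 * N.+1 + 1)%:R ->
  \int[mu]_(w in `[- c, c]) (Ec N x w ^+ 2 + Es N x w ^+ 2) <=
  2 * amp q * growth N.+1 / (2 * N%:R + 3) * (c * z ^+ (2 * N) * z ^+ 2).
Proof.
have m1 := n1.
move=> q01 cq.
have h w : `|w| <= c -> Ec N x w ^+ 2 + Es N x w ^+ 2 <= amp q / odd_fact N.+1 ^+ 2 * w ^+ (2 * N.+1).
  by move=> wc; apply: cos_err_sqr_le => //; exact: le_trans wc cq.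
apply: (le_trans (err_int_le c0 h)).
rewrite ofE natC.
rewrite natr2D (exprD c) cE /z natr2D le_eqVlt; apply/orP; left; apply/eqP.
move: (amp q) (_ ^+ (2 * N)) (growth _) => a b g; field.
by rewrite !gt_eqF//; lra.
Qed.

Let err_high q : 0 <= q < 1 -> c <= q * (2 * N.+1)%:R ->
  \int[mu]_(w in `[- c, c]) (Ec N x w ^+ 2 + Es N x w ^+ 2) <=
  2 * (amp q * growth N.+1 * E) / (2 * N%:R + 1) * (c / (2 * N + 5)%:R * z ^+ (2 * N)).
Proof.
have m1 := n1.
move=> q01 cq.
have h w : `|w| <= c -> Ec N x w ^+ 2 + Es N x w ^+ 2 <=
    amp q / odd_fact N.+1 ^+ 2 * ((2 * N.+1 + 3)%:R / E) * w ^+ (2 * N).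
  move=> wc; apply: cos_err_sqr_le_exp => //; first exact: le_trans wc cq.
  rewrite natrM !natr2D -[N.+1%:R]natr1 -real_normK ?num_real//.
  have wN : `|w| <= N%:R by apply: (le_trans wc); apply: (le_trans c_le); lra.
  have : `|w| ^+ 2 <= N%:R ^+ 2 by rewrite lerXn2r// nnegrE.
  nra.
apply: (le_trans (err_int_le c0 h)).
rewrite ofE natA.
rewrite -[(2 * N).+1%:R]natr1 natrM (exprS c) cE /z natr2D le_eqVlt; apply/orP; left; apply/eqP.
move: (amp q) (_ ^+ (2 * N)) (growth _) => a b g; field.
by rewrite !gt_eqF//; lra.
Qed.

Let z0 : 0 < z. Proof. by rewrite divr_gt0// mulr_gt0. Qed.

(** The factor is pi and not 2 pi because the norm over (-1, 1) brings in the length 2 of the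
    interval. *)
Lemma err_int_L2 : \int[mu]_(w in `[- c, c]) (Ec N x w ^+ 2 + Es N x w ^+ 2) <=
  pi * (c * z ^+ (2 * N.+1)).
Proof.
have m1 := n1.
have -> : c * z ^+ (2 * N.+1) = c * z ^+ (2 * N) * z ^+ 2.
  by rewrite -mulrA -exprD natB.
apply: (le_trans (@err_low (7 / 19) _ _)); first by apply/andP; split; lra.
  by rewrite natr2D -[N.+1%:R]natr1; apply: (le_trans c_le); lra.
apply: ler_wpM2r; first by rewrite !mulr_ge0 ?exprn_ge0// ltW.
rewrite ler_pdivrMr; last lra.
have := @growth_bound_L2 N.+1 N0; rewrite -[N.+1%:R]natr1.
by rewrite (_ : 2 * (N%:R + 1) + 1 = 2 * N%:R + 3 :> R)//; ring.
Qed.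

(** For N >= 4 the decay of w phi_k is used; for N <= 3 the bound |phi_k| <= 1 is sharp enough. *)
Lemma err_int_inf : \int[mu]_(w in `[- c, c]) (Ec N x w ^+ 2 + Es N x w ^+ 2) <=
  2 * pi * (c / (2 * N + 5)%:R * z ^+ (2 * N)).
Proof.
have m1 := n1.
have zN0 : 0 <= c / (2 * N + 5)%:R * z ^+ (2 * N).
  by apply: mulr_ge0; [rewrite divr_ge0 ?ltW|rewrite exprn_ge0// ltW].
case: (leqP 4 N) => N4.
  pose q : R := if N.+1 == 5%N then 59 / 200 else 7 / 19.
  apply: (le_trans (@err_high q _ _)).
  - by rewrite /q; case: ifP => _; apply/andP; split; lra.
  - rewrite natrM -[N.+1%:R]natr1; apply: (le_trans c_le); rewrite /q; case: eqP => [[->]|_]; lra.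
  apply: ler_wpM2r => //; rewrite ler_pdivrMr; last lra.
  have := @growth_bound_high N.+1 q N4 erefl; rewrite -[N.+1%:R]natr1.
  by rewrite (_ : 2 * (N%:R + 1) - 1 = 2 * N%:R + 1 :> R); [lra|ring].
pose q : R := if (N.+1 <= 3)%N then 7 / 19 else 1 / 4.
apply: (le_trans (@err_low q _ _)).
- by rewrite /q; case: ifP => _; apply/andP; split; lra.
- rewrite natr2D -[N.+1%:R]natr1; apply: (le_trans c_le); rewrite /q; case: ifP => [_|/negbT]; first lra.
  rewrite -ltnNge => N3; have -> := nat3 N4 N3; lra.
have h := @growth_bound_low N.+1 q _ erefl; rewrite -[N.+1%:R]natr1 in h.
have {}h : amp q * growth N.+1 * (4 * (N%:R + 1 - 1) ^+ 2) <= pi * (2 * (N%:R + 1) + 1) * (2 * (N%:R + 1) + 3).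
  by apply: h; apply/andP; split; [exact: N0|exact: N4].
have zz : c * z ^+ (2 * N) * z ^+ 2 = (c / (2 * N + 5)%:R * z ^+ (2 * N)) * ((E * c) ^+ 2 / (2 * N + 5)%:R).
  by rewrite {2}/z; field; rewrite gt_eqF.
rewrite zz mulrA mulrAC; apply: ler_wpM2r => //.
have ec : (E * c) ^+ 2 <= (2 * N%:R) ^+ 2 by rewrite lerXn2r// nnegrE// mulr_ge0// ltW.
have a0 : 0 <= amp q * growth N.+1.
  by rewrite mulr_ge0 ?growth_ge0 ?amp_ge0.
rewrite natr2D mulrAC mulrA ler_pdivrMr; last lra.
rewrite ler_pdivrMr; last lra.
have := ler_wpM2l a0 ec; nra.
Qed.

End Fixed.

End ErrorIntegralFinal.

(** * From the representation of f to its projection *)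

Section Projection.
Local Open Scope complex_scope.
Context {R : realType}.
Notation mu := (@lebesgue_measure R).
Implicit Types (u v h : R -> R) (f : R -> R[i]).
Notation ct u := (ctr u 0).
Notation st u := (ctr u (- (pi / 2))).
Notation K := ((Num.sqrt (2 * pi))^-1 : R).
Notation P k := (@legendre R k).
Notation chi := (\1_(`]- 1, 1[%classic) : R -> R).

Let coef h k : R := \int[mu]_(t in `[- 1, 1]) (chi t * h t * nlegendre k t).

Let proj N h x : R := \sum_(0 <= k < N.+1) coef h k * (nlegendre k x * chi x).

Lemma legendre_projE N f x : legendre_proj N f x =
  proj N (fun t => complex.Re (f t)) x +i* proj N (fun t => complex.Im (f t)) x.
Proof.
rewrite /legendre_proj /proj; elim: N.+1 => [|n IH]; first by rewrite !big_nil.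
rewrite !big_nat_recr//= IH; set a := innerC _ _ _.
have -> : a = coef (fun t => complex.Re (f t)) n +i* coef (fun t => complex.Im (f t)) n.
  rewrite /a /innerC /Cintegral /coef; congr (_ +i* _); congr fine; apply: eq_integral => t _; congr EFin.
  - by case: (f t) => p q /=; ring.
  - by case: (f t) => p q /=; ring.
by apply/eqP; rewrite eq_complex /=; apply/andP; split; apply/eqP; ring.
Qed.

Lemma meas_nlegendre k : measurable_fun [set: R] (nlegendre k : R -> R).
Proof.
apply: continuous_measurable_fun => x; apply: cvgM; first exact: cvg_cst.
exact: continuous_horner.
Qed.

Lemma meas_proj N h : measurable_fun [set: R] (proj N h).
Proof.
apply: measurable_sum => k; apply: measurable_funM => //; apply: measurable_funM => //.
exact: meas_nlegendre.
Qed.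

(** Under the integral h may be replaced with h', and the open interval of the indicator with the
    closed one, since 1 and -1 form a null set. *)
Lemma coef_ae h h' (M : R) k : measurable_fun [set: R] h -> measurable_fun [set: R] h' ->
  (forall x, `|h' x| <= M) ->
  {ae mu, forall x, h x = h' x} -> coef h k = Num.sqrt (k%:R + 1 / 2) * I11 (fun t => h' t * (P k).[t]).
Proof.
move=> mh mh' h'M hh'; have mP : measurable_fun [set: R] (horner (P k)).
  by apply: continuous_measurable_fun; exact: continuous_horner.
have m11 : measurable_fun [set: R] (\1_`[- 1, 1] : R -> R) by exact: measurable_indic.
rewrite /coef /I11 -!Rint_indicM.
transitivity (\int[mu]_t (Num.sqrt (k%:R + 1 / 2) * (\1_`[- 1, 1] t * (h' t * (P k).[t])))).
  apply: ae_eq_Rint.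
  - apply: measurable_funM => //; apply: measurable_funM; last exact: meas_nlegendre.
    by apply: measurable_funM => //; exact: measurable_indic.
  - by apply: measurable_funM => //; apply: measurable_funM => //; exact: measurable_funM.
  - have ne (a : R) : {ae mu, forall t, t != a}.
      exists [set a]; split => //; first exact: lebesgue_measure_set1.
      by move=> t /= /negP; rewrite negbK => /eqP.
    have n2 := @filterI _ _ (ae_filter_ringOfSetsType mu) _ _ (ne (-1)) (ne 1).
    apply: (@filterS2 _ _ (ae_filter_ringOfSetsType mu) _ _ _ _ hh' n2) => t /= -> [tN1 t1].
    rewrite /nlegendre !indicE; case: (boolP (t \in `[- 1, 1]%classic)) => [|_]; last by rewrite !mul0r mulr0.
    rewrite inE/= in_itv/= => /andP[a b]; rewrite mem_set/=; first ring.
    by rewrite in_itv/= !lt_neqAle a b eq_sym tN1 t1.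
rewrite RintZ//; have := rintMb (rint_leg_ind k) mh' h'M.
by congr rint; apply/funext => t; rewrite /leg_ind; ring.
Qed.

Lemma proj_ae N h h' (M : R) x : measurable_fun [set: R] h -> measurable_fun [set: R] h' ->
  (forall x, `|h' x| <= M) ->
  {ae mu, forall x, h x = h' x} -> -1 < x < 1 ->
  proj N h x = \sum_(0 <= k < N.+1) (k%:R + 1 / 2) * I11 (fun t => h' t * (P k).[t]) * (P k).[x].
Proof.
move=> mh mh' h'M hh' x1; apply: eq_bigr => k _; rewrite (coef_ae _ mh mh' h'M hh').
have k0 : 0 <= k%:R + 1 / 2 :> R by have := ler0n R k; lra.
rewrite indicE mem_set/= ?in_itv//= mulr1 /nlegendre.
by rewrite mulrACA -expr2 sqr_sqrtr//; ring.
Qed.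

Lemma I11_ctrD u v a b s t k : rint u -> rint v ->
  I11 (fun x => (s * (ctr u a x) + t * (ctr v b x)) * (P k).[x]) =
  s * I11 (fun x => ctr u a x * (P k).[x]) + t * I11 (fun x => ctr v b x * (P k).[x]).
Proof.
move=> iu iv; rewrite /I11 -!Rint_indicM.
have i1 (w : R -> R) (d : R) : rint w -> rint (fun x => \1_`[- 1, 1] x * (ctr w d x * (P k).[x])).
  move=> iw; have := rintMb (rint_leg_ind k) (meas_ctr d iw) (fun x => ctr_bound d x iw).
  by congr rint; apply/funext => x; rewrite /leg_ind; ring.
rewrite -(RintZ s (i1 _ a iu)) -(RintZ t (i1 _ b iv)) -RintD.
- by congr Rintegral; apply/funext => x; ring.
- exact/rintZ/i1.
- exact/rintZ/i1.
Qed.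

Let alg_term (k r a b p : R) : k * (r * a + - r * b) * p = r * (k * a * p - k * b * p).
Proof. by ring. Qed.

Let alg_termD (k r a b p : R) : k * (r * a + r * b) * p = r * (k * a * p + k * b * p).
Proof. by ring. Qed.

Let alg_err (r a b a' b' : R) : r * (a - b) - r * (a' - b') = r * (a - a' - (b - b')).
Proof. by ring. Qed.

Let alg_errD (r a b a' b' : R) : r * (a + b) - r * (a' + b') = r * (a - a' + (b - b')).
Proof. by ring. Qed.

(** Wherever both identities for f hold, f(x) is a combination of transforms; the Legendre
    coefficients see only the a.e. class, and [ctr_err] turns each transform minus its projection
    into an integral of [cos_err]. *)
Lemma proj_err N f u v : L2C f -> rint u -> rint v ->
  {ae mu, forall x, complex.Re (f x) = K * (ct u x - st v x)} ->
  {ae mu, forall x, complex.Im (f x) = K * (st u x + ct v x)} ->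
  {ae mu, forall x, -1 < x < 1 -> f x - legendre_proj N f x =
     (K * (\int[mu]_w (u w * cos_err N 0 w x) - \int[mu]_w (v w * cos_err N (- (pi / 2)) w x))) +i*
     (K * (\int[mu]_w (u w * cos_err N (- (pi / 2)) w x) + \int[mu]_w (v w * cos_err N 0 w x)))}.
Proof.
move=> [m1 m2 _] iu iv h1 h2.
have mc (w : R -> R) a : rint w -> measurable_fun [set: R] (ctr w a) by move=> iw; exact: meas_ctr.
have mF1 : measurable_fun [set: R] (fun x => K * (ct u x - st v x)).
  by apply: measurable_funM => //; apply: measurable_funB; exact: mc.
have mF2 : measurable_fun [set: R] (fun x => K * (st u x + ct v x)).
  by apply: measurable_funM => //; apply: measurable_funD; exact: mc.
have cb (w : R -> R) a x : rint w -> `|ctr w a x| <= \int[mu]_t `|w t| by move=> iw; exact: ctr_bound.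
have b1 x : `|K * (ct u x - st v x)| <= `|K| * (\int[mu]_t `|u t| + \int[mu]_t `|v t|).
  by rewrite normrM ler_wpM2l// (le_trans (ler_normB _ _))// lerD// cb.
have b2 x : `|K * (st u x + ct v x)| <= `|K| * (\int[mu]_t `|u t| + \int[mu]_t `|v t|).
  by rewrite normrM ler_wpM2l// (le_trans (ler_normD _ _))// lerD// cb.
have pt x : -1 < x < 1 -> complex.Re (f x) = K * (ct u x - st v x) ->
    complex.Im (f x) = K * (st u x + ct v x) -> f x - legendre_proj N f x =
     (K * (\int[mu]_w (u w * cos_err N 0 w x) - \int[mu]_w (v w * cos_err N (- (pi / 2)) w x))) +i*
     (K * (\int[mu]_w (u w * cos_err N (- (pi / 2)) w x) + \int[mu]_w (v w * cos_err N 0 w x))).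
  move=> x1 r1 r2; rewrite legendre_projE (proj_ae N m1 mF1 b1 h1 x1) (proj_ae N m2 mF2 b2 h2 x1).
  have e1 : \sum_(0 <= k < N.+1) (k%:R + 1 / 2) * I11 (fun t => K * (ct u t - st v t) * (P k).[t]) * (P k).[x] =
     K * (\sum_(0 <= k < N.+1) (k%:R + 1 / 2) * I11 (fun t => ct u t * (P k).[t]) * (P k).[x] -
      \sum_(0 <= k < N.+1) (k%:R + 1 / 2) * I11 (fun t => st v t * (P k).[t]) * (P k).[x]).
    rewrite -sumrB mulr_sumr; apply: eq_bigr => k _.
    rewrite (@eq_I11 _ _ (fun t => (K * ct u t + (- K) * st v t) * (P k).[t])); last by move=> t; ring.
    by rewrite I11_ctrD//; exact: alg_term.
  have e2 : \sum_(0 <= k < N.+1) (k%:R + 1 / 2) * I11 (fun t => K * (st u t + ct v t) * (P k).[t]) * (P k).[x] =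
     K * (\sum_(0 <= k < N.+1) (k%:R + 1 / 2) * I11 (fun t => st u t * (P k).[t]) * (P k).[x] +
      \sum_(0 <= k < N.+1) (k%:R + 1 / 2) * I11 (fun t => ct v t * (P k).[t]) * (P k).[x]).
    rewrite -big_split/= mulr_sumr; apply: eq_bigr => k _.
    rewrite (@eq_I11 _ _ (fun t => (K * st u t + K * ct v t) * (P k).[t])); last by move=> t; ring.
    by rewrite I11_ctrD//; exact: alg_termD.
  rewrite e1 e2 -!ctr_err//; move: r1 r2; case: (f x) => p q /= -> ->.
  by apply/eqP; rewrite eq_complex /=; apply/andP; split; apply/eqP; [exact: alg_err|exact: alg_errD].
apply: (@filterS2 _ _ (ae_filter_ringOfSetsType mu) _ _ _ _ h1 h2) => x /= r1 r2 x1; exact: pt.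
Qed.

Lemma proj_err_nsq N f (c B : R) : 0 < c -> bandlimited c f -> 0 < B ->
  (forall x, -1 <= x <= 1 -> \int[mu]_(w in `[- c, c])
     (cos_err N 0 w x ^+ 2 + cos_err N (- (pi / 2)) w x ^+ 2) <= B) ->
  {ae mu, forall x, -1 < x < 1 ->
    nsq (f x - legendre_proj N f x) <= B / (2 * pi) * \int[mu]_t nsq (f t)}.
Proof.
move=> c0 bf B0 hB; have [L2f _] := bf.
have [u [v [[cu cv] uv0 Fle h1 h2]]] := bandlimited_repr c0 bf.
have [iu _ _] := cu; have [iv _ _] := cv.
apply: (@filterS _ _ (ae_filter_ringOfSetsType mu) _ _ _ (proj_err N L2f iu iv h1 h2)) => x /= h x1.
rewrite {}h // /nsq /=; have x11 : -1 <= x <= 1 by case/andP: x1 => a b; rewrite !ltW.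
apply: (le_trans (@err_sqr_le _ N x u v c B _ _ cu cv uv0 B0 (hB x x11) erefl erefl)).
by apply: ler_wpM2l => //; rewrite divr_ge0 ?mulr_ge0 ?pi_ge0// ltW.
Qed.

Lemma nsq_int_ge0 f : 0 <= \int[mu]_t nsq (f t).
Proof. by apply: Rintegral_ge0 => t _; exact: nsq_ge0. Qed.

Lemma meas_nsq_err N f : L2C f ->
  measurable_fun [set: R] (fun x => nsq (f x - legendre_proj N f x)).
Proof.
move=> [m1 m2 _]; rewrite (_ : (fun x => _) = (fun x =>
  (complex.Re (f x) - proj N (fun t => complex.Re (f t)) x) ^+ 2 +
  (complex.Im (f x) - proj N (fun t => complex.Im (f t)) x) ^+ 2)).
  apply: measurable_funD; apply: measurable_funX; apply: measurable_funB => //; exact: meas_proj.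
by apply/funext => x; rewrite legendre_projE /nsq; case: (f x).
Qed.

Lemma half_pi_cancel (p x y : R) : p != 0 -> p * x / (2 * p) * y = 2^-1 * (x * y).
Proof. by move=> p0; field. Qed.

Lemma LpnormC_oo_le D f (r : R) : 0 <= r -> {ae mu, forall x, D x -> nsq (f x) <= r ^+ 2} ->
  (LpnormC +oo D f <= r%:E)%E.
Proof.
(* By definition the norm at +oo is 0 when the whole space is null; that branch only asks for r >=
   0. *)
move=> r0 h; rewrite /LpnormC unlock; case: ifP => _; last by rewrite lee_fin.
apply/ess_supP; apply: (@filterS _ _ (ae_filter_ringOfSetsType mu) _ _ _ h) => x /= hx.
rewrite patchE; case: ifPn => [|_]; last by rewrite abse0 lee_fin.
rewrite inE => /hx; rewrite -normc_sqr lee_fin => h2.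
rewrite ger0_norm; last by case: (f x) => a b; exact: sqrtr_ge0.
by move: h2; rewrite ler_pXn2r// nnegrE//; case: (f x) => a b; exact: sqrtr_ge0.
Qed.

Lemma LpnormC2_le D f (r s : R) : measurable D -> 0 <= r -> 0 <= s -> (mu D <= s%:E)%E ->
  measurable_fun D (fun x => nsq (f x)) ->
  {ae mu, forall x, D x -> nsq (f x) <= r} -> (LpnormC 2%:E D f <= (Num.sqrt (s * r))%:E)%E.
Proof.
move=> mD r0 s0 mus mf h; rewrite LpnormC2E//.
rewrite -powR12_sqrt ?mulr_ge0// -poweR_EFin.
apply: gt0_ler_poweR; rewrite ?invr_ge0//.
- by rewrite in_itv/= leey andbT integral_ge0// => x _; rewrite lee_fin nsq_ge0.
- by rewrite in_itv/= leey andbT lee_fin mulr_ge0.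
apply: (@le_trans _ _ (\int[mu]_(x in D) (r%:E))%E).
  apply: ae_ge0_le_integral => //.
  - by move=> x _; rewrite lee_fin nsq_ge0.
  - exact/measurable_EFinP.
rewrite integral_cst// mulrC EFinM lee_wpmul2l// lee_fin.
Qed.

End Projection.

Theorem theorem3p2 (R : realType) (c : R) (hc : 0 < c)
    (f : R -> complex R) (hf : bandlimited c f)
    (N : nat) (hN : expR 1 * c / 2 <= N%:R) :
  (LpnormC +oo%E `](- 1)%R, 1%R[%classic (fun x => f x - legendre_proj N f x)%R
     <= (Num.sqrt (c / (2 * N + 5)%:R)
         * (expR 1 * c / (2 * N + 5)%:R) ^+ N)%:E
        * LpnormC 2%:E [set: R] f)%E
  /\
  (LpnormC 2%:E `](- 1)%R, 1%R[%classic (fun x => f x - legendre_proj N f x)%R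
     <= (Num.sqrt c * (expR 1 * c / (2 * N + 5)%:R) ^+ N.+1)%:E
        * LpnormC 2%:E [set: R] f)%E.
Proof.
have [L2f _] := hf; have [m1 m2 _] := L2f; have [_ _ inf] := L2C_rint L2f.
have hN' : expR 1 * c <= 2 * N%:R by move: hN; rewrite ler_pdivrMr// [N%:R * _]mulrC.
rewrite LpnormC2_rint//; set F := \int[_]_t _; have F0 : 0 <= F by exact: nsq_int_ge0.
set z := expR 1 * c / (2 * N + 5)%:R.
have z0 : 0 < z by rewrite divr_gt0 ?mulr_gt0 ?expR_gt0// ltr0n addn_gt0 orbT.
have y0 : 0 < c / (2 * N + 5)%:R by rewrite divr_gt0// ltr0n addn_gt0 orbT.
have p0 := pi_gt0 R.
have sq (a b : R) n : 0 <= a -> 0 <= b -> (Num.sqrt a * z ^+ n * Num.sqrt b) ^+ 2 = a * z ^+ (2 * n) * b.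
  by move=> a0 b0; rewrite 2!exprMn !sqr_sqrtr// -exprM [(n * 2)%N]mulnC.
split.
  rewrite -EFinM; apply: LpnormC_oo_le; first by rewrite !mulr_ge0 ?sqrtr_ge0 ?exprn_ge0// ltW.
  rewrite sq// ?ltW//.
  have B0 : 0 < 2 * pi * (c / (2 * N + 5)%:R * z ^+ (2 * N)) by rewrite !mulr_gt0 ?exprn_gt0.
  have := proj_err_nsq hc hf B0 (fun x => err_int_inf hc hN').
  rewrite (_ : 2 * pi * _ / (2 * pi) = c / (2 * N + 5)%:R * z ^+ (2 * N)); last first.
    by rewrite mulrAC mulfV ?mul1r// mulf_neq0// gt_eqF.
  by apply: (@filterS _ _ (ae_filter_ringOfSetsType _)) => x /= h xD; apply: h; rewrite in_itv in xD.
have B0 : 0 < pi * (c * z ^+ (2 * N.+1)) by rewrite !mulr_gt0 ?exprn_gt0.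
have := proj_err_nsq hc hf B0 (fun x => err_int_L2 hc hN').
rewrite -/F (_ : pi * _ / (2 * pi) * F = 2^-1 * (c * z ^+ (2 * N.+1) * F)); last first.
  by apply: half_pi_cancel; rewrite gt_eqF.
move=> h; have r0 : 0 <= 2^-1 * (c * z ^+ (2 * N.+1) * F).
  by rewrite !mulr_ge0 ?invr_ge0 ?exprn_ge0// ltW.
(* The 2 is the length of (-1, 1); it cancels the 1/2 left by pi / (2 pi). *)
rewrite -EFinM (_ : Num.sqrt c * z ^+ N.+1 * Num.sqrt F = Num.sqrt (2 * (2^-1 * (c * z ^+ (2 * N.+1) * F)))); last first.
  rewrite mulrA mulfV// mul1r -sq ?(ltW hc)// sqrtr_sqr ger0_norm//.
  by rewrite !mulr_ge0 ?sqrtr_ge0 ?exprn_ge0// ltW.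
apply: LpnormC2_le => //.
- rewrite lebesgue_measure_itv/= lte_fin ifT; last by lra.
  by rewrite -EFinB lee_fin; lra.
- by apply: measurable_funTS; exact: meas_nsq_err.
Qed.
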